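(* Assume the standing setup (A1)–(A2) and let $\eta>0$ with $b<\eta<a$ satisfy the gap condition $\rho:=K\left(\frac{1}{\eta-b}+\frac{1}{a-\eta}\right)<1$. Then for every $\omega\in\Omega$ and every $(\hat x_0,\hat y_0)\in\mathbb{R}^n\times\mathbb{R}^m$, $$\mathcal{W}_\eta((\hat x_0,\hat y_0),\omega)=\{(\xi,\,l(\xi,(\hat x_0,\hat y_0),\omega)) : \xi\in\mathbb{R}^n\},$$ where $$l(\xi,(\hat x_0,\hat y_0),\omega)=\hat y_0+\int_{-\infty}^0 e^{-Bs+\int_s^0 z(\theta_\tau\omega)d\tau}\,\Delta G(u(s),v(s),\theta_s\omega)\,ds,$$ with $(u,v)=\phi(\cdot,\omega,(\hat x_0,\hat y_0);\xi-\hat x_0)$ the unique solution in $C^-_\eta$ of the integral system $$u(t)=e^{At+\int_0^t z(\theta_\tau\omega)d\tau}(\xi-\hat x_0)+\int_0^t e^{A(t-s)+\int_s^t z(\theta_\tau\omega)d\tau}\Delta F(u(s),v(s),\theta_s\omega)\,ds,\quad v(t)=\int_{-\infty}^t e^{B(t-s)+\int_s^t z(\theta_\tau\omega)d\tau}\Delta G(u(s),v(s),\theta_s\omega)\,ds,\ t\le0.$$ Moreover $\xi\mapsto l(\xi,(\hat x_0,\hat y_0),\omega)$ is Lipschitz with $$\mathrm{Lip}\,l\le\frac{K}{(\eta-b)\left(1-K\left(\frac{1}{\eta-b}+\frac{1}{a-\eta}\right)\right)}.$$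
   Context: Standing setup: $1<\alpha<2$; $\Omega$ is a $\{\theta_t\}$-invariant full-measure set of càdlàg paths $\omega:\mathbb{R}\to\mathbb{R}$ ($\omega(0)=0$) of a two-sided scalar symmetric $\alpha$-stable Lévy motion, with $\theta_t\omega=\omega(\cdot+t)-\omega(t)$, on which $z(\omega)=-\int_{-\infty}^0e^\tau\omega(\tau)d\tau$ exists, $t\mapsto z(\theta_t\omega)$ is càdlàg, $\lim_{t\to\pm\infty}|z(\theta_t\omega)|/|t|=0$ and $\lim_{t\to\pm\infty}\frac1t\int_0^tz(\theta_\tau\omega)d\tau=0$. (A1) $A$ is a real $n\times n$ matrix and $B$ a real $m\times m$ matrix with $|e^{At}x|\le e^{at}|x|$ for $t\le0$ and $|e^{Bt}y|\le e^{bt}|y|$ for $t\ge 0$, where $b<0<a$. (A2) $f:\mathbb{R}^n\times\mathbb{R}^m\to\mathbb{R}^n$, $g:\mathbb{R}^n\times\mathbb{R}^m\to\mathbb{R}^m$ satisfy $f(0,0)=0$, $g(0,0)=0$, $|f(x_1,y_1)-f(x_2,y_2)|\le K(|x_1-x_2|+|y_1-y_2|)$ and the same for $g$. Put $F(x,y,\omega)=e^{-z(\omega)}f(e^{z(\omega)}x,e^{z(\omega)}y)$, $G(x,y,\omega)=e^{-z(\omega)}g(e^{z(\omega)}x,e^{z(\omega)}y)$. The random system (RDE) is $\frac{d\hat x}{dt}=A\hat x+F(\hat x,\hat y,\theta_t\omega)+z(\theta_t\omega)\hat x$, $\frac{d\hat y}{dt}=B\hat y+G(\hat x,\hat y,\theta_t\omega)+z(\theta_t\omega)\hat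 y$; $\varphi(t,\omega,(\hat x_0,\hat y_0))=(\hat x(t),\hat y(t))$ denotes its (Carathéodory) solution, defined for all $t\in\mathbb{R}$, with $(\hat x(0),\hat y(0))=(\hat x_0,\hat y_0)$. $|\cdot|$ is the Euclidean norm. For fixed $\omega$ and $\eta\in\mathbb{R}$, $C^-_\eta$ is the Banach space of continuous $\phi=(u,v):(-\infty,0]\to\mathbb{R}^n\times\mathbb{R}^m$ with $\|\phi\|_{C^-_\eta}=\sup_{t\le0}e^{-\eta t-\int_0^tz(\theta_\tau\omega)d\tau}|u(t)|+\sup_{t\le0}e^{-\eta t-\int_0^tz(\theta_\tau\omega)d\tau}|v(t)|<\infty$. Given a base point $(\hat x_0,\hat y_0)$ with orbit $(\hat x(t),\hat y(t))=\varphi(t,\omega,(\hat x_0,\hat y_0))$, define $\Delta F(u,v,\theta_t\omega)=F(u+\hat x(t),v+\hat y(t),\theta_t\omega)-F(\hat x(t),\hat y(t),\theta_t\omega)$ and $\Delta G$ analogously with $G$. The set $\mathcal{W}_\eta((\hat x_0,\hat y_0),\omega)$ (the unstable fiber through $(\hat x_0,\hat y_0)$) is the set of all $(\hat x_0^*,\hat y_0^* )\in\mathbb{R}^n\times\mathbb{R}^m$ such that the function $t\mapsto\varphi(t,\omega,(\hat x_0^*,\hat y_0^* ))-\varphi(t,\omega,(\hat x_0,\hat y_0))$, $t\le0$, belongs to $C^-_\eta$. *)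

(* Defs.v *)
From Stdlib Require Import Reals ClassicalEpsilon Factorial.
From mathcomp Require Import all_boot.
Open Scope R_scope.

Definition vec (n : nat) := 'I_n -> R.
Definition mat (n : nat) := 'I_n -> 'I_n -> R.

Definition vadd {n} (x y : vec n) : vec n := fun i => x i + y i.
Definition vsub {n} (x y : vec n) : vec n := fun i => x i - y i.
Definition vscale {n} (c : R) (x : vec n) : vec n := fun i => c * x i.
Definition vnorm {n} (x : vec n) : R := sqrt (\big[Rplus/0]_(i < n) (x i * x i)).

Definition mulmv {n} (A : mat n) (x : vec n) : vec n :=
  fun i => \big[Rplus/0]_(j < n) (A i j * x j).
Definition mmul {n} (A B : mat n) : mat n :=
  fun i j => \big[Rplus/0]_(k < n) (A i k * B k j).
Definition mid (n : nat) : mat n := fun i j => if i == j then 1 else 0.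
Fixpoint mpow {n} (A : mat n) (k : nat) : mat n :=
  match k with O => mid n | S k' => mmul A (mpow A k') end.

Definition mexp {n} (A : mat n) (t : R) : mat n :=
  fun i j => epsilon (inhabits 0)
    (fun r => infinite_sum (fun k => t ^ k / INR (fact k) * mpow A k i j) r).

(* signed Riemann integral over [a,b] (or -[b,a] if b<a) exists and equals I *)
Definition has_int (h : R -> R) (a b I : R) : Prop :=
  exists pr : Riemann_integrable h a b, RiemannInt pr = I.
Definition Rint (h : R -> R) (a b : R) : R := epsilon (inhabits 0) (has_int h a b).
Definition has_int_neginf (h : R -> R) (b I : R) : Prop :=
  (forall a, a <= b -> exists J, has_int h a b J) /\
  (forall eps, eps > 0 -> exists M, forall a J, a <= M -> a <= b -> has_int h a b J ->
      Rabs (J - I) < eps).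
Definition Rint_neginf (h : R -> R) (b : R) : R :=
  epsilon (inhabits 0) (has_int_neginf h b).

Definition cadlag (h : R -> R) : Prop :=
  forall t,
    (forall eps, eps > 0 -> exists d, d > 0 /\
        forall s, t <= s < t + d -> Rabs (h s - h t) < eps) /\
    (exists L, forall eps, eps > 0 -> exists d, d > 0 /\
        forall s, t - d < s < t -> Rabs (h s - L) < eps).

Definition theta (t : R) (w : R -> R) : R -> R := fun s => w (s + t) - w t.
Definition zfun (w : R -> R) : R := - Rint_neginf (fun tau => exp tau * w tau) 0.
Definition Zt (w : R -> R) (t : R) : R := zfun (theta t w).

Definition in_Omega (w : R -> R) : Prop :=
  w 0 = 0 /\ cadlag w /\
  (forall t, exists I, has_int_neginf (fun tau => exp tau * theta t w tau) 0 I) /\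
  cadlag (Zt w) /\
  (forall eps, eps > 0 -> exists T, T > 0 /\ forall t, Rabs t >= T ->
       Rabs (Zt w t) / Rabs t < eps) /\
  (forall eps, eps > 0 -> exists T, T > 0 /\ forall t, Rabs t >= T ->
       Rabs (Rint (Zt w) 0 t / t) < eps).

(* F(x,y,omega') with z(omega') = zz :  e^{-zz} f(e^{zz} x, e^{zz} y) *)
Definition Fw {n m k} (f : vec n -> vec m -> vec k) (zz : R) (x : vec n) (y : vec m)
  : vec k := vscale (exp (- zz)) (f (vscale (exp zz) x) (vscale (exp zz) y)).

(* (X,Y) is a (Caratheodory) solution of (RDE) on all of R with (X,Y)(0)=(x0,y0) *)
Definition is_rde_sol {n m} (A : mat n) (B : mat m)
  (f : vec n -> vec m -> vec n) (g : vec n -> vec m -> vec m) (w : R -> R)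
  (x0 : vec n) (y0 : vec m) (X : R -> vec n) (Y : R -> vec m) : Prop :=
  X 0 = x0 /\ Y 0 = y0 /\
  forall t,
    (forall i, has_int (fun s => mulmv A (X s) i + Fw f (Zt w s) (X s) (Y s) i
                                + Zt w s * X s i) 0 t (X t i - x0 i)) /\
    (forall j, has_int (fun s => mulmv B (Y s) j + Fw g (Zt w s) (X s) (Y s) j
                                + Zt w s * Y s j) 0 t (Y t j - y0 j)).

Definition phi {n m} (A : mat n) (B : mat m)
  (f : vec n -> vec m -> vec n) (g : vec n -> vec m -> vec m) (w : R -> R)
  (x0 : vec n) (y0 : vec m) : (R -> vec n) * (R -> vec m) :=
  epsilon (inhabits ((fun _ _ => 0), (fun _ _ => 0)))
    (fun XY => is_rde_sol A B f g w x0 y0 XY.1 XY.2).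

Definition cont_neg {n} (u : R -> vec n) : Prop :=
  forall t, t <= 0 -> forall eps, eps > 0 -> exists d, d > 0 /\
    forall s, s <= 0 -> Rabs (s - t) < d -> vnorm (vsub (u s) (u t)) < eps.

Definition wgt (w : R -> R) (eta t : R) : R := exp (- eta * t - Rint (Zt w) 0 t).

Definition in_Cneg {n m} (w : R -> R) (eta : R) (u : R -> vec n) (v : R -> vec m)
  : Prop :=
  cont_neg u /\ cont_neg v /\
  exists M, forall t, t <= 0 ->
     wgt w eta t * vnorm (u t) <= M /\ wgt w eta t * vnorm (v t) <= M.

Definition Wfiber {n m} (A : mat n) (B : mat m)
  (f : vec n -> vec m -> vec n) (g : vec n -> vec m -> vec m) (w : R -> R)
  (eta : R) (x0 : vec n) (y0 : vec m) (xs : vec n) (ys : vec m) : Prop :=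
  let base := phi A B f g w x0 y0 in
  let other := phi A B f g w xs ys in
  in_Cneg w eta (fun t => vsub (other.1 t) (base.1 t))
                (fun t => vsub (other.2 t) (base.2 t)).

Definition dF {n m} (A : mat n) (B : mat m)
  (f : vec n -> vec m -> vec n) (g : vec n -> vec m -> vec m) (w : R -> R)
  (x0 : vec n) (y0 : vec m) (u : vec n) (v : vec m) (s : R) : vec n :=
  let base := phi A B f g w x0 y0 in
  vsub (Fw f (Zt w s) (vadd u (base.1 s)) (vadd v (base.2 s)))
       (Fw f (Zt w s) (base.1 s) (base.2 s)).
Definition dG {n m} (A : mat n) (B : mat m)
  (f : vec n -> vec m -> vec n) (g : vec n -> vec m -> vec m) (w : R -> R)
  (x0 : vec n) (y0 : vec m) (u : vec n) (v : vec m) (s : R) : vec m :=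
  let base := phi A B f g w x0 y0 in
  vsub (Fw g (Zt w s) (vadd u (base.1 s)) (vadd v (base.2 s)))
       (Fw g (Zt w s) (base.1 s) (base.2 s)).

Definition is_LP_sol {n m} (A : mat n) (B : mat m)
  (f : vec n -> vec m -> vec n) (g : vec n -> vec m -> vec m) (w : R -> R)
  (x0 : vec n) (y0 : vec m) (xi : vec n) (u : R -> vec n) (v : R -> vec m) : Prop :=
  forall t, t <= 0 ->
    (forall i, has_int
        (fun s => exp (Rint (Zt w) s t) *
                  mulmv (mexp A (t - s)) (dF A B f g w x0 y0 (u s) (v s) s) i) 0 t
        (u t i - exp (Rint (Zt w) 0 t) * mulmv (mexp A t) (vsub xi x0) i)) /\
    (forall j, has_int_neginf
        (fun s => exp (Rint (Zt w) s t) *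
                  mulmv (mexp B (t - s)) (dG A B f g w x0 y0 (u s) (v s) s) j) t
        (v t j)).

Definition LPsol {n m} (A : mat n) (B : mat m)
  (f : vec n -> vec m -> vec n) (g : vec n -> vec m -> vec m) (w : R -> R)
  (eta : R) (x0 : vec n) (y0 : vec m) (xi : vec n) : (R -> vec n) * (R -> vec m) :=
  epsilon (inhabits ((fun _ _ => 0), (fun _ _ => 0)))
    (fun uv => in_Cneg w eta uv.1 uv.2 /\ is_LP_sol A B f g w x0 y0 xi uv.1 uv.2).

Definition l_integrand {n m} (A : mat n) (B : mat m)
  (f : vec n -> vec m -> vec n) (g : vec n -> vec m -> vec m) (w : R -> R)
  (eta : R) (x0 : vec n) (y0 : vec m) (xi : vec n) (j : 'I_m) (s : R) : R :=
  let uv := LPsol A B f g w eta x0 y0 xi in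
  exp (Rint (Zt w) s 0) * mulmv (mexp B (- s)) (dG A B f g w x0 y0 (uv.1 s) (uv.2 s) s) j.

Definition lmap {n m} (A : mat n) (B : mat m)
  (f : vec n -> vec m -> vec n) (g : vec n -> vec m -> vec m) (w : R -> R)
  (eta : R) (x0 : vec n) (y0 : vec m) (xi : vec n) : vec m :=
  fun j => y0 j + Rint_neginf (l_integrand A B f g w eta x0 y0 xi j) 0.

(* Main.v *)
(* Multiplying by [exp (- int_0^t z)] removes the term [z(theta_t w) x] from the random
   equation and turns [F], [G] into nonlinearities with the same Lipschitz constant, so
   that [C^-_eta] becomes the space of functions bounded by [M e^{eta t}] on [t <= 0].
   There the integral system, the fiber condition and "bounded backward solution of
   the difference equation" are the same thing; the contraction estimate given by the
   dichotomy yields existence, uniqueness and the Lipschitz bound at once.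
   Since [z] is only càdlàg, differential equations are understood through right
   derivatives: a continuous function is determined by its right derivative. *)
Require Import Defs.
From HB Require Import structures.
From Stdlib Require Import Reals Lra Psatz FunctionalExtensionality ClassicalEpsilon.
From mathcomp Require Import all_boot.
From Coquelicot Require Import Coquelicot.
Open Scope R_scope.

(** * Finite sums, Euclidean norm and matrices *)

(** Write [I t] for the integral of [z] from 0 to [t]. The unknown [exp (- I t) x] sees the
    nonlinearity [Fw f] at the shifted level [z + I], whose outer and inner exponentials cancel in
    the Lipschitz estimate. The number [rho] has two sources: a forcing of size [C e^{eta s}]
    contributes [C / (a - eta)] when [A] propagates it from time 0, and [C / (eta - b)] when [B]
    propagates it from minus infinity.

    Two obstacles shape the development. [phi], [LPsol] and the integrals are epsilon choices, so
    nothing is known about them before existence is proved: global solvability of the random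
    equation and convergence of the improper integrals are part of the work. And the coefficients
    jump, so integrability, the fundamental theorem and the mean value inequality are rebuilt for
    càdlàg integrands and right derivatives.

    In the stable component the initial value is not free: it is the one for which [e^{B(t-s)} V(s)]
    tends to 0 as [s] goes to minus infinity. Most arguments about [V] turn on this vanishing of the
    remote past. *)

HB.instance Definition _ := Monoid.isComLaw.Build R 0 Rplus
  (fun x y z => esym (Rplus_assoc x y z)) Rplus_comm Rplus_0_l.

Notation "\rsum_ ( i < n ) F" := (\big[Rplus/0]_(i < n) F)
  (at level 36, F at level 36, i, n at level 50).

Lemma rsumD n (F G : 'I_n -> R) :
  \rsum_(i < n) (F i + G i) = \rsum_(i < n) F i + \rsum_(i < n) G i.
Proof. exact: big_split. Qed.

Lemma rsumZ n c (F : 'I_n -> R) : \rsum_(i < n) (c * F i) = c * \rsum_(i < n) F i.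
Proof.
rewrite (big_morph (Rmult c) (id1 := 0) (op1 := Rplus)) //.
- move=> x y; ring.
- ring.
Qed.

Lemma rsumB n (F G : 'I_n -> R) :
  \rsum_(i < n) (F i - G i) = \rsum_(i < n) F i - \rsum_(i < n) G i.
Proof.
have -> : \rsum_(i < n) (F i - G i) = \rsum_(i < n) (F i + (-1) * G i).
  by apply: eq_bigr => i _; ring.
by rewrite rsumD rsumZ; ring.
Qed.

Lemma rsum_le n (F G : 'I_n -> R) :
  (forall i, F i <= G i) -> \rsum_(i < n) F i <= \rsum_(i < n) G i.
Proof.
by move=> H; apply: (big_ind2 Rle) => //; [lra | move=> *; lra].
Qed.

Lemma rsum_ge0 n (F : 'I_n -> R) : (forall i, 0 <= F i) -> 0 <= \rsum_(i < n) F i.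
Proof. by move=> H; apply: (big_ind (Rle 0)) => //; [lra | move=> *; lra]. Qed.

Lemma rsum_eq0 n (F : 'I_n -> R) : (forall i, F i = 0) -> \rsum_(i < n) F i = 0.
Proof. by move=> H; apply: big1 => i _; apply: H. Qed.

Lemma rsum_abs n (F : 'I_n -> R) : Rabs (\rsum_(i < n) F i) <= \rsum_(i < n) Rabs (F i).
Proof.
apply: (big_ind2 (fun x y => Rabs x <= y)) => [|x1 x2 y1 y2 H1 H2|i _].
- rewrite Rabs_R0; lra.
- apply: Rle_trans (Rabs_triang _ _) _; lra.
- lra.
Qed.

Lemma rsum_term_le n (F : 'I_n -> R) i : (forall i, 0 <= F i) -> F i <= \rsum_(i < n) F i.
Proof.
move=> H; rewrite (bigD1 i) //=.
rewrite -{1}(Rplus_0_r (F i)); apply: Rplus_le_compat_l.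
by apply: (big_ind (Rle 0)) => //; [lra | move=> *; lra].
Qed.

Lemma rsum_const n c : \rsum_(i < n) c = INR n * c.
Proof.
elim: n => [|n IH]; first by rewrite big_ord0 /=; ring.
by rewrite big_ord_recr IH S_INR /=; ring.
Qed.

Lemma filterlim_rsum {T} (F : (T -> Prop) -> Prop) {FF : Filter F} n
    (h : 'I_n -> T -> R) (l : 'I_n -> R) :
  (forall i, filterlim (h i) F (locally (l i))) ->
  filterlim (fun x => \rsum_(i < n) h i x) F (locally (\rsum_(i < n) l i)).
Proof.
move=> H.
elim: n h l H => [|n IH] h l H.
  apply: (filterlim_ext (fun _ => 0)); first by move=> x; rewrite big_ord0.
  by rewrite big_ord0; apply: filterlim_const.
rewrite big_ord_recr /=.
apply: (filterlim_ext (fun x => plus (\rsum_(i < n) h (widen_ord (leqnSn n) i) x) (h ord_max x))).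
  by move=> x; rewrite big_ord_recr.
by apply: filterlim_comp_2 (filterlim_plus _ _) => //; apply: IH => i.
Qed.

Definition dot {n} (x y : vec n) : R := \rsum_(i < n) (x i * y i).

Lemma dot_ge0 n (x : vec n) : 0 <= dot x x.
Proof. by apply: rsum_ge0 => i; nra. Qed.

Lemma vnorm_ge0 n (x : vec n) : 0 <= vnorm x.
Proof. exact: sqrt_pos. Qed.

Lemma vnorm_sq n (x : vec n) : vnorm x * vnorm x = dot x x.
Proof. exact: sqrt_sqrt (dot_ge0 _ x). Qed.

Lemma coord_le_vnorm n (x : vec n) i : Rabs (x i) <= vnorm x.
Proof.
rewrite -sqrt_Rsqr_abs; apply: sqrt_le_1_alt.
by apply: (rsum_term_le n (fun i => x i * x i)) => j; nra.
Qed.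

Lemma vnorm_le_sq n (x : vec n) c : 0 <= c -> dot x x <= c * c -> vnorm x <= c.
Proof.
move=> c0 H; have := vnorm_sq _ x; have := vnorm_ge0 _ x; nra.
Qed.

Lemma dot_vaddZ n (x y : vec n) c :
  dot (fun i => x i + c * y i) (fun i => x i + c * y i) =
  dot x x + 2 * c * dot x y + c * c * dot y y.
Proof.
by rewrite /dot -!rsumZ -!rsumD; apply: eq_bigr => i _; ring.
Qed.

(** The quadratic [|x + c y|^2] in [c] is nonnegative, in particular at its minimum
    [c = - x.y / |y|^2]. If [|y| = 0] it is affine in [c], and a positive [x.y] would let a suitable
    [c] bring it down to [-1]. *)
Lemma cauchy_schwarz n (x y : vec n) : dot x y <= vnorm x * vnorm y.
Proof.
have [x0 y0] := (vnorm_ge0 _ x, vnorm_ge0 _ y).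
have [hx hy] := (vnorm_sq _ x, vnorm_sq _ y).
have H c := dot_vaddZ _ x y c.
have H0 c := dot_ge0 _ (fun i => x i + c * y i).
have {}H c : 0 <= dot x x + 2 * c * dot x y + c * c * dot y y by rewrite -H.
case: (Rle_lt_or_eq_dec 0 (vnorm y) y0) => [yp|ye].
  have := H (- dot x y / dot y y).
  have yy : 0 < dot y y by rewrite -hy; nra.
  have -> : dot x x + 2 * (- dot x y / dot y y) * dot x y
     + (- dot x y / dot y y) * (- dot x y / dot y y) * dot y y
     = (dot x x * dot y y - dot x y * dot x y) / dot y y by field; lra.
  move=> h; have {}h : 0 <= dot x x * dot y y - dot x y * dot x y.
    have -> : dot x x * dot y y - dot x y * dot x y =
      (dot x x * dot y y - dot x y * dot x y) / dot y y * dot y y by field; lra.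
    by apply: Rmult_le_pos => //; lra.
  rewrite -hx -hy in h.
  have : 0 <= vnorm x * vnorm y by nra.
  case: (Rle_lt_dec (dot x y) (vnorm x * vnorm y)) => // ? ?; nra.
have yy : dot y y = 0 by rewrite -hy -ye; ring.
rewrite -ye Rmult_0_r.
case: (Rle_lt_dec (dot x y) 0) => // h.
have := H (- (dot x x + 1) / (2 * dot x y)).
rewrite yy.
have -> : dot x x + 2 * (- (dot x x + 1) / (2 * dot x y)) * dot x y +
   - (dot x x + 1) / (2 * dot x y) * (- (dot x x + 1) / (2 * dot x y)) * 0 = -1 by field; lra.
lra.
Qed.

Lemma vnorm_vadd n (x y : vec n) : vnorm (vadd x y) <= vnorm x + vnorm y.
Proof.
apply: vnorm_le_sq; first by have := vnorm_ge0 _ x; have := vnorm_ge0 _ y; lra.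
have -> : vadd x y = (fun i => x i + 1 * y i).
  by apply: functional_extensionality => i; rewrite /vadd; ring.
have := cauchy_schwarz _ x y.
rewrite dot_vaddZ -!vnorm_sq; nra.
Qed.

Lemma vnorm_vscale n c (x : vec n) : vnorm (vscale c x) = Rabs c * vnorm x.
Proof.
rewrite /vnorm -sqrt_Rsqr_abs -sqrt_mult_alt; last exact: Rle_0_sqr.
by congr sqrt; rewrite -rsumZ; apply: eq_bigr => i _; rewrite /vscale /Rsqr; ring.
Qed.

Lemma vnorm0 n : vnorm (fun _ : 'I_n => 0) = 0.
Proof. by rewrite /vnorm rsum_eq0 ?sqrt_0 // => i; ring. Qed.

Lemma vsubxx n (x : vec n) : vsub x x = fun _ => 0.
Proof. by apply: functional_extensionality => i; rewrite /vsub; ring. Qed.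

Lemma vsub0 n (x : vec n) : vsub x (fun _ => 0) = x.
Proof. by apply: functional_extensionality => i; rewrite /vsub; ring. Qed.

Lemma vnorm_vsubC n (x y : vec n) : vnorm (vsub x y) = vnorm (vsub y x).
Proof. by congr sqrt; apply: eq_bigr => i _; rewrite /vsub; ring. Qed.

Lemma vnorm_vsub_triangle n (x y z : vec n) :
  vnorm (vsub x z) <= vnorm (vsub x y) + vnorm (vsub y z).
Proof.
have -> : vsub x z = vadd (vsub x y) (vsub y z).
  by apply: functional_extensionality => i; rewrite /vadd /vsub; ring.
exact: vnorm_vadd.
Qed.

Lemma vnorm_vsub_le n (x y : vec n) : vnorm (vsub x y) <= vnorm x + vnorm y.
Proof.
have -> : vsub x y = vadd x (vscale (-1) y).
  by apply: functional_extensionality => i; rewrite /vadd /vsub /vscale; ring.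
apply: Rle_trans (vnorm_vadd _ _ _) _.
rewrite vnorm_vscale Rabs_left; lra.
Qed.

Lemma vsub_eq0 n (x y : vec n) : vnorm (vsub x y) <= 0 -> x = y.
Proof.
move=> H; apply: functional_extensionality => i.
have h := coord_le_vnorm _ (vsub x y) i.
have d0 : Rabs (x i - y i) = 0.
  by have := Rabs_pos (x i - y i); move: h H; rewrite {1}/vsub; lra.
by have := Rabs_eq_0 _ d0; lra.
Qed.

Lemma vnorm_le_rsum n (x : vec n) : vnorm x <= \rsum_(i < n) Rabs (x i).
Proof.
apply: vnorm_le_sq; first by apply: rsum_ge0 => i; apply: Rabs_pos.
rewrite /dot -rsumZ; apply: rsum_le => i.
have h := rsum_term_le n (fun i => Rabs (x i)) i (fun i => Rabs_pos _).
have -> : x i * x i = Rabs (x i) * Rabs (x i).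
  by rewrite -Rabs_mult Rabs_right //; apply: Rle_ge; nra.
by apply: Rmult_le_compat_r h; apply: Rabs_pos.
Qed.

Lemma vnorm_le_coord n (x : vec n) c :
  (forall i, Rabs (x i) <= c) -> vnorm x <= INR n * c.
Proof.
move=> H; apply: Rle_trans (vnorm_le_rsum _ _) _.
by rewrite -rsum_const; apply: rsum_le.
Qed.

Lemma mulmv_vadd n (A : mat n) x y : mulmv A (vadd x y) = vadd (mulmv A x) (mulmv A y).
Proof.
apply: functional_extensionality => i; rewrite /mulmv /vadd -rsumD.
by apply: eq_bigr => j _; ring.
Qed.

Lemma mulmv_vsub n (A : mat n) x y : mulmv A (vsub x y) = vsub (mulmv A x) (mulmv A y).
Proof.
apply: functional_extensionality => i; rewrite /mulmv /vsub -rsumB.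
by apply: eq_bigr => j _; ring.
Qed.

Lemma mulmv_vscale n (A : mat n) c x : mulmv A (vscale c x) = vscale c (mulmv A x).
Proof.
apply: functional_extensionality => i; rewrite /mulmv /vscale -rsumZ.
by apply: eq_bigr => j _; ring.
Qed.

Lemma mulmv_mmul n (A B : mat n) x : mulmv (mmul A B) x = mulmv A (mulmv B x).
Proof.
apply: functional_extensionality => i; rewrite /mulmv /mmul.
transitivity (\rsum_(j < n) \rsum_(k < n) (A i k * B k j * x j)).
  by apply: eq_bigr => j _; rewrite Rmult_comm -rsumZ; apply: eq_bigr => k _; ring.
rewrite exchange_big; apply: eq_bigr => k _ /=.
by rewrite -rsumZ; apply: eq_bigr => j _; ring.
Qed.

Lemma mulmv_mid n (x : vec n) : mulmv (mid n) x = x.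
Proof.
apply: functional_extensionality => i; rewrite /mulmv /mid.
rewrite (bigD1 i) //= eqxx big1 => [|j /negbTE]; first ring.
by rewrite eq_sym => ->; ring.
Qed.

(** A crude entrywise norm: it only has to dominate the action on vectors and the entries of all
    powers. *)
Definition mnorm {n} (A : mat n) : R := \rsum_(i < n) \rsum_(j < n) Rabs (A i j).

Lemma mnorm_ge0 n (A : mat n) : 0 <= mnorm A.
Proof. by do 2!apply: rsum_ge0 => ?; apply: Rabs_pos. Qed.

Lemma vnorm_mulmv n (A : mat n) x : vnorm (mulmv A x) <= mnorm A * vnorm x.
Proof.
apply: Rle_trans (vnorm_le_rsum _ _) _.
rewrite Rmult_comm /mnorm -rsumZ; apply: rsum_le => i.
apply: Rle_trans (rsum_abs _ _) _.
rewrite -rsumZ; apply: rsum_le => j.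
rewrite Rabs_mult.
have := coord_le_vnorm _ x j; have := Rabs_pos (A i j); nra.
Qed.

(** * Right derivatives and càdlàg functions *)

(** The supremum of the points up to which [P] holds can be neither a point of failure nor smaller
    than [b]. The two induction steps mirror the two halves of the càdlàg condition: a step beyond
    [c], and a passage to [c] from the left. *)
Lemma real_induction (P : R -> Prop) a b : a <= b -> P a ->
  (forall c, a <= c < b -> P c ->
     exists d, 0 < d /\ forall x, c < x < c + d -> x <= b -> P x) ->
  (forall c, a < c <= b -> (forall x, a <= x < c -> P x) -> P c) -> P b.
Proof.
move=> ab Pa Hr Hl.
pose S c := a <= c <= b /\ forall x, a <= x <= c -> P x.
have Sa : S a.
  by split; [lra | move=> x hx; have -> : x = a by lra].
have [c [cub club]] : {c | is_lub S c}.
  by apply: completeness; [exists b => x [] ; lra | exists a].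
have ac : a <= c by apply: cub.
have cb : c <= b by apply: club => x []; lra.
have Pl x : a <= x < c -> P x.
  move=> [ax xc].
  case: (excluded_middle_informative (P x)) => // nP; exfalso.
  suff ? : c <= x by lra.
  apply: club => y [_ Hy]; case: (Rle_lt_dec y x) => // xy.
  by case: nP; apply: Hy; lra.
have Pc : P c.
  case: (Rle_lt_or_eq_dec a c ac) => [h|<- //].
  by apply: Hl.
case: (Rle_lt_or_eq_dec c b cb) => [h|<- //].
have [|d [d0 Hd]] := Hr c _ Pc; first lra.
pose c' := Rmin b (c + d / 2).
have c'b : c' <= b by apply: Rmin_l.
have c'd : c' <= c + d / 2 by apply: Rmin_r.
have cc' : c < c' by apply: Rmin_glb_lt; lra.
suff ? : c' <= c by lra.
apply: cub; split; first lra.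
move=> x hx.
case: (Rlt_le_dec x c) => [xc|]; first by apply: Pl; lra.
case/Rle_lt_or_eq_dec => [cx|<- //].
by apply: Hd; lra.
Qed.

Lemma at_right_iff t (P : R -> Prop) :
  at_right t P <-> exists d, 0 < d /\ forall s, t < s < t + d -> P s.
Proof.
split=> [[d Hd]|[d [d0 Hd]]].
  exists d; split; first exact: cond_pos.
  move=> s hs; apply: Hd; last lra.
  by rewrite /ball /= /AbsRing_ball /abs /minus /plus /opp /= Rabs_right; lra.
exists (mkposreal d d0) => s; rewrite /ball /= /AbsRing_ball /abs /minus /plus /opp /= => h1 h2.
by apply: Hd; move: h1; rewrite Rabs_right; lra.
Qed.

Lemma at_left_iff t (P : R -> Prop) :
  at_left t P <-> exists d, 0 < d /\ forall s, t - d < s < t -> P s.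
Proof.
split=> [[d Hd]|[d [d0 Hd]]].
  exists d; split; first exact: cond_pos.
  move=> s hs; apply: Hd; last lra.
  by rewrite /ball /= /AbsRing_ball /abs /minus /plus /opp /= Rabs_left; lra.
exists (mkposreal d d0) => s; rewrite /ball /= /AbsRing_ball /abs /minus /plus /opp /= => h1 h2.
by apply: Hd; move: h1; rewrite Rabs_left; lra.
Qed.

Lemma filterlim_RP {T} (F : (T -> Prop) -> Prop) {FF : Filter F} (f : T -> R) (l : R) :
  filterlim f F (locally l) <-> forall eps, 0 < eps -> F (fun x => Rabs (f x - l) < eps).
Proof.
rewrite filterlim_locally; split=> H.
  by move=> e e0; have := H (mkposreal e e0).
by move=> [e e0]; apply: H.
Qed.

Lemma continuous_RP (f : R -> R) t :
  continuous f t <-> forall eps, 0 < eps -> exists d, 0 < d /\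
    forall s, Rabs (s - t) < d -> Rabs (f s - f t) < eps.
Proof.
rewrite /continuous filterlim_RP; split=> H e e0.
  by have [d Hd] := H e e0; exists d; split; [exact: cond_pos | exact: Hd].
by have [d [d0 Hd]] := H e e0; exists (mkposreal d d0).
Qed.

Section FilterlimR.
Context {T : Type} {F : (T -> Prop) -> Prop} {FF : Filter F}.
Implicit Types f g : T -> R.

Lemma filterlim_addR f g a b : filterlim f F (locally a) -> filterlim g F (locally b) ->
  filterlim (fun x => f x + g x) F (locally (a + b)).
Proof. by move=> hf hg; apply: filterlim_comp_2 hf hg _; apply: filterlim_plus. Qed.

Lemma filterlim_mulR f g a b : filterlim f F (locally a) -> filterlim g F (locally b) ->
  filterlim (fun x => f x * g x) F (locally (a * b)).
Proof. by move=> hf hg; apply: filterlim_comp_2 hf hg _; apply: filterlim_mult. Qed.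

Lemma filterlim_subR f g a b : filterlim f F (locally a) -> filterlim g F (locally b) ->
  filterlim (fun x => f x - g x) F (locally (a - b)).
Proof.
move=> hf hg; apply: filterlim_addR hf _.
exact: (filterlim_comp _ _ _ _ _ _ _ _ hg (filterlim_opp b)).
Qed.

Lemma filterlim_compR f (g : R -> R) a : filterlim f F (locally a) -> continuous g a ->
  filterlim (fun x => g (f x)) F (locally (g a)).
Proof. by move=> hf hg; apply: (filterlim_comp _ _ _ _ _ _ _ _ hf hg). Qed.

End FilterlimR.

Lemma continuous_at_right (f : R -> R) t : continuous f t -> filterlim f (at_right t) (locally (f t)).
Proof. by move=> H; apply: filterlim_filter_le_1 H; apply: filter_le_within. Qed.

Lemma continuous_at_left (f : R -> R) t : continuous f t -> filterlim f (at_left t) (locally (f t)).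
Proof. by move=> H; apply: filterlim_filter_le_1 H; apply: filter_le_within. Qed.

(* Right derivatives: with càdlàg coefficients the solutions of the random
   equation are not differentiable at the jumps, but they have everywhere a right
   derivative, and this characterises them. *)
Definition rder (f : R -> R) (t l : R) : Prop :=
  filterlim (fun s => (f s - f t) / (s - t)) (at_right t) (locally l).

Lemma rderP f t l : rder f t l <-> forall eps, 0 < eps -> exists d, 0 < d /\
  forall s, t < s < t + d -> Rabs (f s - f t - l * (s - t)) <= eps * (s - t).
Proof.
have E s : t < s -> f s - f t - l * (s - t) = ((f s - f t) / (s - t) - l) * (s - t).
  by move=> h; field; lra.
rewrite /rder filterlim_RP; split=> H e e0.
  have /at_right_iff [d [d0 Hd]] := H e e0.
  exists d; split=> // s hs; rewrite E; last lra.
  rewrite Rabs_mult (Rabs_right (s - t)); last lra.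
  by apply: Rmult_le_compat_r; [lra | apply: Rlt_le; apply: Hd].
have [|d [d0 Hd]] := H (e / 2); first lra.
apply/at_right_iff; exists d; split=> // s hs.
have := Hd s hs; rewrite E; last lra.
rewrite Rabs_mult (Rabs_right (s - t)); last lra.
move=> h; suff ? : Rabs ((f s - f t) / (s - t) - l) <= e / 2 by lra.
by apply: (Rmult_le_reg_r (s - t)); lra.
Qed.

Lemma rder_right_cont f t l : rder f t l -> filterlim f (at_right t) (locally (f t)).
Proof.
move=> H.
have h1 : filterlim (fun s => s - t) (at_right t) (locally (t - t)).
  apply: filterlim_subR; last exact: filterlim_const.
  by apply: (continuous_at_right (fun s => s)); apply: continuous_id.
pose proof (filterlim_addR _ _ _ _ (filterlim_mulR _ _ _ _ H h1) (filterlim_const (f t))) as h2.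
move: h2; have -> : l * (t - t) + f t = f t by ring.
apply: filterlim_ext_loc; apply/at_right_iff; exists 1; split; first lra.
by move=> s hs; field; lra.
Qed.

Lemma rder_ext f g t l d : 0 < d -> (forall s, t <= s < t + d -> f s = g s) ->
  rder f t l -> rder g t l.
Proof.
move=> d0 E /rderP H; apply/rderP => e e0; have [d' [d'0 Hd]] := H e e0.
exists (Rmin d d'); split; first exact: Rmin_glb_lt.
move=> s hs; have h1 := Rmin_l d d'; have h2 := Rmin_r d d'.
rewrite -(E s); last lra.
by rewrite -(E t); [apply: Hd; lra | lra].
Qed.

Lemma rder_add f g t a b : rder f t a -> rder g t b -> rder (fun s => f s + g s) t (a + b).
Proof.
move=> hf hg; apply: filterlim_ext (filterlim_addR _ _ _ _ hf hg) => s.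
by rewrite /Rdiv; ring.
Qed.

Lemma rder_mul f g t a b : rder f t a -> rder g t b ->
  rder (fun s => f s * g s) t (a * g t + f t * b).
Proof.
move=> hf hg.
pose proof (filterlim_addR _ _ _ _
  (filterlim_mulR _ _ _ _ hf (rder_right_cont _ _ _ hg))
  (filterlim_mulR _ _ _ _ (filterlim_const (f t)) hg)) as h; move: h.
by apply: filterlim_ext => s; rewrite /Rdiv; ring.
Qed.

Lemma is_derive_rder f t l : is_derive f t l -> rder f t l.
Proof.
move=> /is_derive_Reals H; apply/rderP => e e0.
have [d Hd] := H e e0; exists d; split; first exact: cond_pos.
move=> s hs.
have h0 : s - t <> 0 by lra.
have := Hd (s - t) h0; rewrite Rabs_right; last lra.
have -> : t + (s - t) = s by ring.
move=> h; have {}h := Rlt_le _ _ (h ltac:(lra)).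
have -> : f s - f t - l * (s - t) = ((f s - f t) / (s - t) - l) * (s - t) by field; lra.
rewrite Rabs_mult (Rabs_right (s - t)); last lra.
by apply: Rmult_le_compat_r; lra.
Qed.

Lemma rder_const c t : rder (fun _ => c) t 0.
Proof. by apply: is_derive_rder; apply: is_derive_const. Qed.

Lemma rder_scal c f t a : rder f t a -> rder (fun s => c * f s) t (c * a).
Proof.
move=> h; have := rder_mul _ _ _ _ _ (rder_const c t) h.
by have -> : 0 * f t + c * a = c * a by ring.
Qed.

Lemma rder_sub f g t a b : rder f t a -> rder g t b -> rder (fun s => f s - g s) t (a - b).
Proof.
move=> hf hg; have := rder_add _ _ _ _ _ hf (rder_scal (-1) _ _ _ hg).
have -> : a + -1 * b = a - b by ring.
apply: (rder_ext _ _ _ _ 1); first lra.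
by move=> s _; ring.
Qed.

Lemma rder_rsum n (h : 'I_n -> R -> R) (l : 'I_n -> R) t :
  (forall i, rder (h i) t (l i)) ->
  rder (fun s => \rsum_(i < n) h i s) t (\rsum_(i < n) l i).
Proof.
move=> H; pose proof (filterlim_rsum _ _ _ _ H) as h2; move: h2.
apply: filterlim_ext => s; rewrite /Rdiv.
rewrite -rsumB Rmult_comm -rsumZ; apply: eq_bigr => i _; ring.
Qed.

(** With a slack [e (s - a)] the inequality propagates to the right by the right derivative and
    passes to left limits by continuity, so real induction applies; the slack is then sent to 0. *)
Lemma rder_ge0_le f f' a b : a <= b ->
  (forall c, a <= c <= b -> continuous f c) ->
  (forall c, a <= c < b -> rder f c (f' c)) ->
  (forall c, a <= c < b -> 0 <= f' c) -> f a <= f b.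
Proof.
move=> ab fc fd f0.
suff H e : 0 < e -> f a <= f b + e * (b - a).
  case: (Rle_lt_dec (f a) (f b)) => // h; exfalso.
  (* This slack accounts for less than half of the supposed drop; the [+ 1] keeps the denominator
     positive when [a = b]. *)
  have := H ((f a - f b) / (2 * (b - a + 1))) ltac:(apply: Rdiv_lt_0_compat; lra).
  have -> : (f a - f b) / (2 * (b - a + 1)) * (b - a) = (f a - f b) / 2 - (f a - f b) / (2 * (b - a + 1)) by field; lra.
  have : 0 < (f a - f b) / (2 * (b - a + 1)) by apply: Rdiv_lt_0_compat; lra.
  lra.
move=> e0; pattern b; apply: (real_induction _ a b ab).
- lra.
- move=> c hc Pc.
  have /rderP /(_ e e0) [d [d0 Hd]] := fd c hc.
  exists d; split=> // x hx _; have := Hd x hx.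
  have := f0 c hc; move: (f' c) => l l0 /Rabs_le_between h.
  nra.
- move=> c hc Px.
  case: (Rle_lt_dec (f a) (f c + e * (c - a))) => // h; exfalso.
  pose r := f a - (f c + e * (c - a)).
  have [|d [d0 Hd]] := proj1 (continuous_RP f c) (fc c ltac:(lra)) r; first by rewrite /r; lra.
  pose x := Rmax a (c - d / 2).
  have ax : a <= x by apply: Rmax_l.
  have dx : c - d / 2 <= x by apply: Rmax_r.
  have xc : x < c by apply: Rmax_lub_lt; lra.
  have := Px x ltac:(lra).
  have := Hd x; rewrite Rabs_left; last lra.
  move/(_ ltac:(lra)) /Rabs_lt_between; rewrite /r; nra.
Qed.

Definition vcont {n} (U : R -> vec n) : Prop := forall i t, continuous (fun s => U s i) t.
Definition vrder {n} (U : R -> vec n) (t : R) (l : vec n) : Prop :=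
  forall i, rder (fun s => U s i) t (l i).

(* Mean value inequality, by monotonicity of [|c| beta - c.W] with [c = W b - W a]. *)
Lemma vec_mean_value n (W w : R -> vec n) (beta beta' : R -> R) a b : a <= b ->
  vcont W -> (forall s, a <= s < b -> vrder W s (w s)) ->
  (forall s, is_derive beta s (beta' s)) ->
  (forall s, a <= s < b -> vnorm (w s) <= beta' s) ->
  vnorm (vsub (W b) (W a)) <= beta b - beta a.
Proof.
move=> ab Wc Wd bd H.
have bc s : continuous beta s by apply: ex_derive_continuous; exists (beta' s).
set c := vsub (W b) (W a).
have c0 := vnorm_ge0 _ c.
have bm : beta a <= beta b.
  apply: (rder_ge0_le beta beta') => // s hs; first exact: is_derive_rder.
  by apply: Rle_trans (H s hs); apply: vnorm_ge0.
suff h : vnorm c * beta a - dot c (W a) <= vnorm c * beta b - dot c (W b).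
  have : dot c c = dot c (W b) - dot c (W a).
    by rewrite /dot -rsumB; apply: eq_bigr => i _; rewrite /c /vsub; ring.
  rewrite -vnorm_sq => h2.
  case: (Rle_lt_dec (vnorm c) (beta b - beta a)) => // h3; nra.
apply: (rder_ge0_le (fun s => vnorm c * beta s - dot c (W s))
  (fun s => vnorm c * beta' s - dot c (w s))) => // s hs.
- apply: filterlim_subR.
    by apply: filterlim_mulR; [apply: filterlim_const | apply: bc].
  by apply: filterlim_rsum => i; apply: filterlim_mulR; [apply: filterlim_const | apply: Wc].
- apply: rder_sub; first by apply: rder_scal; apply: is_derive_rder.
  by apply: rder_rsum => i; apply: rder_scal; apply: Wd.
- have := cauchy_schwarz _ c (w s); have := H s hs; nra.
Qed.

Lemma rder0_const f a b : a <= b -> (forall s, continuous f s) ->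
  (forall s, a <= s < b -> rder f s 0) -> f b = f a.
Proof.
move=> ab fc fd.
have h1 : f a <= f b by apply: (rder_ge0_le f (fun _ => 0)) => // *; lra.
have h2 : -1 * f a <= -1 * f b.
  apply: (rder_ge0_le (fun s => -1 * f s) (fun _ => -1 * 0)) => // s hs.
  - by apply: filterlim_mulR; [apply: filterlim_const | apply: fc].
  - exact/rder_scal/fd.
  - lra.
lra.
Qed.

(** * Càdlàg functions and their Riemann integrals *)

Lemma cadlagP h : cadlag h <-> forall t, filterlim h (at_right t) (locally (h t)) /\
  exists L : R, filterlim h (at_left t) (locally L).
Proof.
split=> H t; have [H1 [L H2]] := H t; split.
- apply/filterlim_RP => e e0; have [d [d0 Hd]] := H1 e e0.
  by apply/at_right_iff; exists d; split=> // s hs; apply: Hd; lra.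
- exists L; apply/filterlim_RP => e e0; have [d [d0 Hd]] := H2 e e0.
  by apply/at_left_iff; exists d.
- move=> e e0; move/filterlim_RP: H1 => /(_ e e0) /at_right_iff [d [d0 Hd]].
  exists d; split=> // s hs; case: (Rle_lt_or_eq_dec t s); first lra.
    by move=> ts; apply: Hd; lra.
  by move=> <-; rewrite Rminus_diag Rabs_R0.
- exists L => e e0; move/filterlim_RP: H2 => /(_ e e0) /at_left_iff [d [d0 Hd]].
  by exists d.
Qed.

Lemma cadlag_continuous h : (forall t, continuous h t) -> cadlag h.
Proof.
move=> H; apply/cadlagP => t; split; first exact: continuous_at_right.
by exists (h t); apply: continuous_at_left.
Qed.

Lemma cadlag_add f g : cadlag f -> cadlag g -> cadlag (fun t => f t + g t).
Proof.
move=> /cadlagP hf /cadlagP hg; apply/cadlagP => t.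
have [[f1 [lf f2]] [g1 [lg g2]]] := (hf t, hg t).
split; first exact: filterlim_addR.
by exists (lf + lg); apply: filterlim_addR.
Qed.

Lemma cadlag_mul f g : cadlag f -> cadlag g -> cadlag (fun t => f t * g t).
Proof.
move=> /cadlagP hf /cadlagP hg; apply/cadlagP => t.
have [[f1 [lf f2]] [g1 [lg g2]]] := (hf t, hg t).
split; first exact: filterlim_mulR.
by exists (lf * lg); apply: filterlim_mulR.
Qed.

Lemma cadlag_ext f g : (forall t, f t = g t) -> cadlag f -> cadlag g.
Proof. by move=> E H; have <- : f = g by apply: functional_extensionality. Qed.

Lemma cadlag_const c : cadlag (fun _ => c).
Proof. by apply: cadlag_continuous => t; apply: continuous_const. Qed.

Lemma cadlag_sub f g : cadlag f -> cadlag g -> cadlag (fun t => f t - g t).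
Proof.
move=> hf hg; have := cadlag_add _ _ hf (cadlag_mul _ _ (cadlag_const (-1)) hg).
by apply: cadlag_ext => t; ring.
Qed.

Lemma cadlag_rsum n (h : 'I_n -> R -> R) : (forall i, cadlag (h i)) ->
  cadlag (fun t => \rsum_(i < n) h i t).
Proof.
elim: n h => [|n IH] h H.
  by apply: (cadlag_ext (fun _ => 0)) (cadlag_const 0) => t; rewrite big_ord0.
apply: (cadlag_ext (fun t => \rsum_(i < n) h (widen_ord (leqnSn n) i) t + h ord_max t)).
  by move=> t; rewrite big_ord_recr.
by apply: cadlag_add => //; apply: IH.
Qed.

(** Càdlàg functions are regulated. By real induction, an approximation on [[a, c]] is continued to
    the right by the constant [h c]; to reach [c] from the left, the left limit [L] is used just
    before [c] and the exact value at [c]. *)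
Lemma cadlag_step_approx h a b e : cadlag h -> a <= b -> 0 < e ->
  exists k : R -> R, ex_RInt k a b /\ forall x, a <= x <= b -> Rabs (h x - k x) < e.
Proof.
move=> hc ab e0.
pose P c := exists k : R -> R, ex_RInt k a c /\ forall x, a <= x <= c -> Rabs (h x - k x) < e.
apply: (real_induction P a b ab).
- exists (fun _ => h a); split; first exact: ex_RInt_point.
  by move=> x hx; (have -> : x = a by lra); rewrite Rminus_diag Rabs_R0.
- move=> c [ac cb] [k [ki Hk]].
  have [/(_ e e0) [d [d0 Hd]] _] := hc c.
  exists d; split=> // x hx _.
  exists (fun y => if Rle_dec y c then k y else h c); split.
    apply: (ex_RInt_Chasles _ a c x).
      apply: ex_RInt_ext ki => y; rewrite Rmin_left ?Rmax_right // => hy.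
      by case: Rle_dec => ? //; lra.
    apply: (ex_RInt_ext (fun _ => h c)); last exact: ex_RInt_const.
    move=> y; rewrite Rmin_left ?Rmax_right; try lra.
    by move=> hy; case: Rle_dec => ? //; lra.
  move=> y hy; case: Rle_dec => yc; first by apply: Hk; lra.
  by apply: Hd; lra.
- move=> c [ac cb] Px.
  have [_ [L /(_ e e0) [d [d0 Hd]]]] := hc c.
  pose x := Rmax a (c - d / 2).
  have ax : a <= x by apply: Rmax_l.
  have dx : c - d / 2 <= x by apply: Rmax_r.
  have xc : x < c by apply: Rmax_lub_lt; lra.
  have [k [ki Hk]] := Px x ltac:(lra).
  exists (fun y => if Rle_dec y x then k y else if Rlt_dec y c then L else h y); split.
    apply: (ex_RInt_Chasles _ a x c).
      apply: ex_RInt_ext ki => y; rewrite Rmin_left ?Rmax_right // => hy.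
      by case: Rle_dec => ? //; lra.
    apply: (ex_RInt_ext (fun _ => L)); last exact: ex_RInt_const.
    move=> y; rewrite Rmin_left ?Rmax_right; try lra.
    by move=> hy; case: Rle_dec => ? //; try lra; case: Rlt_dec => ? //; lra.
  move=> y hy; case: Rle_dec => yx; first by apply: Hk; lra.
  by case: Rlt_dec => yc; [apply: Hd; lra | rewrite Rminus_diag Rabs_R0].
Qed.

Lemma cadlag_ex_RInt h a b : cadlag h -> ex_RInt h a b.
Proof.
move=> hc.
wlog ab : a b / a <= b.
  move=> W; case: (Rle_lt_dec a b) => ba; first exact: W.
  by apply: ex_RInt_swap; apply: W; lra.
have inv_pos n : 0 < / (INR n + 1).
  by apply: Rinv_0_lt_compat; have := pos_INR n; lra.
pose k n := proj1_sig (constructive_indefinite_description _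
  (cadlag_step_approx h a b (/ (INR n + 1)) hc ab (inv_pos n))).
have kP n : ex_RInt (k n) a b /\ forall x, a <= x <= b -> Rabs (h x - k n x) < / (INR n + 1).
  by rewrite /k; case: constructive_indefinite_description.
(* The limit theorem for integrals asks for uniform convergence on the whole line, whereas the
   approximation holds on [[a, b]] only; everything is set to 0 outside. *)
pose cut (u : R -> R) x := if Rle_dec a x then if Rle_dec x b then u x else 0 else 0.
have cutE u x : Rmin a b < x < Rmax a b -> cut u x = u x.
  rewrite Rmin_left // Rmax_right // /cut => hx.
  by case: Rle_dec => ? /=; try lra; case: Rle_dec => ? /= //; lra.
have [||I [_ HI]] := filterlim_RInt (fun n => cut (k n)) a b eventually _ (cut h)
   (fun n => RInt (k n) a b).
- move=> n; apply: (is_RInt_ext (k n)); first by move=> x hx; rewrite cutE.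
  by apply: RInt_correct; case: (kP n).
- apply/filterlim_locally => eps.
  have := is_lim_seq_INR.
  move/is_lim_seq_spec => /(_ (/ eps)) [N HN].
  exists N => n Nn t.
  rewrite /ball /= /AbsRing_ball /abs /minus /plus /opp /= /cut.
  have e0 := cond_pos eps.
  have small : / (INR n + 1) < eps.
    have := HN n Nn; rewrite -{2}(Rinv_inv eps) => hn.
    apply: Rinv_lt_contravar; last lra.
    by apply: Rmult_lt_0_compat; [apply: Rinv_0_lt_compat | have := pos_INR n; lra].
  case: Rle_dec => h1 /=; last by rewrite Rplus_opp_r Rabs_R0.
  case: Rle_dec => h2 /=; last by rewrite Rplus_opp_r Rabs_R0.
  have := proj2 (kP n) t ltac:(lra).
  by rewrite Rabs_minus_sym /Rminus; lra.
- exists I; apply: is_RInt_ext HI => x hx; exact: cutE.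
Qed.

Lemma has_intP h a b I : has_int h a b I <-> is_RInt h a b I.
Proof.
split=> [[pr <-]|H].
  rewrite -RInt_Reals; apply: RInt_correct; exact: ex_RInt_Reals_1.
have pr : Riemann_integrable h a b by apply: ex_RInt_Reals_0; exists I.
by exists pr; rewrite -RInt_Reals; apply: is_RInt_unique.
Qed.

Lemma Rint_RInt h a b : ex_RInt h a b -> Rint h a b = RInt h a b.
Proof.
move=> [I HI].
have : has_int h a b (Rint h a b).
  by apply: epsilon_spec; exists I; apply/has_intP.
by move/has_intP/is_RInt_unique.
Qed.

Lemma RInt_primitive_continuous (h : R -> R) a t :
  (forall x y, ex_RInt h x y) -> continuous (RInt h a) t.
Proof.
move=> hi; apply/continuous_RP => e e0.
have [M HM] := ex_RInt_ub h (t - 1) (t + 1) (hi _ _).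
have M0 : 0 <= M.
  apply: Rle_trans (HM t _); first exact: norm_ge_0.
  by rewrite Rmin_left ?Rmax_right; lra.
exists (Rmin 1 (e / (M + 1))); split.
  by apply: Rmin_glb_lt; [lra | apply: Rdiv_lt_0_compat; lra].
move=> s hs.
have h1 := Rlt_le_trans _ _ _ hs (Rmin_l _ _).
have h2 := Rlt_le_trans _ _ _ hs (Rmin_r _ _).
have -> : RInt h a s - RInt h a t = RInt h t s.
  rewrite -(RInt_Chasles h a t s) // /plus /=; ring.
have := norm_RInt_le_const_abs h t s (RInt h t s) M _ (RInt_correct _ _ _ (hi _ _)).
rewrite /norm /= /abs /= => H; apply: Rle_lt_trans (H _) _.
  move=> x hx; apply: HM; rewrite Rmin_left ?Rmax_right; try lra.
  move/Rabs_lt_between: h1 => h1.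
  have := Rmin_glb t s (t - 1); have := Rmax_lub t s (t + 1).
  by case: hx => hx1 hx2 H1 H2; split; [apply: Rle_trans hx1; apply: H2 | apply: Rle_trans hx2 _; apply: H1]; lra.
apply: (Rle_lt_trans _ (Rabs (s - t) * (M + 1))).
  by have := Rabs_pos (s - t); nra.
have -> : e = e / (M + 1) * (M + 1) by field; lra.
by apply: Rmult_lt_compat_r; lra.
Qed.

Lemma RInt_primitive_rder (h : R -> R) a t : cadlag h -> rder (RInt h a) t (h t).
Proof.
move=> hc; have hi x y := cadlag_ex_RInt h x y hc.
apply/rderP => e e0.
have [/(_ e e0) [d [d0 Hd]] _] := hc t.
exists d; split=> // s hs.
have -> : RInt h a s - RInt h a t = RInt h t s.
  rewrite -(RInt_Chasles h a t s) // /plus /=; ring.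
have -> : RInt h t s - h t * (s - t) = RInt (fun x => minus (h x) (h t)) t s.
  rewrite RInt_minus //; last exact: ex_RInt_const.
  by rewrite RInt_const /minus /plus /opp /scal /= /mult /=; ring.
rewrite Rmult_comm; apply: abs_RInt_le_const; first lra.
  by apply: ex_RInt_minus => //; apply: ex_RInt_const.
by move=> x hx; apply: Rlt_le; apply: Hd; lra.
Qed.

(** The fundamental theorem of calculus for right derivatives: [F] minus the primitive of [h] is
    continuous with zero right derivative, hence constant. *)
Lemma is_RInt_rder (F h : R -> R) a b :
  (forall s, continuous F s) -> cadlag h ->
  (forall s, Rmin a b <= s < Rmax a b -> rder F s (h s)) -> is_RInt h a b (F b - F a).
Proof.
wlog ab : a b / a <= b.
  move=> W Fc hc H; case: (Rle_lt_dec a b) => ab; first exact: W.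
  have -> : F b - F a = opp (F a - F b) by rewrite /opp /=; ring.
  apply: is_RInt_swap; apply: W => //; first lra.
  by rewrite Rmin_comm Rmax_comm.
rewrite Rmin_left // Rmax_right // => Fc hc H.
have hi x y := cadlag_ex_RInt h x y hc.
have E : F b - RInt h a b = F a - RInt h a a.
  apply: (rder0_const (fun s => F s - RInt h a s)) => // s.
    by apply: filterlim_subR; [apply: Fc | apply: RInt_primitive_continuous].
  move=> hs; have := rder_sub _ _ _ _ _ (H s hs) (RInt_primitive_rder h a s hc).
  by rewrite Rminus_diag.
have -> : F b - F a = RInt h a b.
  by move: E; rewrite RInt_point /zero /=; lra.
exact: RInt_correct.
Qed.

Lemma has_int_neginf_unique h b I J :
  has_int_neginf h b I -> has_int_neginf h b J -> I = J.
Proof.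
move=> [hI HI] [_ HJ].
case: (Req_dec I J) => // ne; exfalso.
have e0 : Rabs (I - J) / 2 > 0.
  by have := Rabs_pos_lt (I - J); lra.
have [M HM] := HI _ e0; have [M' HM'] := HJ _ e0.
pose a := Rmin b (Rmin M M').
have ab : a <= b by apply: Rmin_l.
have aM : a <= M by apply: Rle_trans (Rmin_r _ _) (Rmin_l _ _).
have aM' : a <= M' by apply: Rle_trans (Rmin_r _ _) (Rmin_r _ _).
have [V HV] := hI a ab.
have h1 := HM a V aM ab HV; have h2 := HM' a V aM' ab HV.
have := Rabs_triang (V - J) (- (V - I)).
rewrite Rabs_Ropp; have -> : V - J + - (V - I) = I - J by ring.
lra.
Qed.

Lemma Rint_neginf_unique h b I : has_int_neginf h b I -> Rint_neginf h b = I.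
Proof.
move=> H; apply: (has_int_neginf_unique h b) => //.
by apply: epsilon_spec; exists I.
Qed.

(** * The matrix exponential *)

Lemma is_series_extR (c d : nat -> R) (l : R) :
  (forall k, c k = d k) -> is_series c l -> is_series d l.
Proof. exact: is_series_ext. Qed.

Lemma is_series_rsum n (c : 'I_n -> nat -> R) (l : 'I_n -> R) :
  (forall i, is_series (c i) (l i)) ->
  is_series (fun k => \rsum_(i < n) c i k) (\rsum_(i < n) l i).
Proof.
elim: n c l => [|n IH] c l H.
  apply: (is_series_extR (fun _ => 0)); first by move=> k; rewrite big_ord0.
  rewrite big_ord0; apply: filterlim_ext (filterlim_const 0) => k.
  by rewrite sum_n_const Rmult_0_r.
rewrite big_ord_recr /=.
apply: (is_series_extR (fun k => plus (\rsum_(i < n) c (widen_ord (leqnSn n) i) k) (c ord_max k))).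
  by move=> k; rewrite big_ord_recr.
by apply: is_series_plus => //; apply: IH => i.
Qed.

Lemma mmulA n (A B C : mat n) : mmul A (mmul B C) = mmul (mmul A B) C.
Proof.
apply: functional_extensionality => i; apply: functional_extensionality => j.
rewrite /mmul; transitivity (\rsum_(k < n) \rsum_(l < n) (A i k * B k l * C l j)).
  by apply: eq_bigr => k _; rewrite -rsumZ; apply: eq_bigr => l _; ring.
rewrite exchange_big; apply: eq_bigr => l _ /=.
by rewrite Rmult_comm -rsumZ; apply: eq_bigr => k _; ring.
Qed.

Lemma mpow_comm n (A : mat n) k : mmul A (mpow A k) = mmul (mpow A k) A.
Proof.
elim: k => [|k IH] /=; last by rewrite {1}IH mmulA.
apply: functional_extensionality => i; apply: functional_extensionality => j.
rewrite /mmul /mid (bigD1 j) //= eqxx big1 => [|k /negbTE ->]; last by ring.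
rewrite [in RHS](bigD1 i) //= eqxx big1 => [|k]; first by ring.
by rewrite eq_sym => /negbTE ->; ring.
Qed.

Lemma mpow_bound n (A : mat n) k i j : Rabs (mpow A k i j) <= mnorm A ^ k.
Proof.
elim: k i j => [|k IH] i j /=.
  by rewrite /mid; case: (i == j); rewrite ?Rabs_R1 ?Rabs_R0; lra.
apply: Rle_trans (rsum_abs _ _) _.
apply: (Rle_trans _ (mnorm A ^ k * \rsum_(l < n) Rabs (A i l))).
  rewrite -rsumZ; apply: rsum_le => l; rewrite Rabs_mult Rmult_comm.
  by apply: Rmult_le_compat_r; [apply: Rabs_pos | apply: IH].
rewrite Rmult_comm; apply: Rmult_le_compat_r; first exact/pow_le/mnorm_ge0.
apply: (rsum_term_le n (fun i => \rsum_(l < n) Rabs (A i l))) => i'.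
by apply: rsum_ge0 => l; apply: Rabs_pos.
Qed.

(** Each entry of the matrix exponential is read as a scalar power series in [t], so that the theory
    of power series supplies derivatives. *)
Definition mexp_coef {n} (A : mat n) i j (k : nat) : R := mpow A k i j / INR (Factorial.fact k).

(** The terms at [r] are bounded by [(mnorm A |r|)^k / k!], one term of an exponential series, hence
    by a constant. The radius thus exceeds every real number. *)
Lemma mexp_coef_CV_radius n (A : mat n) i j : CV_radius (mexp_coef A i j) = p_infty.
Proof.
have [ub _] := CV_radius_bounded (mexp_coef A i j).
have H (r : R) : Rbar_le r (CV_radius (mexp_coef A i j)).
  refine (ub r _); exists (exp (mnorm A * Rabs r)) => k.
  have M0 : 0 <= mnorm A * Rabs r.
    by apply: Rmult_le_pos; [apply: mnorm_ge0 | apply: Rabs_pos].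
  have f0 l : 0 < INR (Factorial.fact l) by apply: INR_fact_lt_0.
  apply: Rle_trans (exp_ge_taylor _ k M0).
  apply: (Rle_trans _ ((mnorm A * Rabs r) ^ k / INR (Factorial.fact k))).
    rewrite /mexp_coef /Rdiv !Rabs_mult -RPow_abs Rpow_mult_distr.
    rewrite (Rabs_right (/ _)); last by apply/Rle_ge/Rlt_le/Rinv_0_lt_compat/f0.
    rewrite Rmult_assoc (Rmult_comm (/ _)) -Rmult_assoc.
    apply: Rmult_le_compat_r; first exact/Rlt_le/Rinv_0_lt_compat/f0.
    by apply: Rmult_le_compat_r; [exact/pow_le/Rabs_pos | apply: mpow_bound].
  case: k => [|k] /=; first lra.
  rewrite -[X in X <= _]Rplus_0_l; apply: Rplus_le_compat_r.
  apply: cond_pos_sum => l; apply: Rmult_le_pos; first exact: pow_le.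
  exact/Rlt_le/Rinv_0_lt_compat/f0.
case: (CV_radius _) H => [r H|//|H]; last by have := H 0.
by have := H (r + 1) => /=; lra.
Qed.

Lemma mexp_PSeries n (A : mat n) t i j : mexp A t i j = PSeries (mexp_coef A i j) t.
Proof.
have H : infinite_sum (fun k => t ^ k / INR (Factorial.fact k) * mpow A k i j)
   (PSeries (mexp_coef A i j) t).
  apply/is_series_Reals.
  apply: (is_series_extR (fun k => mexp_coef A i j k * t ^ k)).
    by move=> k; rewrite /mexp_coef /Rdiv; ring.
  apply/is_pseries_R; apply: PSeries_correct; apply: CV_radius_inside.
  by rewrite mexp_coef_CV_radius.
have H2 : infinite_sum (fun k => t ^ k / INR (Factorial.fact k) * mpow A k i j) (mexp A t i j).
  by rewrite /mexp; apply: epsilon_spec; eexists; exact: H.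
exact: uniqueness_sum H2 H.
Qed.

Lemma mexp_coef_derive n (A : mat n) i j k :
  PS_derive (mexp_coef A i j) k = mmul A (mpow A k) i j / INR (Factorial.fact k).
Proof.
rewrite /PS_derive /mexp_coef fact_simpl mult_INR /=.
by field; split; [apply: INR_fact_neq_0 | apply: (not_0_INR k.+1)].
Qed.

Lemma PSeries_mexp_coef n (A : mat n) i j t :
  is_series (fun k => mexp_coef A i j k * t ^ k) (mexp A t i j).
Proof.
apply/is_pseries_R; rewrite mexp_PSeries; apply: PSeries_correct.
by apply: CV_radius_inside; rewrite mexp_coef_CV_radius.
Qed.

Lemma is_derive_mexp_l n (A : mat n) i j t :
  is_derive (fun s => mexp A s i j) t (mmul A (mexp A t) i j).
Proof.
apply: (is_derive_ext (PSeries (mexp_coef A i j))); first by move=> s; rewrite mexp_PSeries.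
have <- : PSeries (PS_derive (mexp_coef A i j)) t = mmul A (mexp A t) i j.
  apply: is_pseries_unique; apply/is_pseries_R.
  apply: (is_series_extR (fun k => \rsum_(l < n) (A i l * (mexp_coef A l j k * t ^ k)))).
    move=> k; rewrite mexp_coef_derive /mmul /mexp_coef /Rdiv.
    rewrite Rmult_assoc Rmult_comm -rsumZ; apply: eq_bigr => l _; ring.
  by apply: is_series_rsum => l; apply: is_series_scal; apply: PSeries_mexp_coef.
by apply: is_derive_PSeries; rewrite mexp_coef_CV_radius.
Qed.

Lemma mexp_comm n (A : mat n) t : mmul A (mexp A t) = mmul (mexp A t) A.
Proof.
apply: functional_extensionality => i; apply: functional_extensionality => j.
have h1 : is_series (fun k => \rsum_(l < n) (A i l * (mexp_coef A l j k * t ^ k)))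
  (mmul A (mexp A t) i j).
  by apply: is_series_rsum => l; apply: is_series_scal; apply: PSeries_mexp_coef.
have h2 : is_series (fun k => \rsum_(l < n) ((mexp_coef A i l k * t ^ k) * A l j))
  (mmul (mexp A t) A i j).
  by apply: is_series_rsum => l; apply: is_series_scal_r; apply: PSeries_mexp_coef.
rewrite -(is_series_unique _ _ h1) -(is_series_unique _ _ h2).
apply: Series_ext => k.
transitivity (t ^ k / INR (Factorial.fact k) * mmul A (mpow A k) i j).
  by rewrite /mmul -rsumZ; apply: eq_bigr => l _; rewrite /mexp_coef /Rdiv; ring.
rewrite mpow_comm /mmul -rsumZ; apply: eq_bigr => l _; rewrite /mexp_coef /Rdiv; ring.
Qed.

Lemma mexp0 n (A : mat n) : mexp A 0 = mid n.
Proof.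
apply: functional_extensionality => i; apply: functional_extensionality => j.
by rewrite mexp_PSeries PSeries_0 /mexp_coef /=; field.
Qed.

Lemma mulmv_mexp0 n (A : mat n) x : mulmv (mexp A 0) x = x.
Proof. by rewrite mexp0 mulmv_mid. Qed.

Lemma continuous_mexp n (A : mat n) i j t : continuous (fun s => mexp A s i j) t.
Proof. by apply: ex_derive_continuous; eexists; apply: is_derive_mexp_l. Qed.

Lemma vcont_mulmv_mexp n (A : mat n) (r : R -> R) (D : R -> vec n) :
  (forall t, continuous r t) -> vcont D -> vcont (fun s => mulmv (mexp A (r s)) (D s)).
Proof.
move=> rc Dc i t; apply: filterlim_rsum => j; apply: filterlim_mulR (Dc j t).
by apply: (filterlim_compR r (fun s => mexp A s i j)); [apply: rc | apply: continuous_mexp].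
Qed.

Lemma vrder_mulmv_mexp n (A : mat n) (D : R -> vec n) t l :
  vrder D t l ->
  vrder (fun s => mulmv (mexp A s) (D s)) t
    (vadd (mulmv A (mulmv (mexp A t) (D t))) (mulmv (mexp A t) l)).
Proof.
move=> Dd i; rewrite -mulmv_mmul /vadd /mulmv -rsumD.
by apply: rder_rsum => j; apply: rder_mul (Dd j); apply/is_derive_rder/is_derive_mexp_l.
Qed.

(* Integrating factor: the factor commutes with [A], so only the forcing term survives. *)
Lemma vrder_integrating_factor n (A : mat n) (D : R -> vec n) t s k :
  vrder D s (vadd (mulmv A (D s)) k) ->
  vrder (fun r => mulmv (mexp A (t - r)) (D r)) s (mulmv (mexp A (t - s)) k).
Proof.
move=> Dd i.
have -> : mulmv (mexp A (t - s)) k i =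
   \rsum_(j < n) (- mmul A (mexp A (t - s)) i j * D s j
                  + mexp A (t - s) i j * vadd (mulmv A (D s)) k j).
  have -> : \rsum_(j < n) (- mmul A (mexp A (t - s)) i j * D s j
                  + mexp A (t - s) i j * vadd (mulmv A (D s)) k j) =
     (-1) * mulmv (mmul A (mexp A (t - s))) (D s) i
      + mulmv (mexp A (t - s)) (vadd (mulmv A (D s)) k) i.
    by rewrite rsumD; congr Rplus; rewrite /mulmv -rsumZ; apply: eq_bigr => j _; ring.
  by rewrite mexp_comm mulmv_mmul mulmv_vadd /vadd; ring.
apply: rder_rsum => j; apply: rder_mul (Dd j); apply: is_derive_rder.
have -> : - mmul A (mexp A (t - s)) i j = scal (-1) (mmul A (mexp A (t - s)) i j).
  by rewrite /scal /= /mult /=; ring.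
apply: (is_derive_comp (fun r => mexp A r i j) (fun r => t - r)); first exact: is_derive_mexp_l.
by auto_derive => //; ring.
Qed.

(** No Cauchy product of series: [e^{A(t+s-r)} e^{Ar} x] has zero right derivative in [r], and its
    values at [r = s] and [r = 0] are the two sides. *)
Lemma mexp_add n (A : mat n) t s x :
  mulmv (mexp A t) (mulmv (mexp A s) x) = mulmv (mexp A (t + s)) x.
Proof.
pose W r := mulmv (mexp A (t + s - r)) (mulmv (mexp A r) x).
have Wc : vcont W.
  apply: vcont_mulmv_mexp.
    by move=> r; apply: filterlim_subR; [apply: filterlim_const | apply: continuous_id].
  apply: vcont_mulmv_mexp; first by move=> r; apply: continuous_id.
  by move=> i r; apply: continuous_const.
have Wd r i : rder (fun r => W r i) r 0.
  have -> : 0 = mulmv (mexp A (t + s - r)) (fun _ => 0) i.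
    by rewrite /mulmv rsum_eq0 // => j; ring.
  apply: vrder_integrating_factor => {}i.
  have -> : (fun _ : 'I_n => 0) = mulmv (mexp A r) (fun _ => 0).
    by apply: functional_extensionality => j; rewrite /mulmv rsum_eq0 // => k; ring.
  apply: (vrder_mulmv_mexp _ _ (fun _ => x)) => j; exact: rder_const.
have WE u v : W u = W v.
  wlog uv : u v / u <= v.
    by move=> H; case: (Rle_lt_dec u v) => h; [apply: H | rewrite -(H v u) //; lra].
  by apply: functional_extensionality => i; rewrite (rder0_const (fun r => W r i) u v uv) // => *; apply: Wc.
have := WE s 0; rewrite /W mulmv_mexp0.
have -> : t + s - s = t by ring.
by have -> : t + s - 0 = t + s by ring.
Qed.

Lemma mexpK n (A : mat n) t x : mulmv (mexp A t) (mulmv (mexp A (- t)) x) = x.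
Proof. by rewrite mexp_add Rplus_opp_r mulmv_mexp0. Qed.

(** * A fixed point theorem in a weighted norm *)

(** The supremum [S] of [h] on [D] satisfies [S <= d + rho S]. The a priori bound is what makes [S]
    finite and the inequality solvable. *)
Lemma self_bound (D : R -> Prop) (h : R -> R) d rho : rho < 1 ->
  (exists M, forall t, D t -> h t <= M) ->
  (forall C, (forall t, D t -> h t <= C) -> forall t, D t -> h t <= d + rho * C) ->
  forall t, D t -> h t <= d / (1 - rho).
Proof.
move=> r1 [M HM] H t Dt.
have [S [ub lub]] : {S | is_lub (fun y => exists2 s, D s & y = h s) S}.
  apply: completeness; first by exists M => y [s Ds ->]; apply: HM.
  by exists (h t), t.
have hS s : D s -> h s <= S by move=> Ds; apply: ub; exists s.
have : S <= d + rho * S by apply: lub => y [s Ds ->]; apply: H.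
move=> h1; apply: (Rle_trans _ S); first exact: hS.
apply: (Rmult_le_reg_r (1 - rho)); first lra.
have -> : d / (1 - rho) * (1 - rho) = d by field; lra.
lra.
Qed.

Lemma geom_le0 x c rho : 0 <= rho < 1 -> (forall k, x <= c * rho ^ k) -> x <= 0.
Proof.
move=> hr H.
have lim : is_lim_seq (fun k => c * rho ^ k) (c * 0).
  apply: (is_lim_seq_scal_l (fun k => rho ^ k) c 0); apply: is_lim_seq_geom; rewrite Rabs_right; lra.
rewrite Rmult_0_r in lim.
exact: (is_lim_seq_le (fun _ => x) (fun k => c * rho ^ k) x 0 H (is_lim_seq_const x) lim).
Qed.

Lemma geom_cauchy_lim (u : nat -> R) c rho : 0 <= rho < 1 ->
  (forall k j, Rabs (u (k + j)%N - u k) <= c * rho ^ k) ->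
  forall k, Rabs (u k - real (Lim_seq u)) <= c * rho ^ k.
Proof.
move=> hr H.
have c0 : 0 <= c by have := H 0%N 0%N; have := Rabs_pos (u (0 + 0)%N - u 0%N); rewrite /=; lra.
have [l Hl] : ex_finite_lim_seq u.
  apply/ex_lim_seq_cauchy_corr => eps.
  have e0 := cond_pos eps.
  have [||N HN] := pow_lt_1_zero rho _ (eps / (2 * (c + 1))).
  - by rewrite Rabs_right; lra.
  - by apply: Rdiv_lt_0_compat; lra.
  have small k : (N <= k)%coq_nat -> Rabs (u k - u N) < eps / 2.
    move=> Nk; have -> : k = (N + (k - N))%N by rewrite subnKC //; apply/leP.
    apply: Rle_lt_trans (H _ _) _.
    have := HN N (le_n _); rewrite Rabs_right; last exact/Rle_ge/pow_le/(proj1 hr).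
    move=> h; apply: (Rle_lt_trans _ ((c + 1) * rho ^ N)).
      by have := pow_le rho N (proj1 hr); nra.
    have -> : eps / 2 = (c + 1) * (eps / (2 * (c + 1))) by field; lra.
    by apply: Rmult_lt_compat_l; lra.
  exists N => p q Np Nq.
  have := Rabs_triang (u p - u N) (- (u q - u N)); rewrite Rabs_Ropp.
  have -> : u p - u N + - (u q - u N) = u p - u q by ring.
  by have := small p Np; have := small q Nq; lra.
move=> k; rewrite (is_lim_seq_unique _ _ Hl) /=.
have lim : is_lim_seq (fun j => Rabs (u k - u (j + k)%coq_nat)) (Rabs (u k - l)).
  apply: (is_lim_seq_abs _ (u k - l)).
  apply: is_lim_seq_minus'; first exact: is_lim_seq_const.
  exact: (proj1 (is_lim_seq_incr_n u k l) Hl).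
apply: (is_lim_seq_le _ (fun _ => c * rho ^ k) _ _ _ lim (is_lim_seq_const _)) => j.
by rewrite Rabs_minus_sym plusE addnC; apply: H.
Qed.

Section Contraction.
Variables (n m : nat) (wt : R -> R).
Hypothesis wt_gt0 : forall t, 0 < wt t.
Hypothesis wt_cont : forall t, continuous wt t.
Implicit Types (U : R -> vec n) (V : R -> vec m).

Definition wbounded U V := exists M, forall t, vnorm (U t) + vnorm (V t) <= M * wt t.
Definition wadm U V := vcont U /\ vcont V /\ wbounded U V.
(** The weighted distance is encoded as a relation with an explicit bound [C], which spares the
    construction of a supremum norm and of a complete space. *)
Definition wdist_le C U V U' V' :=
  forall t, vnorm (vsub (U t) (U' t)) + vnorm (vsub (V t) (V' t)) <= C * wt t.

Lemma wdist_le_trans C1 C2 U V U' V' U'' V'' :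
  wdist_le C1 U V U' V' -> wdist_le C2 U' V' U'' V'' -> wdist_le (C1 + C2) U V U'' V''.
Proof.
move=> H1 H2 t; have := H1 t; have := H2 t.
have := vnorm_vsub_triangle _ (U t) (U' t) (U'' t).
have := vnorm_vsub_triangle _ (V t) (V' t) (V'' t); lra.
Qed.

Variables (T1 : (R -> vec n) -> (R -> vec m) -> R -> vec n)
          (T2 : (R -> vec n) -> (R -> vec m) -> R -> vec m) (rho : R).
Hypothesis rho01 : 0 <= rho < 1.
Hypothesis T_adm : forall U V, wadm U V -> wadm (T1 U V) (T2 U V).
Hypothesis T_contr : forall U V U' V' C, wadm U V -> wadm U' V' ->
  wdist_le C U V U' V' -> wdist_le (rho * C) (T1 U V) (T2 U V) (T1 U' V') (T2 U' V').

Let it k := iter k (fun p : (R -> vec n) * (R -> vec m) => (T1 p.1 p.2, T2 p.1 p.2))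
  (fun _ _ => 0, fun _ _ => 0).

Let wdist_le_it C j k := wdist_le C (it j).1 (it j).2 (it k).1 (it k).2.

Local Lemma it_adm k : wadm (it k).1 (it k).2.
Proof.
elim: k => [|k IH] /=; last exact: T_adm.
split; [|split]; try by move=> i t; apply: continuous_const.
by exists 0 => t; rewrite !vnorm0; lra.
Qed.

(** The first iterate lies within some [M] of the zero pair, consecutive iterates approach each
    other by the factor [rho], and the geometric series sums to [M / (1 - rho)]. *)
Local Lemma it_cauchy : exists C, 0 <= C /\ forall k j, wdist_le_it (C * rho ^ k) (k + j) k.
Proof.
have [_ [_ [M HM]]] := it_adm 1%N.
have M0 : 0 <= M.
  have := HM 0; have := vnorm_ge0 _ ((it 1).1 0); have := vnorm_ge0 _ ((it 1).2 0).
  by have := wt_gt0 0; nra.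
have step k : wdist_le_it (M * rho ^ k) k.+1 k.
  elim: k => [|k IH].
    move=> t; have := HM t.
    by rewrite /= !vsub0; lra.
  have -> : M * rho ^ k.+1 = rho * (M * rho ^ k) by rewrite /=; ring.
  by apply: T_contr IH; apply: it_adm.
have geo k j : wdist_le_it (M * rho ^ k * ((1 - rho ^ j) / (1 - rho))) (k + j) k.
  elim: j => [|j IH].
    by move=> t; rewrite addn0 !vsubxx !vnorm0 /=; apply/Req_le; field; lra.
  rewrite addnS.
  have -> : M * rho ^ k * ((1 - rho ^ j.+1) / (1 - rho)) =
    M * rho ^ (k + j) + M * rho ^ k * ((1 - rho ^ j) / (1 - rho)).
    by rewrite -plusE pow_add /=; field; lra.
  exact: wdist_le_trans (step _) IH.
exists (M / (1 - rho)); split.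
  by apply: Rmult_le_pos => //; apply/Rlt_le/Rinv_0_lt_compat; lra.
move=> k j t; apply: Rle_trans (geo k j t) _.
apply: Rmult_le_compat_r; first exact/Rlt_le/wt_gt0.
have -> : M / (1 - rho) * rho ^ k = M * rho ^ k * (1 / (1 - rho)) by field; lra.
have h0 j' := pow_le rho j' (proj1 rho01).
apply: Rmult_le_compat_l; first exact: Rmult_le_pos.
apply: Rmult_le_compat_r; first by apply/Rlt_le/Rinv_0_lt_compat; lra.
by have := h0 j; lra.
Qed.

Let U_lim : R -> vec n := fun t i => real (Lim_seq (fun k => (it k).1 t i)).
Let V_lim : R -> vec m := fun t j => real (Lim_seq (fun k => (it k).2 t j)).

Local Lemma it_lim : exists C, 0 <= C /\
  forall k, wdist_le (C * rho ^ k) (it k).1 (it k).2 U_lim V_lim.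
Proof.
have [C [C0 HC]] := it_cauchy.
(* Limits are taken coordinate by coordinate; the factor [INR n + INR m] is the price of returning
   to Euclidean norms. *)
exists ((INR n + INR m) * C); split.
  by apply: Rmult_le_pos => //; have := pos_INR n; have := pos_INR m; lra.
have hU t i k : Rabs ((it k).1 t i - U_lim t i) <= (C * wt t) * rho ^ k.
  apply: (geom_cauchy_lim (fun k => (it k).1 t i)) => // {}k j.
  apply: Rle_trans (coord_le_vnorm _ (vsub ((it (k + j)).1 t) ((it k).1 t)) i) _.
  have := HC k j t; have := vnorm_ge0 _ (vsub ((it (k + j)).2 t) ((it k).2 t)); lra.
have hV t i k : Rabs ((it k).2 t i - V_lim t i) <= (C * wt t) * rho ^ k.
  apply: (geom_cauchy_lim (fun k => (it k).2 t i)) => // {}k j.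
  apply: Rle_trans (coord_le_vnorm _ (vsub ((it (k + j)).2 t) ((it k).2 t)) i) _.
  have := HC k j t; have := vnorm_ge0 _ (vsub ((it (k + j)).1 t) ((it k).1 t)); lra.
move=> k t.
have := vnorm_le_coord _ (vsub ((it k).1 t) (U_lim t)) _ (fun i => hU t i k).
have := vnorm_le_coord _ (vsub ((it k).2 t) (V_lim t)) _ (fun i => hV t i k).
lra.
Qed.

(** The convergence is uniform only where the weight is bounded, so [s] is kept where
    [wt s < wt t + 1] before the usual three-term estimate. *)
Local Lemma uniform_lim_continuous (u : nat -> R -> R) (l : R -> R) C :
  0 <= C -> (forall k t, continuous (u k) t) ->
  (forall k t, Rabs (u k t - l t) <= C * rho ^ k * wt t) -> forall t, continuous l t.
Proof.
move=> C0 uc ul t; apply/continuous_RP => e e0.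
have [d1 [d10 Hd1]] := proj1 (continuous_RP wt t) (wt_cont t) 1 Rlt_0_1.
have w0 := wt_gt0 t.
pose c := (C + 1) * (wt t + 1).
have c0 : 0 < c by rewrite /c; nra.
have [||N HN] := pow_lt_1_zero rho _ (e / 3 / c).
- by rewrite Rabs_right; lra.
- by apply: Rdiv_lt_0_compat; lra.
have small s : wt s < wt t + 1 -> Rabs (u N s - l s) < e / 3.
  move=> ws; apply: Rle_lt_trans (ul N s) _.
  have := HN N (le_n _); have r0 := pow_le rho N (proj1 rho01).
  rewrite Rabs_right; last lra.
  move=> h; have : c * rho ^ N < e / 3.
    have -> : e / 3 = c * (e / 3 / c) by field; lra.
    exact: Rmult_lt_compat_l.
  apply: Rle_lt_trans; have s0 := wt_gt0 s.
  have -> : c * rho ^ N = (C + 1) * rho ^ N * (wt t + 1) by rewrite /c; ring.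
  apply: Rmult_le_compat; [exact: Rmult_le_pos | lra | | lra].
  by apply: Rmult_le_compat_r => //; lra.
have [|d2 [d20 Hd2]] := proj1 (continuous_RP (u N) t) (uc N t) (e / 3); first lra.
exists (Rmin d1 d2); split; first exact: Rmin_glb_lt.
move=> s hs.
have h1 := Hd1 s (Rlt_le_trans _ _ _ hs (Rmin_l _ _)).
have h2 := Hd2 s (Rlt_le_trans _ _ _ hs (Rmin_r _ _)).
move/Rabs_lt_between: h1 => h1.
have := small s ltac:(lra); have := small t ltac:(lra).
move: h2 => /Rabs_lt_between h2 /Rabs_lt_between h3 /Rabs_lt_between h4.
apply/Rabs_lt_between; lra.
Qed.

(** Picard iteration from the zero pair; the limit is fixed because its image and itself are both
    within a multiple of [rho^k] of the next iterate. The weight stays abstract because two are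
    used: [e^{2L|t|}] for global solvability and [e^{eta min(t,0)}] for bounded backward
    solutions. *)
Theorem contraction_fixpoint :
  exists U V, wadm U V /\ forall t, T1 U V t = U t /\ T2 U V t = V t.
Proof.
have [C [C0 HC]] := it_lim.
have adm : wadm U_lim V_lim.
  split; [|split].
  - move=> i t.
    apply: (uniform_lim_continuous (fun k s => (it k).1 s i) (fun s => U_lim s i) C C0).
      by move=> k s; have [h _] := it_adm k; apply: h.
    move=> k s; apply: Rle_trans (coord_le_vnorm _ (vsub ((it k).1 s) (U_lim s)) i) _.
    have := HC k s; have := vnorm_ge0 _ (vsub ((it k).2 s) (V_lim s)); lra.
  - move=> i t.
    apply: (uniform_lim_continuous (fun k s => (it k).2 s i) (fun s => V_lim s i) C C0).
      by move=> k s; have [_ [h _]] := it_adm k; apply: h.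
    move=> k s; apply: Rle_trans (coord_le_vnorm _ (vsub ((it k).2 s) (V_lim s)) i) _.
    have := HC k s; have := vnorm_ge0 _ (vsub ((it k).1 s) (U_lim s)); lra.
  - exists C => t; have := HC 0%N t.
    by rewrite /= !(vnorm_vsubC _ (fun _ => 0)) !vsub0; lra.
exists U_lim, V_lim; split=> // t.
have H k : vnorm (vsub (T1 U_lim V_lim t) (U_lim t)) + vnorm (vsub (T2 U_lim V_lim t) (V_lim t))
    <= 2 * C * wt t * rho ^ k.
  have h1 := T_contr _ _ _ _ _ (it_adm k) adm (HC k) t.
  have h2 := HC k.+1 t; rewrite /= in h1 h2.
  have := vnorm_vsub_triangle _ (T1 U_lim V_lim t) ((it k.+1).1 t) (U_lim t).
  have := vnorm_vsub_triangle _ (T2 U_lim V_lim t) ((it k.+1).2 t) (V_lim t).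
  rewrite (vnorm_vsubC _ (T1 U_lim V_lim t) ((it k.+1).1 t)) (vnorm_vsubC _ (T2 U_lim V_lim t) ((it k.+1).2 t)) /=.
  have := Rmult_le_pos _ _ (Rmult_le_pos _ _ C0 (pow_le rho k (proj1 rho01))) (Rlt_le _ _ (wt_gt0 t)).
  set q := C * rho ^ k * wt t => q0 h3 h4.
  have e1 : rho * (C * rho ^ k) * wt t = rho * q by rewrite /q; ring.
  have e2 : C * (rho * rho ^ k) * wt t = rho * q by rewrite /q; ring.
  have -> : 2 * C * wt t * rho ^ k = 2 * q by rewrite /q; ring.
  by rewrite e1 in h1; rewrite e2 in h2; have ? : rho * q <= q by [nra]; lra.
have {}H := geom_le0 _ _ _ rho01 H.
have := vnorm_ge0 _ (vsub (T1 U_lim V_lim t) (U_lim t)).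
have := vnorm_ge0 _ (vsub (T2 U_lim V_lim t) (V_lim t)).
by split; apply: vsub_eq0; lra.
Qed.

End Contraction.

(** * Variation of constants and exponential dichotomy *)

Definition vcadlag {n} (h : R -> vec n) : Prop := forall i, cadlag (fun s => h s i).

Lemma vcont_sub n (U V : R -> vec n) : vcont U -> vcont V -> vcont (fun s => vsub (U s) (V s)).
Proof. by move=> hU hV i t; apply: filterlim_subR; [apply: hU | apply: hV]. Qed.

Lemma vcont_add n (U V : R -> vec n) : vcont U -> vcont V -> vcont (fun s => vadd (U s) (V s)).
Proof. by move=> hU hV i t; apply: filterlim_addR; [apply: hU | apply: hV]. Qed.

Lemma vcont_comp n (U : R -> vec n) (r : R -> R) :
  vcont U -> (forall t, continuous r t) -> vcont (fun s => U (r s)).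
Proof.
by move=> hU hr i t; apply: (filterlim_compR r (fun s => U s i)); [apply: hr | apply: hU].
Qed.

Lemma vcadlag_sub n (U V : R -> vec n) :
  vcadlag U -> vcadlag V -> vcadlag (fun s => vsub (U s) (V s)).
Proof. by move=> hU hV i; apply: cadlag_sub; [apply: hU | apply: hV]. Qed.

Lemma vcadlag_mulmv_mexp n (A : mat n) (r : R -> R) (h : R -> vec n) :
  (forall t, continuous r t) -> vcadlag h -> vcadlag (fun s => mulmv (mexp A (r s)) (h s)).
Proof.
move=> rc hc i; apply: cadlag_rsum => j; apply: cadlag_mul (hc j).
apply: cadlag_continuous => t.
by apply: (filterlim_compR r (fun s => mexp A s i j)); [apply: rc | apply: continuous_mexp].
Qed.

Lemma continuous_sub_l t s : continuous (fun r => t - r) s.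
Proof. by apply: filterlim_subR; [apply: filterlim_const | apply: continuous_id]. Qed.

Lemma continuous_oppR s : continuous (fun r => - r) s.
Proof. by apply: continuous_opp; apply: continuous_id. Qed.

Definition lin_ode {n} (A : mat n) (h : vec n) (U : R -> vec n) (t : R) : Prop :=
  vrder U t (vadd (mulmv A (U t)) h).

Lemma lin_ode_sub n (A : mat n) h k (U V : R -> vec n) t :
  lin_ode A h U t -> lin_ode A k V t ->
  lin_ode A (vsub h k) (fun s => vsub (U s) (V s)) t.
Proof.
move=> hU hV i; rewrite mulmv_vsub.
have := rder_sub _ _ _ _ _ (hU i) (hV i).
by congr rder; rewrite /vadd /vsub; ring.
Qed.

(** The fundamental theorem applied to [r -> e^{A(t-r)} U(r)]. Both orders of [s] and [t] are
    allowed, since the unstable component is integrated backward from 0 and the stable one forward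
    from the past. *)
Lemma variation_of_constants n (A : mat n) (U h : R -> vec n) s t i :
  vcont U -> vcadlag h ->
  (forall r, Rmin s t <= r < Rmax s t -> lin_ode A (h r) U r) ->
  is_RInt (fun r => mulmv (mexp A (t - r)) (h r) i) s t
    (U t i - mulmv (mexp A (t - s)) (U s) i).
Proof.
move=> Uc hc H.
have -> : U t i = mulmv (mexp A (t - t)) (U t) i by rewrite Rminus_diag mulmv_mexp0.
apply: (is_RInt_rder (fun r => mulmv (mexp A (t - r)) (U r) i)).
- move=> r; apply: (vcont_mulmv_mexp n A (fun r => t - r)) => //; exact: continuous_sub_l.
- apply: (vcadlag_mulmv_mexp n A (fun r => t - r)) => //; exact: continuous_sub_l.
- by move=> r hr; apply: vrder_integrating_factor; apply: H.
Qed.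

(** The solution of [U' = A U + h] with value [c] at 0. With [e^{At}] factored out, the integrand no
    longer depends on [t], and the product rule gives the equation. *)
Definition duhamel {n} (A : mat n) (c : vec n) (h : R -> vec n) (t : R) : vec n :=
  mulmv (mexp A t) (vadd c (fun i => RInt (fun s => mulmv (mexp A (- s)) (h s) i) 0 t)).

Section Duhamel.
Context {n : nat} (A : mat n) (c : vec n) (h : R -> vec n) (hc : vcadlag h).

Lemma duhamel_kernel_cadlag : vcadlag (fun s => mulmv (mexp A (- s)) (h s)).
Proof. exact: (vcadlag_mulmv_mexp n A Ropp) continuous_oppR hc. Qed.

Lemma duhamel_vcont : vcont (duhamel A c h).
Proof.
apply: (vcont_mulmv_mexp n A (fun t => t)); first by move=> t; apply: continuous_id.
move=> i t; apply: filterlim_addR; first exact: filterlim_const.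
apply: RInt_primitive_continuous => x y; apply: cadlag_ex_RInt; exact: duhamel_kernel_cadlag.
Qed.

Lemma duhamel_ode t : lin_ode A (h t) (duhamel A c h) t.
Proof.
have E : h t = mulmv (mexp A t) (mulmv (mexp A (- t)) (h t)) by rewrite mexpK.
rewrite /lin_ode {1}E; apply: vrder_mulmv_mexp => i.
rewrite -[X in rder _ _ X]Rplus_0_l; apply: rder_add; first exact: rder_const.
apply: (RInt_primitive_rder (fun s => mulmv (mexp A (- s)) (h s) i)).
exact: duhamel_kernel_cadlag.
Qed.

Lemma duhamel0 : duhamel A c h 0 = c.
Proof.
rewrite /duhamel mulmv_mexp0; apply: functional_extensionality => i.
by rewrite /vadd RInt_point /zero /=; ring.
Qed.

End Duhamel.

Lemma exp_small c e : 0 < c -> 0 < e -> exists M, forall t, t <= M -> exp (c * t) < e.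
Proof.
move=> c0 e0; exists ((ln e - 1) / c) => t ht.
rewrite -[X in _ < X]exp_ln //; apply: exp_increasing.
have : c * t <= c * ((ln e - 1) / c) by apply: Rmult_le_compat_l; lra.
have -> : c * ((ln e - 1) / c) = ln e - 1 by field; lra.
lra.
Qed.

Lemma is_derive_scal_exp k c s : is_derive (fun r => k * exp (c * r)) s (k * c * exp (c * s)).
Proof. by auto_derive => //; ring. Qed.

Section Dichotomy.
Context {n : nat} (A : mat n) (eta C : R) (D k : R -> vec n).
Hypothesis D_cont : vcont D.
Hypothesis D_ode : forall s, s < 0 -> lin_ode A (k s) D s.
Hypothesis k_le : forall s, s < 0 -> vnorm (k s) <= C * exp (eta * s).

Local Lemma bound_ge0 : 0 <= C.
Proof.
have := k_le (-1) ltac:(lra); have := vnorm_ge0 _ (k (-1)).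
have := exp_pos (eta * -1); nra.
Qed.

(** Mean value inequality for [q -> e^{A(r-q)} D(q)], whose right derivative [e^{A(r-q)} k(q)] is at
    most [C e^{cr} e^{(eta-c)q}]. Integration of the latter produces the factor [1 / (eta - c)]:
    with [c = a] on [[t, 0]] and [c = b] on [[s, t]] these are the two terms of the gap
    condition. *)
Local Lemma flow_estimate (c : R) r s t : s <= t -> t <= 0 -> c <> eta ->
  (forall q, s <= q < t -> forall x, vnorm (mulmv (mexp A (r - q)) x) <= exp (c * (r - q)) * vnorm x) ->
  vnorm (vsub (mulmv (mexp A (r - t)) (D t)) (mulmv (mexp A (r - s)) (D s))) <=
  C / (eta - c) * exp (c * r) * (exp ((eta - c) * t) - exp ((eta - c) * s)).
Proof.
move=> st t0 ce H.
have C0 := bound_ge0.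
pose K := C / (eta - c) * exp (c * r).
have -> : C / (eta - c) * exp (c * r) * (exp ((eta - c) * t) - exp ((eta - c) * s)) =
   K * exp ((eta - c) * t) - K * exp ((eta - c) * s) by rewrite /K; ring.
apply: (vec_mean_value n (fun q => mulmv (mexp A (r - q)) (D q))
  (fun q => mulmv (mexp A (r - q)) (k q)) (fun q => K * exp ((eta - c) * q))
  (fun q => K * (eta - c) * exp ((eta - c) * q))) => //.
- by apply: vcont_mulmv_mexp => // q; apply: continuous_sub_l.
- by move=> q hq; apply: vrder_integrating_factor; apply: D_ode; lra.
- by move=> q; apply: is_derive_scal_exp.
move=> q hq; apply: Rle_trans (H q hq _) _.
have -> : K * (eta - c) * exp ((eta - c) * q) = exp (c * (r - q)) * (C * exp (eta * q)).
  have -> : K * (eta - c) = C * exp (c * r) by rewrite /K; field; lra.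
  have -> : exp (c * (r - q)) = exp (c * r) * exp (- (c * q)) by rewrite -exp_plus; congr exp; ring.
  have -> : exp ((eta - c) * q) = exp (eta * q) * exp (- (c * q)) by rewrite -exp_plus; congr exp; ring.
  ring.
by apply: Rmult_le_compat_l; [apply/Rlt_le/exp_pos | apply: k_le; lra].
Qed.

Lemma unstable_bound a : eta < a ->
  (forall t x, t <= 0 -> vnorm (mulmv (mexp A t) x) <= exp (a * t) * vnorm x) ->
  forall t, t <= 0 -> vnorm (D t) <= (vnorm (D 0) + C / (a - eta)) * exp (eta * t).
Proof.
move=> ha HA t t0.
have := flow_estimate a t t 0 t0 (Rle_refl 0) ltac:(lra)
  (fun q hq x => HA (t - q) x ltac:(lra)).
rewrite Rminus_diag mulmv_mexp0 Rminus_0_r Rmult_0_r exp_0 vnorm_vsubC.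
have -> : C / (eta - a) * exp (a * t) * (1 - exp ((eta - a) * t)) =
   C / (a - eta) * (exp (eta * t) - exp (a * t)).
  have -> : exp (eta * t) = exp (a * t) * exp ((eta - a) * t).
    by rewrite -exp_plus; congr exp; ring.
  by field; lra.
have D0 : D t = vadd (vsub (D t) (mulmv (mexp A t) (D 0))) (mulmv (mexp A t) (D 0)).
  by apply: functional_extensionality => i; rewrite /vadd /vsub; ring.
have := vnorm_vadd _ (vsub (D t) (mulmv (mexp A t) (D 0))) (mulmv (mexp A t) (D 0)).
rewrite -D0.
have := HA t (D 0) t0.
have h1 : exp (a * t) <= exp (eta * t).
  by case: (Req_dec t 0) => [->|tn]; [rewrite !Rmult_0_r; lra | apply/Rlt_le/exp_increasing; nra].
have h2 : 0 <= C / (a - eta) by apply: Rmult_le_pos bound_ge0 _; apply/Rlt_le/Rinv_0_lt_compat; lra.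
have := exp_pos (a * t); have := vnorm_ge0 _ (D 0).
nra.
Qed.

(* The contribution of the remote past may vanish either because [D] is bounded in
   the weighted norm or because [D] is built from a convergent improper integral;
   the hypothesis covers both. *)
Lemma stable_bound b : b < eta ->
  (forall t x, t >= 0 -> vnorm (mulmv (mexp A t) x) <= exp (b * t) * vnorm x) ->
  forall t, t <= 0 ->
  (forall e, 0 < e -> exists s, s <= t /\ vnorm (mulmv (mexp A (t - s)) (D s)) <= e) ->
  vnorm (D t) <= C / (eta - b) * exp (eta * t).
Proof.
move=> hb HB t t0 Hpast.
case: (Rle_lt_dec (vnorm (D t)) (C / (eta - b) * exp (eta * t))) => // h; exfalso.
(* Half of the supposed excess is left to the past, too little to account for the whole excess. *)
have [s [st hs]] := Hpast ((vnorm (D t) - C / (eta - b) * exp (eta * t)) / 2) ltac:(lra).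
have := flow_estimate b t s t st t0 ltac:(lra) (fun q hq x => HB (t - q) x ltac:(lra)).
rewrite Rminus_diag mulmv_mexp0.
have D0 : D t = vadd (vsub (D t) (mulmv (mexp A (t - s)) (D s))) (mulmv (mexp A (t - s)) (D s)).
  by apply: functional_extensionality => i; rewrite /vadd /vsub; ring.
have := vnorm_vadd _ (vsub (D t) (mulmv (mexp A (t - s)) (D s))) (mulmv (mexp A (t - s)) (D s)).
rewrite -D0.
have -> : C / (eta - b) * exp (b * t) * (exp ((eta - b) * t) - exp ((eta - b) * s)) =
   C / (eta - b) * exp (eta * t) - C / (eta - b) * (exp (b * t) * exp ((eta - b) * s)).
  have -> : exp (eta * t) = exp (b * t) * exp ((eta - b) * t).
    by rewrite -exp_plus; congr exp; ring.
  by ring.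
have h2 : 0 <= C / (eta - b) by apply: Rmult_le_pos bound_ge0 _; apply/Rlt_le/Rinv_0_lt_compat; lra.
have := Rmult_le_pos _ _ h2 (Rmult_le_pos _ _ (Rlt_le _ _ (exp_pos (b * t))) (Rlt_le _ _ (exp_pos ((eta - b) * s)))).
lra.
Qed.

End Dichotomy.

(** The norm is at most [M e^{bt} e^{(eta-b)s}], which vanishes as [s] goes to minus infinity
    because [b < eta]. *)
Lemma bounded_past n (B : mat n) b eta M (D : R -> vec n) : b < eta ->
  (forall t x, t >= 0 -> vnorm (mulmv (mexp B t) x) <= exp (b * t) * vnorm x) ->
  (forall t, t <= 0 -> vnorm (D t) <= M * exp (eta * t)) ->
  forall t e, t <= 0 -> 0 < e ->
  exists T, T <= t /\ forall s, s <= T -> vnorm (mulmv (mexp B (t - s)) (D s)) < e.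
Proof.
move=> hb HB HM t e t0 e0.
have M0 : 0 <= M.
  have := HM 0 ltac:(lra); have := vnorm_ge0 _ (D 0).
  by rewrite Rmult_0_r exp_0; lra.
have E0 := exp_pos (b * t).
have [T HT] := exp_small (eta - b) (e / ((M + 1) * exp (b * t))) ltac:(lra)
   ltac:(by apply: Rdiv_lt_0_compat => //; nra).
exists (Rmin t T); split; first exact: Rmin_l.
move=> s hs; have st := Rle_trans _ _ _ hs (Rmin_l _ _); have sT := Rle_trans _ _ _ hs (Rmin_r _ _).
apply: Rle_lt_trans (HB _ _ _) _; first lra.
apply: (Rle_lt_trans _ (exp (b * (t - s)) * (M * exp (eta * s)))).
  by apply: Rmult_le_compat_l; [apply/Rlt_le/exp_pos | apply: HM; lra].
have -> : exp (b * (t - s)) * (M * exp (eta * s)) = M * exp (b * t) * exp ((eta - b) * s).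
  have -> : exp (b * (t - s)) = exp (b * t) * exp (- (b * s)) by rewrite -exp_plus; congr exp; ring.
  have -> : exp ((eta - b) * s) = exp (eta * s) * exp (- (b * s)) by rewrite -exp_plus; congr exp; ring.
  ring.
have h := HT s sT; have E1 := exp_pos ((eta - b) * s).
apply: (Rle_lt_trans _ ((M + 1) * exp (b * t) * exp ((eta - b) * s))).
  by apply: Rmult_le_compat_r; [lra | nra].
have -> : e = (M + 1) * exp (b * t) * (e / ((M + 1) * exp (b * t))) by field; lra.
by apply: Rmult_lt_compat_l => //; nra.
Qed.

(** * Improper integrals and pairs of Lipschitz equations *)

Lemma at_minfty_iff (P : R -> Prop) :
  Rbar_locally m_infty P <-> exists M, forall s, s <= M -> P s.
Proof.
split=> [[M H]|[M H]].
  by exists (M - 1) => s hs; apply: H; lra.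
by exists M => s hs; apply: H; lra.
Qed.

Lemma has_int_neginf_lim (h : R -> R) b (I : R) : cadlag h ->
  has_int_neginf h b I <-> filterlim (fun s => RInt h s b) (Rbar_locally m_infty) (locally I).
Proof.
move=> hc; have hi x y := cadlag_ex_RInt h x y hc.
split=> [[_ H]|/filterlim_RP H].
  apply/filterlim_RP => e e0; have [M HM] := H e e0.
  apply/at_minfty_iff; exists (Rmin M b) => s hs.
  have h1 := Rle_trans _ _ _ hs (Rmin_l _ _); have h2 := Rle_trans _ _ _ hs (Rmin_r _ _).
  by apply: (HM s (RInt h s b)) => //; apply/has_intP; apply: RInt_correct.
split=> [s _|e e0]; first by exists (RInt h s b); apply/has_intP; apply: RInt_correct.
have /at_minfty_iff [M HM] := H e e0.
exists M => s J sM _ /has_intP HJ.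
by rewrite -(is_RInt_unique _ _ _ _ HJ); apply: HM.
Qed.

Lemma has_int_neginf_ext (h k : R -> R) b I : (forall s, s < b -> h s = k s) ->
  has_int_neginf h b I -> has_int_neginf k b I.
Proof.
move=> E [H1 H2].
have X (h' k' : R -> R) s J : (forall s, s < b -> h' s = k' s) -> s <= b ->
    has_int h' s b J -> has_int k' s b J.
  move=> E' sb /has_intP HJ; apply/has_intP; apply: is_RInt_ext HJ => x.
  by rewrite Rmax_right // => hx; apply: E'; lra.
split=> [s sb|e e0].
  by have [J HJ] := H1 s sb; exists J; apply: X HJ.
have [M HM] := H2 e e0; exists M => s J sM sb HJ; apply: (HM s) => //.
by apply: X HJ => // r hr; rewrite E.
Qed.

Definition pair_ode {n m} (A : mat n) (B : mat m) (p : R -> vec n -> vec m -> vec n)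
    (q : R -> vec n -> vec m -> vec m) (U : R -> vec n) (V : R -> vec m) (t : R) : Prop :=
  lin_ode A (p t (U t) (V t)) U t /\ lin_ode B (q t (U t) (V t)) V t.

(** The last clause replaces continuity in time: along continuous curves the nonlinearity is càdlàg,
    which provides integrability and a right derivative for the primitive. *)
Definition lip_nonlin {n m k} (K : R) (p : R -> vec n -> vec m -> vec k) : Prop :=
  (forall s x y x' y', vnorm (vsub (p s x y) (p s x' y')) <= K * (vnorm (vsub x x') + vnorm (vsub y y')))
  /\ (forall s, p s (fun _ => 0) (fun _ => 0) = fun _ => 0)
  /\ (forall U V, vcont U -> vcont V -> vcadlag (fun s => p s (U s) (V s))).

Lemma lip_nonlin_le n m k K (p : R -> vec n -> vec m -> vec k) s x y :
  lip_nonlin K p -> vnorm (p s x y) <= K * (vnorm x + vnorm y).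
Proof.
by move=> [H [H0 _]]; have := H s x y (fun _ => 0) (fun _ => 0); rewrite H0 !vsub0.
Qed.

(** The abstract form of [dF] and [dG]: the nonlinearity that governs the difference to a reference
    solution [(U, V)]. *)
Definition recenter {n m k} (p : R -> vec n -> vec m -> vec k) (U : R -> vec n) (V : R -> vec m)
  (s : R) (x : vec n) (y : vec m) : vec k :=
  vsub (p s (vadd x (U s)) (vadd y (V s))) (p s (U s) (V s)).

Lemma lip_nonlin_recenter n m k K (p : R -> vec n -> vec m -> vec k) U V :
  vcont U -> vcont V -> lip_nonlin K p -> lip_nonlin K (recenter p U V).
Proof.
move=> Uc Vc [H1 [H2 H3]]; split; [|split].
- move=> s x y x' y'.
  have E d (u v w : vec d) : vsub (vsub u w) (vsub v w) = vsub u v.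
    by apply: functional_extensionality => i; rewrite /vsub; ring.
  have E' d (u v w : vec d) : vsub (vadd u w) (vadd v w) = vsub u v.
    by apply: functional_extensionality => i; rewrite /vsub /vadd; ring.
  by rewrite /recenter E; have := H1 s (vadd x (U s)) (vadd y (V s)) (vadd x' (U s)) (vadd y' (V s)); rewrite !E'.
- move=> s; have E d (u : vec d) : vadd (fun _ => 0) u = u.
    by apply: functional_extensionality => i; rewrite /vadd; ring.
  by rewrite /recenter !E vsubxx.
- move=> U' V' hU hV; apply: vcadlag_sub; last exact: H3.
  by apply: (H3 (fun s => vadd (U' s) (U s)) (fun s => vadd (V' s) (V s))); apply: vcont_add.
Qed.

(** * Backward uniqueness and global existence for pairs of Lipschitz equations *)

Section PairODE.
Context {n m : nat} (A : mat n) (B : mat m) (K : R) (K_ge0 : 0 <= K).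
Context (p : R -> vec n -> vec m -> vec n) (q : R -> vec n -> vec m -> vec m).
Context (p_lip : lip_nonlin K p) (q_lip : lip_nonlin K q).

(** The sum of the Lipschitz constants [mnorm A + K] and [mnorm B + K] of the two right-hand sides;
    the [+ 1] makes it positive. *)
Let L := mnorm A + mnorm B + 2 * K + 1.

Local Lemma L_gt0 : 0 < L.
Proof. by rewrite /L; have := mnorm_ge0 _ A; have := mnorm_ge0 _ B; lra. Qed.

Lemma pair_ode_sub U V U' V' t : pair_ode A B p q U V t -> pair_ode A B p q U' V' t ->
  lin_ode A (vsub (p t (U t) (V t)) (p t (U' t) (V' t))) (fun s => vsub (U s) (U' s)) t /\
  lin_ode B (vsub (q t (U t) (V t)) (q t (U' t) (V' t))) (fun s => vsub (V s) (V' s)) t.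
Proof. by move=> [h1 h2] [h3 h4]; split; apply: lin_ode_sub. Qed.

Local Lemma field_lip k (F : mat k) (r : R -> vec n -> vec m -> vec k) (z z' : vec k) s x y x' y' :
  lip_nonlin K r -> vnorm (vsub z z') <= vnorm (vsub x x') + vnorm (vsub y y') ->
  vnorm (vadd (mulmv F (vsub z z')) (vsub (r s x y) (r s x' y'))) <=
  (mnorm F + K) * (vnorm (vsub x x') + vnorm (vsub y y')).
Proof.
move=> [H _] hz; apply: Rle_trans (vnorm_vadd _ _ _) _.
have := vnorm_mulmv _ F (vsub z z'); have := H s x y x' y'; have := mnorm_ge0 _ F.
nra.
Qed.

(* The energy [(|u|^2 + |v|^2) e^{4Lt}] of the difference of two solutions is nondecreasing. *)
Lemma pair_ode_backward_unique U V U' V' :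
  vcont U -> vcont V -> vcont U' -> vcont V' ->
  (forall t, t < 0 -> pair_ode A B p q U V t) ->
  (forall t, t < 0 -> pair_ode A B p q U' V' t) ->
  U 0 = U' 0 -> V 0 = V' 0 -> forall t, t <= 0 -> U t = U' t /\ V t = V' t.
Proof.
move=> Uc Vc Uc' Vc' H H' U0 V0 t t0.
have L0 := L_gt0.
pose u s := vsub (U s) (U' s); pose v s := vsub (V s) (V' s).
have uc : vcont u by apply: vcont_sub.
have vc : vcont v by apply: vcont_sub.
pose du s := vadd (mulmv A (u s)) (vsub (p s (U s) (V s)) (p s (U' s) (V' s))).
pose dv s := vadd (mulmv B (v s)) (vsub (q s (U s) (V s)) (q s (U' s) (V' s))).
pose E s := (dot (u s) (u s) + dot (v s) (v s)) * exp (4 * L * s).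
pose E' s := (2 * dot (u s) (du s) + 2 * dot (v s) (dv s)) * exp (4 * L * s)
   + (dot (u s) (u s) + dot (v s) (v s)) * (4 * L * exp (4 * L * s)).
have dot_cont d (x : R -> vec d) s : vcont x -> continuous (fun s => dot (x s) (x s)) s.
  by move=> xc; apply: filterlim_rsum => i; apply: filterlim_mulR; apply: xc.
have dot_rder d (x : R -> vec d) l s : vrder x s l -> rder (fun s => dot (x s) (x s)) s (2 * dot (x s) l).
  move=> xl; rewrite /dot -rsumZ; apply: rder_rsum => i.
  have := rder_mul _ _ _ _ _ (xl i) (xl i); congr rder; ring.
have exp_der s : is_derive (fun r => exp (4 * L * r)) s (4 * L * exp (4 * L * s)).
  by auto_derive => //; ring.
have Ele : E t <= E 0.
  apply: (rder_ge0_le E E') => // s hs.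
  - apply: filterlim_mulR; first by apply: filterlim_addR; apply: dot_cont.
    by apply: (ex_derive_continuous (fun r => exp (4 * L * r))); eexists; apply: exp_der.
  - have [h1 h2] := pair_ode_sub _ _ _ _ _ (H s ltac:(lra)) (H' s ltac:(lra)).
    by apply: rder_mul; [apply: rder_add; apply: dot_rder | apply/is_derive_rder/exp_der].
  - have hu : vnorm (du s) <= L * (vnorm (u s) + vnorm (v s)).
      apply: Rle_trans (field_lip _ A p _ _ s _ _ _ _ p_lip _) _.
        by have := vnorm_ge0 _ (v s); rewrite /v; lra.
      rewrite -/(u s) -/(v s); apply: Rmult_le_compat_r.
        by have := vnorm_ge0 _ (u s); have := vnorm_ge0 _ (v s); lra.
      by rewrite /L; have := mnorm_ge0 _ B; lra.
    have hv : vnorm (dv s) <= L * (vnorm (u s) + vnorm (v s)).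
      apply: Rle_trans (field_lip _ B q _ _ s _ _ _ _ q_lip _) _.
        by have := vnorm_ge0 _ (u s); rewrite /u; lra.
      rewrite -/(u s) -/(v s); apply: Rmult_le_compat_r.
        by have := vnorm_ge0 _ (u s); have := vnorm_ge0 _ (v s); lra.
      by rewrite /L; have := mnorm_ge0 _ A; lra.
    have c1 := cauchy_schwarz _ (vscale (-1) (u s)) (du s).
    have c2 := cauchy_schwarz _ (vscale (-1) (v s)) (dv s).
    have dotN d (x y : vec d) : dot (vscale (-1) x) y = - dot x y.
      transitivity (-1 * dot x y); last ring.
      by rewrite /dot -rsumZ; apply: eq_bigr => i _; rewrite /vscale; ring.
    rewrite !dotN !vnorm_vscale Rabs_Ropp Rabs_R1 !Rmult_1_l in c1 c2.
    have -> : E' s = (2 * dot (u s) (du s) + 2 * dot (v s) (dv s)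
      + 4 * L * (dot (u s) (u s) + dot (v s) (v s))) * exp (4 * L * s) by rewrite /E'; ring.
    apply: Rmult_le_pos; last exact/Rlt_le/exp_pos.
    rewrite -!vnorm_sq.
    move: (vnorm_ge0 _ (u s)) (vnorm_ge0 _ (v s)) c1 c2 hu hv.
    set x := vnorm (u s); set y := vnorm (v s) => x0 y0 c1 c2 hu hv.
    have c3 : x * vnorm (du s) <= x * (L * (x + y)) by apply: Rmult_le_compat_l.
    have c4 : y * vnorm (dv s) <= y * (L * (x + y)) by apply: Rmult_le_compat_l.
    (* This is [(x + y)^2 <= 2 (x^2 + y^2)] in disguise, the reason for the exponent [4 L]: without
       it the energy has derivative at least [- 2 L (x + y)^2]. *)
    have c5 : 0 <= L * ((x - y) * (x - y)) by apply: Rmult_le_pos; [exact: Rlt_le | exact: Rle_0_sqr].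
    nra.
have E0 : E 0 = 0.
  by rewrite /E /u /v U0 V0 !vsubxx -!vnorm_sq !vnorm0; ring.
rewrite E0 in Ele.
have : dot (u t) (u t) + dot (v t) (v t) <= 0.
  by apply: (Rmult_le_reg_r (exp (4 * L * t))); [apply: exp_pos | rewrite Rmult_0_l].
have := vnorm_sq _ (u t); have := vnorm_sq _ (v t).
have := vnorm_ge0 _ (u t); have := vnorm_ge0 _ (v t) => hv hu sv su sm.
by split; apply: vsub_eq0; [change (vnorm (u t) <= 0) | change (vnorm (v t) <= 0)]; nra.
Qed.

(** Integration of [e^{2L|s|}] away from 0 gains the factor [1 / (2L)], which later yields the
    contraction constant. The two half-lines are separate because the mean value inequality wants a
    differentiable majorant. *)
Local Lemma exp_abs_mean_value k (W w : R -> vec k) C :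
  0 <= C -> vcont W -> (forall s, vrder W s (w s)) -> W 0 = (fun _ => 0) ->
  (forall s, vnorm (w s) <= C * exp (2 * L * Rabs s)) ->
  forall t, vnorm (W t) <= C / (2 * L) * exp (2 * L * Rabs t).
Proof.
move=> C0 Wc Wd W0 H t; have L0 := L_gt0.
have CL : 0 <= C / (2 * L) by apply: Rmult_le_pos => //; apply/Rlt_le/Rinv_0_lt_compat; lra.
case: (Rle_lt_dec 0 t) => ht.
  have := vec_mean_value k W w (fun s => C / (2 * L) * exp (2 * L * s))
    (fun s => C / (2 * L) * (2 * L) * exp (2 * L * s)) 0 t ht Wc (fun s _ => Wd s)
    (fun s => is_derive_scal_exp _ _ s).
  rewrite W0 vsub0 Rmult_0_r exp_0 (Rabs_right t); last lra.
  move=> h; apply: Rle_trans (h _) _; last lra.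
  move=> s hs; have := H s; rewrite Rabs_right; last lra.
  by have -> : C / (2 * L) * (2 * L) = C by field; lra.
have := vec_mean_value k W w (fun s => - (C / (2 * L)) * exp (- (2 * L) * s))
  (fun s => - (C / (2 * L)) * (- (2 * L)) * exp (- (2 * L) * s)) t 0 (Rlt_le _ _ ht) Wc (fun s _ => Wd s)
  (fun s => is_derive_scal_exp _ _ s).
rewrite vnorm_vsubC W0 vsub0 Rmult_0_r exp_0 (Rabs_left t) //.
have -> : - (2 * L) * t = 2 * L * - t by ring.
move=> h; apply: Rle_trans (h _) _; last lra.
move=> s hs; have := H s; rewrite Rabs_left; last lra.
have -> : 2 * L * - s = - (2 * L) * s by ring.
by have -> : - (C / (2 * L)) * - (2 * L) = C by field; lra.
Qed.

(** In the weight [e^{2L|t|}] the Picard operator contracts by [1/2] on the whole line at once, so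
    no continuation of local solutions is needed. *)
Lemma pair_ode_exists x0 y0 : exists U V, vcont U /\ vcont V /\ U 0 = x0 /\ V 0 = y0 /\
  forall t, pair_ode A B p q U V t.
Proof.
have L0 := L_gt0.
pose wt t := exp (2 * L * Rabs t).
pose P U V s := vadd (mulmv A (U s)) (p s (U s) (V s)).
pose Q U V s := vadd (mulmv B (V s)) (q s (U s) (V s)).
pose T k (x : vec k) (h : R -> vec k) t : vec k := vadd x (fun i => RInt (fun s => h s i) 0 t).
have mul_cadlag k (F : mat k) U : vcont U -> vcadlag (fun s => mulmv F (U s)).
  move=> Uc i; apply: cadlag_rsum => j; apply: cadlag_mul; first exact: cadlag_const.
  by apply: cadlag_continuous; apply: Uc.
have PQc U V : vcont U -> vcont V -> vcadlag (P U V) /\ vcadlag (Q U V).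
  move=> Uc Vc; split=> i; apply: cadlag_add; try exact: mul_cadlag.
    by case: p_lip => [_ [_ h]]; apply: h.
  by case: q_lip => [_ [_ h]]; apply: h.
have Tc k x h : vcadlag h -> vcont (T k x h).
  move=> hc i t; apply: filterlim_addR; first exact: filterlim_const.
  by apply: RInt_primitive_continuous => a b; apply: cadlag_ex_RInt.
have Td k x h t : vcadlag h -> vrder (T k x h) t (h t).
  move=> hc i; rewrite -[X in rder _ _ X]Rplus_0_l; apply: rder_add; first exact: rder_const.
  exact: (RInt_primitive_rder (fun s => h s i)).
have T0 k x h : T k x h 0 = x.
  by apply: functional_extensionality => i; rewrite /T /vadd RInt_point /zero /=; ring.
have wt0 t : 0 < wt t by apply: exp_pos.
have wt1 t : 1 <= wt t.
  rewrite /wt -exp_0; case: (Req_dec t 0) => [->|tn]; first by rewrite Rabs_R0 Rmult_0_r; lra.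
  by apply/Rlt_le/exp_increasing; have := Rabs_pos_lt t tn; nra.
have contr U V U' V' C : vcont U -> vcont V -> vcont U' -> vcont V' ->
    wdist_le n m wt C U V U' V' ->
    wdist_le n m wt (1 / 2 * C) (T n x0 (P U V)) (T m y0 (Q U V)) (T n x0 (P U' V')) (T m y0 (Q U' V')).
  move=> Uc Vc Uc' Vc' H t.
  have [[p1 q1] [p2 q2]] := (PQc _ _ Uc Vc, PQc _ _ Uc' Vc').
  have C0 : 0 <= C.
    have := H 0; have := vnorm_ge0 _ (vsub (U 0) (U' 0)); have := vnorm_ge0 _ (vsub (V 0) (V' 0)).
    by have := wt0 0; nra.
  have vD d (a b c e : vec d) : vsub (vadd a b) (vadd c e) = vadd (vsub a c) (vsub b e).
    by apply: functional_extensionality => i; rewrite /vsub /vadd; ring.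
  have mA := mnorm_ge0 _ A; have mB := mnorm_ge0 _ B.
  have e1 : vnorm (vsub (T n x0 (P U V) t) (T n x0 (P U' V') t)) <= (mnorm A + K) * C / (2 * L) * wt t.
    apply: (exp_abs_mean_value _ (fun s => vsub (T n x0 (P U V) s) (T n x0 (P U' V') s))
      (fun s => vsub (P U V s) (P U' V' s))).
    - by apply: Rmult_le_pos; lra.
    - by apply: vcont_sub; apply: Tc.
    - by move=> s i; apply: rder_sub; apply: Td.
    - by rewrite !T0 vsubxx.
    - move=> s; rewrite /P vD -mulmv_vsub Rmult_assoc.
      apply: Rle_trans (field_lip _ A p _ _ s _ _ _ _ p_lip _) _.
        by have := vnorm_ge0 _ (vsub (V s) (V' s)); lra.
      by apply: Rmult_le_compat_l; [lra | apply: H].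
  have e2 : vnorm (vsub (T m y0 (Q U V) t) (T m y0 (Q U' V') t)) <= (mnorm B + K) * C / (2 * L) * wt t.
    apply: (exp_abs_mean_value _ (fun s => vsub (T m y0 (Q U V) s) (T m y0 (Q U' V') s))
      (fun s => vsub (Q U V s) (Q U' V' s))).
    - by apply: Rmult_le_pos; lra.
    - by apply: vcont_sub; apply: Tc.
    - by move=> s i; apply: rder_sub; apply: Td.
    - by rewrite !T0 vsubxx.
    - move=> s; rewrite /Q vD -mulmv_vsub Rmult_assoc.
      apply: Rle_trans (field_lip _ B q _ _ s _ _ _ _ q_lip _) _.
        by have := vnorm_ge0 _ (vsub (U s) (U' s)); lra.
      by apply: Rmult_le_compat_l; [lra | apply: H].
  have -> : 1 / 2 * C * wt t = (mnorm A + K + (mnorm B + K) + 1) * C / (2 * L) * wt t.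
    by rewrite /L; field; rewrite -/L; have := L0; rewrite /L; lra.
  have : 0 <= C / (2 * L) * wt t.
    apply: Rmult_le_pos; last exact: Rlt_le.
    by apply: Rmult_le_pos => //; apply/Rlt_le/Rinv_0_lt_compat; lra.
  by rewrite /Rdiv in e1 e2 *; nra.
have [|||U [V [[Uc [Vc _]] H]]] := contraction_fixpoint n m wt wt0 _
    (fun U V => T n x0 (P U V)) (fun U V => T m y0 (Q U V)) (1 / 2) ltac:(lra).
- move=> t.
  by apply: (filterlim_compR (fun t => 2 * L * Rabs t) exp);
    [apply: filterlim_mulR; [apply: filterlim_const | apply: continuous_Rabs] | apply: continuous_exp].
- move=> U V [Uc [Vc [M HM]]]; have [p1 q1] := PQc _ _ Uc Vc.
  split; [exact: Tc | split; first exact: Tc].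
  have z k : vcont (fun _ : R => (fun _ : 'I_k => 0)) by move=> i t; apply: continuous_const.
  have P0 : P (fun _ _ => 0) (fun _ _ => 0) = fun _ _ => 0.
    apply: functional_extensionality => s; rewrite /P; case: p_lip => [_ [-> _]].
    by apply: functional_extensionality => i; rewrite /vadd /mulmv rsum_eq0 => [|j]; ring.
  have Q0 : Q (fun _ _ => 0) (fun _ _ => 0) = fun _ _ => 0.
    apply: functional_extensionality => s; rewrite /Q; case: q_lip => [_ [-> _]].
    by apply: functional_extensionality => i; rewrite /vadd /mulmv rsum_eq0 => [|j]; ring.
  have T00 k (x : vec k) t : T k x (fun _ _ => 0) t = x.
    by apply: functional_extensionality => i; rewrite /T /vadd RInt_const /scal /= /mult /=; ring.
  (* Boundedness of the image comes from the contraction estimate against the zero pair, whose image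
     is the constant pair [(x0, y0)]. *)
  have h : wdist_le n m wt M U V (fun _ _ => 0) (fun _ _ => 0).
    by move=> t; rewrite !vsub0; apply: HM.
  have {}h := contr _ _ _ _ _ Uc Vc (z n) (z m) h.
  exists (1 / 2 * M + (vnorm x0 + vnorm y0)) => t.
  have := h t; rewrite P0 Q0 !T00.
  have := vnorm_vsub_triangle _ (T n x0 (P U V) t) x0 (fun _ => 0); rewrite !vsub0.
  have := vnorm_vsub_triangle _ (T m y0 (Q U V) t) y0 (fun _ => 0); rewrite !vsub0.
  have := vnorm_ge0 _ x0; have := vnorm_ge0 _ y0; have := wt1 t; nra.
- by move=> U V U' V' C [Uc [Vc _]] [Uc' [Vc' _]]; apply: contr.
have HU : T n x0 (P U V) = U by apply: functional_extensionality => t; case: (H t).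
have HV : T m y0 (Q U V) = V by apply: functional_extensionality => t; case: (H t).
have [p1 q1] := PQc _ _ Uc Vc.
exists U, V; split=> //; split=> //; split; first by rewrite -HU T0.
split; first by rewrite -HV T0.
move=> t; split.
  by rewrite /lin_ode -[X in vrder X]HU; apply: Td.
by rewrite /lin_ode -[X in vrder X]HV; apply: Td.
Qed.

End PairODE.

(** * Bounded backward solutions *)

Lemma continuous_Rmin0 t : continuous (fun s => Rmin s 0) t.
Proof.
apply/continuous_RP => e e0; exists e; split=> // s /Rabs_lt_between hs.
by apply/Rabs_lt_between; rewrite /Rmin; do 2!case: Rle_dec => ? /=; lra.
Qed.

Lemma filterlim_vnorm0 {T} (F : (T -> Prop) -> Prop) {FF : Filter F} n (x : T -> vec n) :
  (forall i, filterlim (fun s => x s i) F (locally 0)) ->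
  forall e, 0 < e -> F (fun s => vnorm (x s) < e).
Proof.
move=> H e e0.
have : filterlim (fun s => \rsum_(i < n) Rabs (x s i)) F (locally (\rsum_(i < n) Rabs 0)).
  by apply: filterlim_rsum => i; apply: filterlim_compR (H i) _; apply: continuous_Rabs.
rewrite rsum_eq0 => [/filterlim_RP /(_ e e0)|i]; last exact: Rabs_R0.
apply: filter_imp => s; rewrite Rminus_0_r => h.
apply: Rle_lt_trans (vnorm_le_rsum _ _) _; exact: Rle_lt_trans (Rle_abs _) h.
Qed.

(** For [t < 0] the right derivative can be computed from values on [[t, 0)], where the two
    functions agree. *)
Lemma lin_ode_ext n (A : mat n) h (U V : R -> vec n) t :
  t < 0 -> (forall s, s <= 0 -> U s = V s) -> lin_ode A h U t -> lin_ode A h V t.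
Proof.
move=> t0 E H i; have := H i; rewrite -E; last lra.
by apply: (rder_ext _ _ _ _ (- t)) => [|s hs]; [lra | rewrite E //; lra].
Qed.

Section StableForcing.
Context {n : nat} (B : mat n) (b eta C : R) (h : R -> vec n) (b_eta : b < eta).
Context (HB : forall t (x : vec n), t >= 0 -> vnorm (mulmv (mexp B t) x) <= exp (b * t) * vnorm x).
Context (hc : vcadlag h) (h_le : forall s, s < 0 -> vnorm (h s) <= C * exp (eta * s)).

Let ker s : vec n := mulmv (mexp B (- s)) (h s).

(** The integrand is at most [C e^{(eta-b)s}], so the integral over [[s, t]] is at most a multiple
    of [e^{(eta-b)t}] and the Cauchy criterion holds at minus infinity. *)
Lemma stable_improper_cv : exists c : vec n, forall i,
  filterlim (fun s => RInt (fun r => ker r i) s 0) (Rbar_locally m_infty) (locally (c i)).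
Proof.
have kc : vcadlag ker by apply: duhamel_kernel_cadlag.
pose W s : vec n := fun i => RInt (fun r => ker r i) 0 s.
have Wc : vcont W.
  by move=> i t; apply: RInt_primitive_continuous => x y; apply: cadlag_ex_RInt.
have C0 : 0 <= C.
  have := h_le (-1) ltac:(lra); have := vnorm_ge0 _ (h (-1)); have := exp_pos (eta * -1); nra.
have est s t : s <= t -> t <= 0 -> vnorm (vsub (W t) (W s)) <= C / (eta - b) * exp ((eta - b) * t).
  move=> st t0.
  have K0 : 0 <= C / (eta - b) by apply: Rmult_le_pos => //; apply/Rlt_le/Rinv_0_lt_compat; lra.
  have := vec_mean_value n W ker (fun r => C / (eta - b) * exp ((eta - b) * r))
    (fun r => C / (eta - b) * (eta - b) * exp ((eta - b) * r)) s t st Wc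
    (fun r _ i => RInt_primitive_rder (fun r => ker r i) 0 r (kc i)) (fun r => is_derive_scal_exp _ _ r).
  have := exp_pos ((eta - b) * s) => E0 H.
  apply: Rle_trans (H _) _; last by nra.
  move=> r hr; apply: Rle_trans (HB _ _ _) _; first lra.
  have -> : C / (eta - b) * (eta - b) = C by field; lra.
  have -> : C * exp ((eta - b) * r) = exp (b * - r) * (C * exp (eta * r)).
    have -> : exp ((eta - b) * r) = exp (b * - r) * exp (eta * r).
      by rewrite -exp_plus; congr exp; ring.
    by ring.
  by apply: Rmult_le_compat_l; [apply/Rlt_le/exp_pos | apply: h_le; lra].
have H i : exists l : R, filterlim (fun s => RInt (fun r => ker r i) s 0) (Rbar_locally m_infty) (locally l).
  apply/filterlim_locally_cauchy => e.
  have e0 := cond_pos e.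
  have [T HT] := exp_small (eta - b) (e / (C / (eta - b) + 1)) ltac:(lra) ltac:(
    by apply: Rdiv_lt_0_compat => //;
       have : 0 <= C / (eta - b) by [apply: Rmult_le_pos => //; apply/Rlt_le/Rinv_0_lt_compat; lra]; lra).
  have K0 : 0 <= C / (eta - b) by apply: Rmult_le_pos => //; apply/Rlt_le/Rinv_0_lt_compat; lra.
  exists (fun s => s <= Rmin T 0); split; first by apply/at_minfty_iff; exists (Rmin T 0).
  have close s t : s <= t -> t <= Rmin T 0 ->
      Rabs (RInt (fun r => ker r i) t 0 - RInt (fun r => ker r i) s 0) < e.
    move=> st tT; have t1 := Rle_trans _ _ _ tT (Rmin_l _ _); have t2 := Rle_trans _ _ _ tT (Rmin_r _ _).
    have X x : RInt (fun r => ker r i) x 0 = - W x i.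
      rewrite -(opp_RInt_swap (fun r => ker r i) 0 x) //; exact: cadlag_ex_RInt.
    rewrite !X; have -> : - W t i - - W s i = - (W t i - W s i) by ring.
    rewrite Rabs_Ropp; apply: Rle_lt_trans (coord_le_vnorm _ (vsub (W t) (W s)) i) _.
    apply: Rle_lt_trans (est s t st t2) _.
    have := HT t t1; have E0 := exp_pos ((eta - b) * t) => hlt.
    apply: (Rle_lt_trans _ ((C / (eta - b) + 1) * exp ((eta - b) * t))); first by nra.
    have -> : pos e = (C / (eta - b) + 1) * (e / (C / (eta - b) + 1)) by field; split; lra.
    by apply: Rmult_lt_compat_l => //; lra.
  move=> u v hu hv; rewrite /ball /= /AbsRing_ball /abs /minus /plus /opp /=.
  case: (Rle_lt_dec u v) => uv; first exact: close.
  by rewrite -Rabs_Ropp Ropp_plus_distr Ropp_involutive Rplus_comm; apply: close => //; lra.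
exists (fun i => proj1_sig (constructive_indefinite_description _ (H i))) => i.
by case: constructive_indefinite_description.
Qed.

(** The vector equals [e^{Bt}] applied to [c] minus the integral over [[s, 0]], and [c] is the limit
    of these integrals. This supplies the past condition of [stable_bound] before the function is
    known to be bounded. *)
Lemma duhamel_past (c : vec n) (t : R) :
  (forall i, filterlim (fun s => RInt (fun r => ker r i) s 0) (Rbar_locally m_infty) (locally (c i))) ->
  forall e, 0 < e -> exists s, s <= t /\ vnorm (mulmv (mexp B (t - s)) (duhamel B c h s)) <= e.
Proof.
move=> Hc e e0.
have kc : vcadlag ker by apply: duhamel_kernel_cadlag.
pose x s : vec n := mulmv (mexp B t) (vadd c (fun i => RInt (fun r => ker r i) 0 s)).
have x0 i : filterlim (fun s => x s i) (Rbar_locally m_infty) (locally 0).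
  have -> : 0 = \rsum_(j < n) (mexp B t i j * (c j - c j)) by rewrite rsum_eq0 // => j; ring.
  apply: filterlim_rsum => j; apply: filterlim_mulR; first exact: filterlim_const.
  apply: (filterlim_ext (fun s => c j - RInt (fun r => ker r j) s 0)).
    move=> s; rewrite /vadd -(opp_RInt_swap (fun r => ker r j) 0 s) /opp /=; first ring.
    exact: cadlag_ex_RInt.
  by apply: filterlim_subR; [apply: filterlim_const | apply: Hc].
pose proof (filterlim_vnorm0 _ _ x x0 e e0) as Hx; move/at_minfty_iff: Hx => [M HM].
exists (Rmin t M); split; first exact: Rmin_l.
rewrite /duhamel mexp_add; have -> : t - Rmin t M + Rmin t M = t by ring.
by apply/Rlt_le/HM; apply: Rmin_r.
Qed.

End StableForcing.

Section BoundedSolutions.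
Context {n m : nat} (A : mat n) (B : mat m) (a b K eta : R).
Context (HA : forall t (x : vec n), t <= 0 -> vnorm (mulmv (mexp A t) x) <= exp (a * t) * vnorm x).
Context (HB : forall t (y : vec m), t >= 0 -> vnorm (mulmv (mexp B t) y) <= exp (b * t) * vnorm y).
Context (b_eta : b < eta) (eta_a : eta < a) (K_ge0 : 0 <= K).
Context (gap : K * (1 / (eta - b) + 1 / (a - eta)) < 1).
Context (p : R -> vec n -> vec m -> vec n) (q : R -> vec n -> vec m -> vec m).
Context (p_lip : lip_nonlin K p) (q_lip : lip_nonlin K q).

Let rho := K * (1 / (eta - b) + 1 / (a - eta)).

Definition weighted_bounded (U : R -> vec n) (V : R -> vec m) : Prop :=
  exists M, forall t, t <= 0 -> vnorm (U t) + vnorm (V t) <= M * exp (eta * t).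

(** The common ground of the integral system and the fiber condition. Only the unstable component
    has a prescribed value at 0; boundedness determines the stable one. *)
Definition bounded_sol (xi : vec n) (U : R -> vec n) (V : R -> vec m) : Prop :=
  vcont U /\ vcont V /\ weighted_bounded U V /\ U 0 = xi /\
  forall t, t < 0 -> pair_ode A B p q U V t.

Lemma weighted_bounded_r U V : weighted_bounded U V ->
  exists M, forall t, t <= 0 -> vnorm (V t) <= M * exp (eta * t).
Proof.
move=> [M HM]; exists M => t t0; have := HM t t0; have := vnorm_ge0 _ (U t); lra.
Qed.

Lemma weighted_bounded_sub U V U' V' : weighted_bounded U V -> weighted_bounded U' V' ->
  weighted_bounded (fun t => vsub (U t) (U' t)) (fun t => vsub (V t) (V' t)).
Proof.
move=> [M HM] [M' HM']; exists (M + M') => t t0.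
have := HM t t0; have := HM' t t0.
have := vnorm_vsub_le _ (U t) (U' t); have := vnorm_vsub_le _ (V t) (V' t); lra.
Qed.

Local Lemma rho01 : 0 <= rho < 1.
Proof.
split=> //; apply: Rmult_le_pos => //.
have : 0 < 1 / (eta - b) by apply: Rdiv_lt_0_compat; lra.
have : 0 < 1 / (a - eta) by apply: Rdiv_lt_0_compat; lra.
lra.
Qed.

Lemma bounded_past_exists (D : R -> vec m) :
  (exists M, forall t, t <= 0 -> vnorm (D t) <= M * exp (eta * t)) ->
  forall t, t <= 0 -> forall e, 0 < e ->
  exists s, s <= t /\ vnorm (mulmv (mexp B (t - s)) (D s)) <= e.
Proof.
move=> [M HM] t t0 e e0.
have [T [Tt HT]] := bounded_past _ B b eta M D b_eta HB HM t e t0 e0.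
by exists T; split=> //; apply/Rlt_le/HT; lra.
Qed.

Local Lemma forcing_le k (r : R -> vec n -> vec m -> vec k) U V U' V' C : lip_nonlin K r ->
  (forall t, t <= 0 -> vnorm (vsub (U t) (U' t)) + vnorm (vsub (V t) (V' t)) <= C * exp (eta * t)) ->
  forall s, s < 0 -> vnorm (vsub (r s (U s) (V s)) (r s (U' s) (V' s))) <= K * C * exp (eta * s).
Proof.
move=> [H _] HC s s0; apply: Rle_trans (H _ _ _ _ _) _.
by rewrite Rmult_assoc; apply: Rmult_le_compat_l => //; apply: HC; lra.
Qed.

Section TwoSolutions.
Context (xi xi' : vec n) (U U' : R -> vec n) (V V' : R -> vec m).
Context (S : bounded_sol xi U V) (S' : bounded_sol xi' U' V').

(** If the summed difference is at most [C e^{eta t}], the dichotomy improves [C] to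
    [|xi - xi'| + rho C]; since the difference is bounded in the weight beforehand, [self_bound]
    gives [|xi - xi'| / (1 - rho)]. One more use of the stable estimate with this [C] gives the
    second inequality, the source of the Lipschitz constant of [l]. *)
Lemma bounded_sol_diff : forall t, t <= 0 ->
  vnorm (vsub (U t) (U' t)) + vnorm (vsub (V t) (V' t)) <=
  vnorm (vsub xi xi') / (1 - rho) * exp (eta * t) /\
  vnorm (vsub (V t) (V' t)) <=
  K * (vnorm (vsub xi xi') / (1 - rho)) / (eta - b) * exp (eta * t).
Proof.
have [Uc [Vc [W [U0 H]]]] := S; have [Uc' [Vc' [W' [U0' H']]]] := S'.
have WD := weighted_bounded_sub _ _ _ _ W W'.
have od t (t0 : t < 0) := pair_ode_sub A B p q _ _ _ _ t (H t t0) (H' t t0).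
have estV C : (forall t, t <= 0 ->
    vnorm (vsub (U t) (U' t)) + vnorm (vsub (V t) (V' t)) <= C * exp (eta * t)) ->
    forall t, t <= 0 -> vnorm (vsub (V t) (V' t)) <= K * C / (eta - b) * exp (eta * t).
  move=> HC t t0.
  refine (stable_bound B eta (K * C) (fun t => vsub (V t) (V' t))
     (fun t => vsub (q t (U t) (V t)) (q t (U' t) (V' t))) _ _ _ b b_eta HB t t0 _).
  - exact: vcont_sub.
  - by move=> s s0; case: (od s s0).
  - exact: forcing_le.
  - by apply: (bounded_past_exists (fun t => vsub (V t) (V' t))) => //; apply: weighted_bounded_r WD.
have estU C : (forall t, t <= 0 ->
    vnorm (vsub (U t) (U' t)) + vnorm (vsub (V t) (V' t)) <= C * exp (eta * t)) ->
    forall t, t <= 0 -> vnorm (vsub (U t) (U' t)) <=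
      (vnorm (vsub xi xi') + K * C / (a - eta)) * exp (eta * t).
  move=> HC t t0; rewrite -U0 -U0'.
  refine (unstable_bound A eta (K * C) (fun t => vsub (U t) (U' t))
     (fun t => vsub (p t (U t) (V t)) (p t (U' t) (V' t))) _ _ _ a eta_a HA t t0).
  - exact: vcont_sub.
  - by move=> s s0; case: (od s s0).
  - exact: forcing_le.
have expK t : exp (eta * t) * exp (- (eta * t)) = 1 by rewrite -exp_plus Rplus_opp_r exp_0.
have normalize C t x : x <= C * exp (eta * t) <-> x * exp (- (eta * t)) <= C.
  have := expK t; have := exp_pos (eta * t); have := exp_pos (- (eta * t)).
  move: (exp (eta * t)) (exp (- (eta * t))) => u v v0 u0 uv; split=> h.
    have -> : C = C * u * v by rewrite Rmult_assoc uv; ring.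
    by apply: Rmult_le_compat_r; lra.
  have -> : x = x * v * u by rewrite Rmult_assoc (Rmult_comm v) uv; ring.
  by apply: Rmult_le_compat_r; lra.
have all : forall t, t <= 0 ->
    (vnorm (vsub (U t) (U' t)) + vnorm (vsub (V t) (V' t))) * exp (- (eta * t)) <=
    vnorm (vsub xi xi') / (1 - rho).
  apply: (self_bound (fun t => t <= 0)); first by case: rho01.
    by have [M HM] := WD; exists M => t t0; apply/normalize/HM.
  move=> C HC t t0; apply/normalize.
  have HC' s : s <= 0 -> vnorm (vsub (U s) (U' s)) + vnorm (vsub (V s) (V' s)) <= C * exp (eta * s).
    by move=> s0; apply/normalize/HC.
  have := estU C HC' t t0; have := estV C HC' t t0.
  have -> : (vnorm (vsub xi xi') + rho * C) * exp (eta * t) =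
    (vnorm (vsub xi xi') + K * C / (a - eta)) * exp (eta * t) + K * C / (eta - b) * exp (eta * t).
    by rewrite /rho; field; lra.
  lra.
move=> t t0; split; first exact/normalize/all.
by apply: estV => // s s0; apply/normalize/all.
Qed.

End TwoSolutions.

(** Times are replaced by [min(t, 0)], so that a fixed point on the whole line encodes a solution on
    [t <= 0]. The operator uses [duhamel] with initial value [xi] in the unstable component and the
    improper integral of the forcing in the stable one. *)
Lemma bounded_sol_exists xi : exists U V, bounded_sol xi U V.
Proof.
have [r0 r1] := rho01.
pose mz t := Rmin t 0.
have mz0 t : mz t <= 0 by apply: Rmin_r.
have mzE t : t <= 0 -> mz t = t by move=> t0; apply: Rmin_left.
pose wt t := exp (eta * mz t).
have wt0 t : 0 < wt t by apply: exp_pos.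
pose P U V s : vec n := p s (U s) (V s).
pose Q U V s : vec m := q s (U s) (V s).
have PQc U V : vcont U -> vcont V -> vcadlag (P U V) /\ vcadlag (Q U V).
  by move=> Uc Vc; split; [case: p_lip => [_ [_ h]] | case: q_lip => [_ [_ h]]]; apply: h.
pose cv (h : R -> vec m) (c : vec m) := forall i, filterlim
  (fun s => RInt (fun r => mulmv (mexp B (- r)) (h r) i) s 0) (Rbar_locally m_infty) (locally (c i)).
(* The operator must be total, while the improper integral is known to converge only along
   admissible pairs; hence a choice of limit, justified by [QM]. *)
pose lim h : vec m := epsilon (inhabits (fun _ => 0)) (cv h).
have QM U V : wadm n m wt U V -> cv (Q U V) (lim (Q U V)).
  move=> [Uc [Vc [M HM]]]; apply: epsilon_spec.
  apply: (stable_improper_cv B b eta (K * M) (Q U V)) => //; first by case: (PQc _ _ Uc Vc).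
  move=> s s0; apply: Rle_trans (lip_nonlin_le _ _ _ _ _ _ _ _ q_lip) _.
  rewrite Rmult_assoc; apply: Rmult_le_compat_l => //.
  by have := HM s; rewrite /wt mzE //; lra.
pose T1 U V t := duhamel A xi (P U V) (mz t).
pose T2 U V t := duhamel B (lim (Q U V)) (Q U V) (mz t).
have Tc U V : vcont U -> vcont V -> vcont (T1 U V) /\ vcont (T2 U V).
  by move=> Uc Vc; have [p1 q1] := PQc _ _ Uc Vc; split; apply: vcont_comp continuous_Rmin0; apply: duhamel_vcont.
have PM k (r : R -> vec n -> vec m -> vec k) U V M : lip_nonlin K r ->
    (forall t, vnorm (U t) + vnorm (V t) <= M * wt t) ->
    forall s, s < 0 -> vnorm (r s (U s) (V s)) <= K * M * exp (eta * s).
  move=> r_lip HM s s0; apply: Rle_trans (lip_nonlin_le _ _ _ _ _ _ _ _ r_lip) _.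
  rewrite Rmult_assoc; apply: Rmult_le_compat_l => //.
  by have := HM s; rewrite /wt mzE //; lra.
have past U V t : wadm n m wt U V -> t <= 0 -> forall e, 0 < e -> exists s, s <= t /\
    vnorm (mulmv (mexp B (t - s)) (duhamel B (lim (Q U V)) (Q U V) s)) <= e.
  move=> ad t0; have [Uc [Vc _]] := ad; apply: duhamel_past; last exact: QM.
  by case: (PQc _ _ Uc Vc).
have T2_bound U V M : wadm n m wt U V -> (forall t, vnorm (U t) + vnorm (V t) <= M * wt t) ->
    forall t, t <= 0 -> vnorm (duhamel B (lim (Q U V)) (Q U V) t) <= K * M / (eta - b) * exp (eta * t).
  move=> ad HM t t0; have [Uc [Vc _]] := ad; have [_ q1] := PQc _ _ Uc Vc.
  refine (stable_bound B eta (K * M) _ (Q U V) _ _ _ b b_eta HB t t0 _).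
  - exact: duhamel_vcont.
  - by move=> s _; apply: duhamel_ode.
  - exact: PM.
  - exact: past.
have [|||U [V [[Uc [Vc [M HM]]] H]]] := contraction_fixpoint n m wt wt0 _ T1 T2 rho rho01.
- move=> t; apply: (filterlim_compR (fun t => eta * mz t) exp); last exact: continuous_exp.
  by apply: filterlim_mulR; [apply: filterlim_const | apply: continuous_Rmin0].
- move=> U V ad; have [Uc [Vc [M HM]]] := ad; have [p1 q1] := PQc _ _ Uc Vc.
  have [c1 c2] := Tc _ _ Uc Vc.
  split=> //; split=> //.
  exists (vnorm xi + K * M / (a - eta) + K * M / (eta - b)) => t.
  have e1 : vnorm (T1 U V t) <= (vnorm xi + K * M / (a - eta)) * wt t.
    rewrite -{1}(duhamel0 A xi (P U V)).
    refine (unstable_bound A eta (K * M) (duhamel A xi (P U V)) (P U V) _ _ _ a eta_a HA (mz t) (mz0 t)).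
    + exact: duhamel_vcont.
    + by move=> s _; apply: duhamel_ode.
    + exact: PM.
  have := T2_bound U V M ad HM (mz t) (mz0 t); rewrite -/(T2 U V t) -/(wt t); lra.
- move=> U V U' V' C ad ad' HC t.
  have [Uc [Vc [M HM]]] := ad; have [p1 q1] := PQc _ _ Uc Vc.
  have [Uc' [Vc' [M' HM']]] := ad'; have [p2 q2] := PQc _ _ Uc' Vc'.
  have HC' s : s <= 0 -> vnorm (vsub (U s) (U' s)) + vnorm (vsub (V s) (V' s)) <= C * exp (eta * s).
    by move=> s0; have := HC s; rewrite /wt mzE.
  have e1 : vnorm (vsub (T1 U V t) (T1 U' V' t)) <= (0 + K * C / (a - eta)) * wt t.
    have <- : vnorm (vsub (duhamel A xi (P U V) 0) (duhamel A xi (P U' V') 0)) = 0.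
      by rewrite !duhamel0 vsubxx vnorm0.
    refine (unstable_bound A eta (K * C) (fun s => vsub (duhamel A xi (P U V) s) (duhamel A xi (P U' V') s))
      (fun s => vsub (P U V s) (P U' V' s)) _ _ _ a eta_a HA (mz t) (mz0 t)).
    + by apply: vcont_sub; apply: duhamel_vcont.
    + by move=> s _; apply: lin_ode_sub; apply: duhamel_ode.
    + exact: forcing_le.
  have e2 : vnorm (vsub (T2 U V t) (T2 U' V' t)) <= K * C / (eta - b) * wt t.
    refine (stable_bound B eta (K * C)
      (fun s => vsub (duhamel B (lim (Q U V)) (Q U V) s) (duhamel B (lim (Q U' V')) (Q U' V') s))
      (fun s => vsub (Q U V s) (Q U' V' s)) _ _ _ b b_eta HB (mz t) (mz0 t) _).
    + by apply: vcont_sub; apply: duhamel_vcont.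
    + by move=> s _; apply: lin_ode_sub; apply: duhamel_ode.
    + exact: forcing_le.
    (* Each image is already bounded in the weight by [T2_bound], so the past of their difference
       vanishes. *)
    + move=> e e0; apply: (bounded_past_exists (fun s => vsub (duhamel B (lim (Q U V)) (Q U V) s)
        (duhamel B (lim (Q U' V')) (Q U' V') s))) => //.
      exists (K * M / (eta - b) + K * M' / (eta - b)) => s s0.
      have := T2_bound U V M ad HM s s0; have := T2_bound U' V' M' ad' HM' s s0.
      by have := vnorm_vsub_le _ (duhamel B (lim (Q U V)) (Q U V) s)
        (duhamel B (lim (Q U' V')) (Q U' V') s); lra.
  have -> : rho * C * wt t = (0 + K * C / (a - eta)) * wt t + K * C / (eta - b) * wt t.
    by rewrite /rho; field; lra.
  lra.
have [p1 q1] := PQc _ _ Uc Vc.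
have HU s : s <= 0 -> duhamel A xi (P U V) s = U s.
  by move=> s0; have [<- _] := H s; rewrite /T1 mzE.
have HV s : s <= 0 -> duhamel B (lim (Q U V)) (Q U V) s = V s.
  by move=> s0; have [_ <-] := H s; rewrite /T2 mzE.
exists U, V; split=> //; split=> //; split.
  by exists M => t t0; have := HM t; rewrite /wt mzE.
split; first by rewrite -HU ?duhamel0 //; lra.
by move=> t t0; split; [apply: lin_ode_ext HU _ | apply: lin_ode_ext HV _] => //; apply: duhamel_ode.
Qed.

Lemma bounded_sol_integral_u xi U V : bounded_sol xi U V -> forall t i, t <= 0 ->
  is_RInt (fun s => mulmv (mexp A (t - s)) (p s (U s) (V s)) i) 0 t
    (U t i - mulmv (mexp A t) xi i).
Proof.
move=> [Uc [Vc [_ [U0 H]]]] t i t0.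
have := variation_of_constants _ A U (fun s => p s (U s) (V s)) 0 t i Uc.
rewrite U0 Rminus_0_r; apply; first by case: p_lip => [_ [_ h]]; apply: h.
by rewrite Rmin_right // Rmax_left // => r hr; case: (H r) => //; lra.
Qed.

(** By variation of constants the integral over [[s, t]] misses [V(t)] by exactly [e^{B(t-s)} V(s)],
    which vanishes in the remote past. *)
Lemma bounded_sol_integral_v xi U V : bounded_sol xi U V -> forall t j, t <= 0 ->
  has_int_neginf (fun s => mulmv (mexp B (t - s)) (q s (U s) (V s)) j) t (V t j).
Proof.
move=> [Uc [Vc [W [_ H]]]] t j t0.
have qc : vcadlag (fun s => q s (U s) (V s)) by case: q_lip => [_ [_ h]]; apply: h.
apply/has_int_neginf_lim.
  by apply: (vcadlag_mulmv_mexp _ B (fun s => t - s)) => // s; apply: continuous_sub_l.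
apply/filterlim_RP => e e0.
have [M HM] := weighted_bounded_r _ _ W.
have [T [Tt HT]] := bounded_past _ B b eta M V b_eta HB HM t e t0 e0.
apply/at_minfty_iff; exists T => s sT.
have -> : RInt (fun r => mulmv (mexp B (t - r)) (q r (U r) (V r)) j) s t =
    V t j - mulmv (mexp B (t - s)) (V s) j.
  apply: is_RInt_unique; apply: variation_of_constants => // r.
  by rewrite Rmin_left ?Rmax_right; try lra; move=> hr; case: (H r) => //; lra.
have -> : V t j - mulmv (mexp B (t - s)) (V s) j - V t j = - mulmv (mexp B (t - s)) (V s) j by ring.
rewrite Rabs_Ropp; apply: Rle_lt_trans (coord_le_vnorm _ _ _) _; exact: HT.
Qed.

(** [U] is visibly a [duhamel] function. For [V], let [E] be the [duhamel] function with value [V 0]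
    at 0; the integral equation says that [e^{B(t-s)} E(s)] tends to [E(t) - V(t)]. At [t = 0] this
    limit is 0, and applying [e^{Bt}] makes it 0 for every [t], so [E = V]. *)
Lemma integral_bounded_sol xi U V : vcont U -> vcont V -> weighted_bounded U V ->
  (forall t i, t <= 0 -> is_RInt (fun s => mulmv (mexp A (t - s)) (p s (U s) (V s)) i) 0 t
    (U t i - mulmv (mexp A t) xi i)) ->
  (forall t j, t <= 0 ->
    has_int_neginf (fun s => mulmv (mexp B (t - s)) (q s (U s) (V s)) j) t (V t j)) ->
  bounded_sol xi U V.
Proof.
move=> Uc Vc W HU HV.
have pc : vcadlag (fun s => p s (U s) (V s)) by case: p_lip => [_ [_ h]]; apply: h.
have qc : vcadlag (fun s => q s (U s) (V s)) by case: q_lip => [_ [_ h]]; apply: h.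
pose D := duhamel A xi (fun s => p s (U s) (V s)).
pose E := duhamel B (V 0) (fun s => q s (U s) (V s)).
have DU t : t <= 0 -> D t = U t.
  move=> t0; apply: functional_extensionality => i.
  have h1 := is_RInt_unique _ _ _ _ (HU t i t0).
  have := is_RInt_unique _ _ _ _ (variation_of_constants _ A D (fun s => p s (U s) (V s)) 0 t i
    (duhamel_vcont A xi _ pc) pc (fun r _ => duhamel_ode A xi _ pc r)).
  by rewrite Rminus_0_r h1 /D duhamel0; lra.
have lim t j (t0 : t <= 0) : filterlim (fun s => mulmv (mexp B (t - s)) (E s) j) (Rbar_locally m_infty)
    (locally (E t j - V t j)).
  have := HV t j t0; move/has_int_neginf_lim => h.
  have {}h := h (vcadlag_mulmv_mexp _ B (fun s => t - s) _ (continuous_sub_l t) qc j).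
  apply: (filterlim_ext (fun s => E t j - RInt (fun r => mulmv (mexp B (t - r)) (q r (U r) (V r)) j) s t)).
    move=> s.
    rewrite (is_RInt_unique _ _ _ _ (variation_of_constants _ B E (fun s => q s (U s) (V s)) s t j
      (duhamel_vcont B (V 0) _ qc) qc (fun r _ => duhamel_ode B (V 0) _ qc r))).
    ring.
  by apply: filterlim_subR; [apply: filterlim_const | exact: h].
have EV t : t <= 0 -> E t = V t.
  move=> t0; apply: functional_extensionality => j.
  have h1 : filterlim (fun s => mulmv (mexp B (t - s)) (E s) j) (Rbar_locally m_infty) (locally 0).
    have -> : 0 = mulmv (mexp B t) (vsub (E 0) (V 0)) j.
      by rewrite /E duhamel0 vsubxx /mulmv rsum_eq0 // => k; ring.
    apply: (filterlim_ext (fun s => mulmv (mexp B t) (mulmv (mexp B (0 - s)) (E s)) j)).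
      by move=> s; rewrite mexp_add; congr (mulmv (mexp B _) _ j); ring.
    apply: filterlim_rsum => k; apply: filterlim_mulR; first exact: filterlim_const.
    by apply: lim; lra.
  pose proof (filterlim_locally_unique _ _ _ h1 (lim t j t0)); lra.
split=> //; split=> //; split=> //; split.
  by rewrite -DU /D ?duhamel0 //; lra.
by move=> t t0; split; [apply: lin_ode_ext DU _ | apply: lin_ode_ext EV _] => //; apply: duhamel_ode.
Qed.

End BoundedSolutions.

(** * The random equation and its unstable fibers *)

(** [g s] may return to [g t] arbitrarily close to [t], so the difference quotient of [f] is
    completed by [l'] at [g t] and becomes a continuous factor there. *)
Lemma rder_comp (f g : R -> R) t l l' :
  rder g t l -> is_derive f (g t) l' -> rder (fun s => f (g s)) t (l' * l).
Proof.
move=> gd /is_derive_Reals fd.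
pose slope y := if Req_dec_T y (g t) then l' else (f y - f (g t)) / (y - g t).
have slope_t : slope (g t) = l' by rewrite /slope; case: Req_dec_T.
have sc : continuous slope (g t).
  apply/continuous_RP => e e0; have [d Hd] := fd e e0.
  exists d; split=> [|y hy]; first exact: cond_pos.
  rewrite slope_t /slope; case: Req_dec_T => [_|ne] /=; first by rewrite Rminus_diag Rabs_R0.
  have := Hd (y - g t) ltac:(lra) hy.
  by have -> : g t + (y - g t) = y by ring.
pose proof (filterlim_mulR _ _ _ _ (filterlim_compR _ _ _ (rder_right_cont _ _ _ gd) sc) gd) as H.
rewrite slope_t in H; apply: filterlim_ext H => s /=.
rewrite /slope; case: Req_dec_T => [E|ne] /=; first by rewrite E /Rdiv; ring.
by rewrite /Rdiv Rmult_assoc -(Rmult_assoc (/ (g s - g t))) Rinv_l ?Rmult_1_l //; lra.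
Qed.

Lemma is_RInt_scalR (h : R -> R) c s t I :
  is_RInt h s t I -> is_RInt (fun x => c * h x) s t (c * I).
Proof. by move=> H; apply: (is_RInt_scal h s t c I H). Qed.

Lemma has_int_neginf_scal (h : R -> R) c b I :
  has_int_neginf h b I -> has_int_neginf (fun x => c * h x) b (c * I).
Proof.
move=> [H1 H2]; split=> [s sb|e e0].
  have [J /has_intP HJ] := H1 s sb; exists (c * J).
  by apply/has_intP; apply: is_RInt_scalR.
have e1 : e / (Rabs c + 1) > 0 by apply: Rdiv_lt_0_compat => //; have := Rabs_pos c; lra.
have [M HM] := H2 _ e1; exists M => s J sM sb /has_intP HJ.
have [J' HJ'] := H1 s sb.
have E : J = c * J'.
  rewrite -(is_RInt_unique _ _ _ _ HJ); apply: is_RInt_unique; apply: is_RInt_scalR.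
  exact/has_intP.
have := HM s J' sM sb HJ'; have c0 := Rabs_pos c.
have -> : J - c * I = c * (J' - I) by rewrite E; ring.
rewrite Rabs_mult => h1.
apply: (Rle_lt_trans _ ((Rabs c + 1) * Rabs (J' - I))).
  by have := Rabs_pos (J' - I); nra.
have -> : e = (Rabs c + 1) * (e / (Rabs c + 1)) by field; lra.
by apply: Rmult_lt_compat_l; lra.
Qed.

Lemma integral_curve_continuous (h F : R -> R) c :
  (forall t, is_RInt h 0 t (F t - c)) -> forall t, continuous F t.
Proof.
move=> H t.
have hi x y : ex_RInt h x y.
  by apply: (ex_RInt_Chasles _ _ 0); [apply: ex_RInt_swap|]; eexists; apply: H.
apply: (continuous_ext (fun s => c + RInt h 0 s)).
  by move=> s; rewrite (is_RInt_unique _ _ _ _ (H s)) /=; ring.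
by apply: filterlim_addR; [apply: filterlim_const | apply: RInt_primitive_continuous].
Qed.

Lemma integral_curve_rder (h F : R -> R) c : cadlag h ->
  (forall t, is_RInt h 0 t (F t - c)) -> forall t, rder F t (h t).
Proof.
move=> hc H t.
have := rder_add _ _ _ _ _ (rder_const c t) (RInt_primitive_rder h 0 t hc).
rewrite Rplus_0_l; apply: (rder_ext _ _ _ _ 1); first lra.
by move=> s _; rewrite (is_RInt_unique _ _ _ _ (H s)); ring.
Qed.

Lemma filterlim_lipschitz {T} (F : (T -> Prop) -> Prop) {FF : Filter F} n m k K
    (f : vec n -> vec m -> vec k) (x : T -> vec n) (y : T -> vec m) x0 y0 : 0 <= K ->
  (forall x1 y1 x2 y2,
     vnorm (vsub (f x1 y1) (f x2 y2)) <= K * (vnorm (vsub x1 x2) + vnorm (vsub y1 y2))) ->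
  (forall i, filterlim (fun s => x s i) F (locally (x0 i))) ->
  (forall j, filterlim (fun s => y s j) F (locally (y0 j))) ->
  forall i, filterlim (fun s => f (x s) (y s) i) F (locally (f x0 y0 i)).
Proof.
move=> K0 H hx hy i; apply/filterlim_RP => e e0.
pose d := e / (2 * (K + 1)).
have d0 : 0 < d by apply: Rdiv_lt_0_compat; lra.
have Z k' (z : T -> vec k') z0 : (forall i, filterlim (fun s => z s i) F (locally (z0 i))) ->
    F (fun s => vnorm (vsub (z s) z0) < d).
  move=> hz; apply: (filterlim_vnorm0 F k' (fun s => vsub (z s) z0)) => // j.
  rewrite -(Rminus_diag (z0 j)); apply: filterlim_subR; [exact: hz | exact: filterlim_const].
pose proof (filter_and _ _ (Z _ _ _ hx) (Z _ _ _ hy)) as near; move: near.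
apply: filter_imp => s [h1 h2].
apply: Rle_lt_trans (coord_le_vnorm _ (vsub (f (x s) (y s)) (f x0 y0)) i) _.
apply: Rle_lt_trans (H _ _ _ _) _.
have -> : e = (K + 1) * (d + d) by rewrite /d; field; lra.
have := vnorm_ge0 _ (vsub (x s) x0); have := vnorm_ge0 _ (vsub (y s) y0); nra.
Qed.

Lemma vscaleA n c d (x : vec n) : vscale c (vscale d x) = vscale (c * d) x.
Proof. by apply: functional_extensionality => i; rewrite /vscale; ring. Qed.

Lemma vscale_exp0 n r (x : vec n) : r = 0 -> vscale (exp r) x = x.
Proof. by move=> ->; apply: functional_extensionality => i; rewrite /vscale exp_0; ring. Qed.

Lemma vscale_expK n r r' (x : vec n) : r + r' = 0 -> vscale (exp r) (vscale (exp r') x) = x.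
Proof. by move=> E; rewrite vscaleA -exp_plus; apply: vscale_exp0. Qed.

Lemma vscale_vsub n c (x y : vec n) : vscale c (vsub x y) = vsub (vscale c x) (vscale c y).
Proof. by apply: functional_extensionality => i; rewrite /vscale /vsub; ring. Qed.

Lemma vscale_vadd n c (x y : vec n) : vscale c (vadd x y) = vadd (vscale c x) (vscale c y).
Proof. by apply: functional_extensionality => i; rewrite /vscale /vadd; ring. Qed.

Lemma vcont_vscale_exp n (r : R -> R) (U : R -> vec n) :
  (forall t, continuous r t) -> vcont U -> vcont (fun s => vscale (exp (r s)) (U s)).
Proof.
move=> rc Uc i t; apply: filterlim_mulR; last exact: Uc.
by apply: (filterlim_compR r exp); [apply: rc | apply: continuous_exp].
Qed.

(** Rescaling the state by [e^r] only shifts the noise level from [z] to [z + r]; the transformed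
    nonlinearity is therefore again of the form [Fw]. *)
Lemma Fw_vscale n m k (f : vec n -> vec m -> vec k) z r x y :
  Fw f z (vscale (exp r) x) (vscale (exp r) y) = vscale (exp r) (Fw f (z + r) x y).
Proof.
rewrite /Fw !vscaleA -!exp_plus; congr (vscale (exp _) _); ring.
Qed.

(** The factors [e^{-zeta}] and [e^{zeta}] cancel, which preserves [K]. For the càdlàg clause a
    single limit statement over a filter serves from both sides, with the left limit of [zeta] in
    place of its value on the left. *)
Lemma lip_nonlin_Fw n m k K (f : vec n -> vec m -> vec k) (zeta : R -> R) : 0 <= K ->
  f (fun _ => 0) (fun _ => 0) = (fun _ => 0) ->
  (forall x1 y1 x2 y2,
     vnorm (vsub (f x1 y1) (f x2 y2)) <= K * (vnorm (vsub x1 x2) + vnorm (vsub y1 y2))) ->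
  cadlag zeta -> lip_nonlin K (fun s => Fw f (zeta s)).
Proof.
move=> K0 f0 H /cadlagP zc; split; [|split].
- move=> s x y x' y'; rewrite /Fw -vscale_vsub vnorm_vscale Rabs_right; last first.
    exact/Rle_ge/Rlt_le/exp_pos.
  apply: (Rle_trans _ (exp (- zeta s) * (K * (exp (zeta s) * vnorm (vsub x x') + exp (zeta s) * vnorm (vsub y y'))))).
    apply: Rmult_le_compat_l; first exact/Rlt_le/exp_pos.
    apply: Rle_trans (H _ _ _ _) _.
    rewrite -!vscale_vsub !vnorm_vscale Rabs_right; first exact: Rle_refl.
    exact/Rle_ge/Rlt_le/exp_pos.
  have E : exp (- zeta s) * exp (zeta s) = 1 by rewrite -exp_plus Rplus_opp_l exp_0.
  apply/Req_le; transitivity (exp (- zeta s) * exp (zeta s) * (K * (vnorm (vsub x x') + vnorm (vsub y y')))); first ring.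
  by rewrite E; ring.
- move=> s; have E d c : vscale c (fun _ : 'I_d => 0) = fun _ => 0.
    by apply: functional_extensionality => i; rewrite /vscale; ring.
  by rewrite /Fw !E f0 E.
move=> U V Uc Vc i.
have X (F : (R -> Prop) -> Prop) (FF : Filter F) z0 u0 v0 : filterlim zeta F (locally z0) ->
    (forall i, filterlim (fun s => U s i) F (locally (u0 i))) ->
    (forall i, filterlim (fun s => V s i) F (locally (v0 i))) ->
    filterlim (fun s => Fw f (zeta s) (U s) (V s) i) F (locally (Fw f z0 u0 v0 i)).
  move=> hz hu hv; apply: filterlim_mulR.
    apply: (filterlim_compR zeta (fun z => exp (- z))) => //.
    apply: (filterlim_compR (fun z => - z) exp); last exact: continuous_exp.
    exact: continuous_oppR.
  have he : filterlim (fun s => exp (zeta s)) F (locally (exp z0)).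
    by apply: filterlim_compR hz _; apply: continuous_exp.
  by apply: (filterlim_lipschitz F n m k K f) => // j; apply: filterlim_mulR.
apply/cadlagP => t; have [z1 [L z2]] := zc t; split.
  by apply: X => // j; apply: continuous_at_right; [apply: Uc | apply: Vc].
exists (Fw f L (U t) (V t) i).
by apply: X => // j; apply: continuous_at_left; [apply: Uc | apply: Vc].
Qed.

(** * Removal of the linear noise term by an exponential factor *)

Section Conjugation.
Context (z : R -> R) (zc : cadlag z).

Definition zint (t : R) : R := RInt z 0 t.

Lemma zint0 : zint 0 = 0.
Proof. by rewrite /zint RInt_point. Qed.

Lemma continuous_zint t : continuous zint t.
Proof. by apply: RInt_primitive_continuous => x y; apply: cadlag_ex_RInt. Qed.

Lemma Rint_zint s t : Rint z s t = zint t - zint s.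
Proof.
have hi x y := cadlag_ex_RInt z x y zc.
have E : zint t = zint s + Rint z s t by rewrite Rint_RInt // /zint -(RInt_Chasles z 0 s t).
by rewrite E; ring.
Qed.

Lemma rder_exp_zint c t : rder (fun s => exp (c * zint s)) t (c * z t * exp (c * zint t)).
Proof.
have := rder_comp exp (fun s => c * zint s) t _ _
  (rder_scal c _ _ _ (RInt_primitive_rder z 0 t zc)) (is_derive_exp (c * zint t)).
by congr rder; ring.
Qed.

(** The right derivative of the factor is [- z] times the factor, which cancels the term [z X]. *)
Lemma lin_ode_descale n (F : mat n) (X : R -> vec n) e t :
  vrder X t (fun i => mulmv F (X t) i + e i + z t * X t i) ->
  lin_ode F (vscale (exp (- zint t)) e) (fun s => vscale (exp (- zint s)) (X s)) t.
Proof.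
move=> H i; rewrite mulmv_vscale.
have := rder_mul _ _ _ _ _ (rder_exp_zint (-1) t) (H i).
have E s : -1 * zint s = - zint s by ring.
rewrite E; have -> : -1 * z t * exp (- zint t) * X t i +
  exp (- zint t) * (mulmv F (X t) i + e i + z t * X t i) =
  vadd (vscale (exp (- zint t)) (mulmv F (X t))) (vscale (exp (- zint t)) e) i.
  by rewrite /vadd /vscale; ring.
by apply: (rder_ext _ _ _ _ 1) => [|s _]; [lra | rewrite E].
Qed.

Lemma lin_ode_rescale n (F : mat n) (U : R -> vec n) e t : lin_ode F e U t ->
  vrder (fun s => vscale (exp (zint s)) (U s)) t
    (fun i => mulmv F (vscale (exp (zint t)) (U t)) i + vscale (exp (zint t)) e i
       + z t * vscale (exp (zint t)) (U t) i).
Proof.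
move=> H i; rewrite mulmv_vscale.
have := rder_mul _ _ _ _ _ (rder_exp_zint 1 t) (H i).
have E s : 1 * zint s = zint s by ring.
rewrite E; have -> : 1 * z t * exp (zint t) * U t i +
  exp (zint t) * vadd (mulmv F (U t)) e i =
  vscale (exp (zint t)) (mulmv F (U t)) i + vscale (exp (zint t)) e i
       + z t * vscale (exp (zint t)) (U t) i.
  by rewrite /vadd /vscale; ring.
by apply: (rder_ext _ _ _ _ 1) => [|s _]; [lra | rewrite E].
Qed.

End Conjugation.

Section Fibers.
Context {n m : nat} (A : mat n) (B : mat m) (a b : R).
Context (f : vec n -> vec m -> vec n) (g : vec n -> vec m -> vec m) (K : R) (w : R -> R) (eta : R).
Context (HA : forall t (x : vec n), t <= 0 -> vnorm (mulmv (mexp A t) x) <= exp (a * t) * vnorm x).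
Context (HB : forall t (y : vec m), t >= 0 -> vnorm (mulmv (mexp B t) y) <= exp (b * t) * vnorm y).
Context (Hf0 : f (fun _ => 0) (fun _ => 0) = (fun _ => 0)).
Context (Hg0 : g (fun _ => 0) (fun _ => 0) = (fun _ => 0)).
Context (Hflip : forall x1 y1 x2 y2,
  vnorm (vsub (f x1 y1) (f x2 y2)) <= K * (vnorm (vsub x1 x2) + vnorm (vsub y1 y2))).
Context (Hglip : forall x1 y1 x2 y2,
  vnorm (vsub (g x1 y1) (g x2 y2)) <= K * (vnorm (vsub x1 x2) + vnorm (vsub y1 y2))).
Context (zc : cadlag (Zt w)) (K_ge0 : 0 <= K) (b_eta : b < eta) (eta_a : eta < a).
Context (gap : K * (1 / (eta - b) + 1 / (a - eta)) < 1).

Let z := Zt w.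
Let I := zint z.
Let p (s : R) := Fw f (z s + I s).
Let q (s : R) := Fw g (z s + I s).

Local Lemma zeta_cadlag : cadlag (fun s => z s + I s).
Proof. by apply: cadlag_add => //; apply: cadlag_continuous; apply: continuous_zint. Qed.

Local Lemma p_lip : lip_nonlin K p.
Proof. exact: lip_nonlin_Fw Hf0 Hflip zeta_cadlag. Qed.

Local Lemma q_lip : lip_nonlin K q.
Proof. exact: lip_nonlin_Fw Hg0 Hglip zeta_cadlag. Qed.

Local Lemma I_cont t : continuous I t.
Proof. exact: continuous_zint. Qed.

Local Lemma opp_I_cont t : continuous (fun s => - I s) t.
Proof. by apply: (filterlim_compR I (fun x => - x)); [apply: I_cont | apply: continuous_oppR]. Qed.

Let grow {k} (U : R -> vec k) s : vec k := vscale (exp (I s)) (U s).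
Let shrink {k} (X : R -> vec k) s : vec k := vscale (exp (- I s)) (X s).

Local Lemma rde_cadlag k (F : mat k) (r : vec n -> vec m -> vec k) X Y (W : R -> vec k) i :
  r (fun _ => 0) (fun _ => 0) = (fun _ => 0) ->
  (forall x1 y1 x2 y2,
    vnorm (vsub (r x1 y1) (r x2 y2)) <= K * (vnorm (vsub x1 x2) + vnorm (vsub y1 y2))) ->
  vcont X -> vcont Y -> vcont W ->
  cadlag (fun s => mulmv F (W s) i + Fw r (Zt w s) (X s) (Y s) i + Zt w s * W s i).
Proof.
move=> r0 rl Xc Yc Wc.
have Wd j : cadlag (fun s => W s j) by apply: cadlag_continuous.
apply: cadlag_add; last exact: cadlag_mul.
apply: cadlag_add.
  by apply: cadlag_rsum => j; apply: cadlag_mul => //; apply: cadlag_const.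
by have [_ [_ h]] := lip_nonlin_Fw n m k K r (Zt w) K_ge0 r0 rl zc; apply: (h X Y).
Qed.

Local Lemma rde_pair_ode x0 y0 X Y : is_rde_sol A B f g w x0 y0 X Y ->
  vcont (shrink X) /\ vcont (shrink Y) /\ shrink X 0 = x0 /\ shrink Y 0 = y0 /\
  forall t, pair_ode A B p q (shrink X) (shrink Y) t.
Proof.
move=> [X0 [Y0 H]].
(* Continuity has to come from the bare integral equation: the integrand is càdlàg, and the equation
   differentiable from the right, only once [X] and [Y] are continuous. *)
have Xc : vcont X.
  by move=> i t; apply: integral_curve_continuous => s; apply/has_intP; have [h _] := H s; apply: h.
have Yc : vcont Y.
  by move=> i t; apply: integral_curve_continuous => s; apply/has_intP; have [_ h] := H s; apply: h.
have I0 : - I 0 = 0 by rewrite /I zint0 Ropp_0.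
have XY s : X s = grow (shrink X) s /\ Y s = grow (shrink Y) s.
  by split; rewrite /grow /shrink vscale_expK //; apply: Rplus_opp_r.
split; first exact: vcont_vscale_exp opp_I_cont Xc.
split; first exact: vcont_vscale_exp opp_I_cont Yc.
split; first by rewrite /shrink vscale_exp0.
split; first by rewrite /shrink vscale_exp0.
move=> t; split.
  have -> : p t (shrink X t) (shrink Y t) = vscale (exp (- I t)) (Fw f (z t) (X t) (Y t)).
    have [-> ->] := XY t; rewrite Fw_vscale vscale_expK //; ring.
  apply: lin_ode_descale => // i.
  apply: (integral_curve_rder (fun s => mulmv A (X s) i + Fw f (Zt w s) (X s) (Y s) i + Zt w s * X s i)
    (fun s => X s i) (x0 i)); first exact: rde_cadlag.
  by move=> s; apply/has_intP; have [h _] := H s; apply: h.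
have -> : q t (shrink X t) (shrink Y t) = vscale (exp (- I t)) (Fw g (z t) (X t) (Y t)).
  have [-> ->] := XY t; rewrite Fw_vscale vscale_expK //; ring.
apply: lin_ode_descale => // i.
apply: (integral_curve_rder (fun s => mulmv B (Y s) i + Fw g (Zt w s) (X s) (Y s) i + Zt w s * Y s i)
  (fun s => Y s i) (y0 i)); first exact: rde_cadlag.
by move=> s; apply/has_intP; have [_ h] := H s; apply: h.
Qed.

Local Lemma rde_exists x0 y0 : exists X Y, is_rde_sol A B f g w x0 y0 X Y.
Proof.
have [U [V [Uc [Vc [U0 [V0 H]]]]]] := pair_ode_exists A B K K_ge0 p q p_lip q_lip x0 y0.
have gc k (W : R -> vec k) : vcont W -> vcont (grow W).
  by move=> Wc; apply: vcont_vscale_exp Wc; apply: I_cont.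
have g0 k (W : R -> vec k) : grow W 0 = W 0.
  by rewrite /grow vscale_exp0 // /I zint0.
exists (grow U), (grow V); split; first by rewrite g0.
split; first by rewrite g0.
move=> t; rewrite -{1}U0 -{1}V0 -(g0 _ U) -(g0 _ V); split=> i; apply/has_intP.
  apply: (is_RInt_rder (fun s => grow U s i)); [exact: gc | apply: rde_cadlag => //; exact: gc |].
  move=> s _; rewrite Fw_vscale.
  by apply: (lin_ode_rescale z zc n A U); case: (H s).
apply: (is_RInt_rder (fun s => grow V s i)); [exact: gc | apply: rde_cadlag => //; exact: gc |].
move=> s _; rewrite Fw_vscale.
by apply: (lin_ode_rescale z zc m B V); case: (H s).
Qed.

(** Global existence is what gives the epsilon choice [phi] its meaning; from here on orbits are
    used only through the equation they satisfy. *)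
Local Lemma phi_rde x0 y0 :
  is_rde_sol A B f g w x0 y0 (phi A B f g w x0 y0).1 (phi A B f g w x0 y0).2.
Proof.
rewrite /phi; apply: (epsilon_spec (inhabits ((fun _ _ => 0), (fun _ _ => 0)))
  (fun XY : (R -> vec n) * (R -> vec m) => is_rde_sol A B f g w x0 y0 XY.1 XY.2)).
by have [X [Y H]] := rde_exists x0 y0; exists (X, Y).
Qed.

(** * Fibers through a fixed base point *)

Section Base.
Context (x0 : vec n) (y0 : vec m).

Let Xb := (phi A B f g w x0 y0).1.
Let Yb := (phi A B f g w x0 y0).2.
Let Ub := shrink Xb.
Let Vb := shrink Yb.
Let dp := recenter p Ub Vb.
Let dq := recenter q Ub Vb.
Let bsol := bounded_sol A B eta dp dq.

Local Lemma base_ode : vcont Ub /\ vcont Vb /\ Ub 0 = x0 /\ Vb 0 = y0 /\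
  forall t, pair_ode A B p q Ub Vb t.
Proof. exact: rde_pair_ode (phi_rde x0 y0). Qed.

Local Lemma dp_lip : lip_nonlin K dp.
Proof. by have [h1 [h2 _]] := base_ode; apply: lip_nonlin_recenter p_lip. Qed.

Local Lemma dq_lip : lip_nonlin K dq.
Proof. by have [h1 [h2 _]] := base_ode; apply: lip_nonlin_recenter q_lip. Qed.

Local Lemma grow_shrink k (X : R -> vec k) s : grow (shrink X) s = X s.
Proof. by rewrite /grow /shrink vscale_expK //; ring. Qed.

Local Lemma dF_grow (U : R -> vec n) (V : R -> vec m) s :
  dF A B f g w x0 y0 (grow U s) (grow V s) s = vscale (exp (I s)) (dp s (U s) (V s)).
Proof.
rewrite /dF -/Xb -/Yb -(grow_shrink _ Xb s) -(grow_shrink _ Yb s) -/Ub -/Vb.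
rewrite /grow -!vscale_vadd Fw_vscale (Fw_vscale _ _ _ f (Zt w s) (I s) (Ub s) (Vb s)).
by rewrite -vscale_vsub.
Qed.

Local Lemma dG_grow (U : R -> vec n) (V : R -> vec m) s :
  dG A B f g w x0 y0 (grow U s) (grow V s) s = vscale (exp (I s)) (dq s (U s) (V s)).
Proof.
rewrite /dG -/Xb -/Yb -(grow_shrink _ Xb s) -(grow_shrink _ Yb s) -/Ub -/Vb.
rewrite /grow -!vscale_vadd Fw_vscale (Fw_vscale _ _ _ g (Zt w s) (I s) (Ub s) (Vb s)).
by rewrite -vscale_vsub.
Qed.

(** The factors [e^{I(t)-I(s)}] and [e^{I(s)}] combine to [e^{I(t)}], which does not depend on [s]
    and leaves the integral. The integral system is thus [e^{I(t)}] times one without noise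
    factor. *)
Local Lemma kernel_grow k (F : mat k) (e : vec k) s t i :
  exp (Rint (Zt w) s t) * mulmv (mexp F (t - s)) (vscale (exp (I s)) e) i =
  exp (I t) * mulmv (mexp F (t - s)) e i.
Proof.
rewrite mulmv_vscale /vscale -Rmult_assoc -exp_plus Rint_zint //.
by congr (exp _ * _); rewrite /I /z; ring.
Qed.

Local Lemma in_Cneg_ext (u u' : R -> vec n) (v v' : R -> vec m) :
  (forall t, t <= 0 -> u t = u' t) -> (forall t, t <= 0 -> v t = v' t) ->
  in_Cneg w eta u v -> in_Cneg w eta u' v'.
Proof.
move=> Eu Ev [cu [cv [M HM]]].
have C k (x x' : R -> vec k) : (forall t, t <= 0 -> x t = x' t) -> cont_neg x -> cont_neg x'.
  move=> E c t t0 e e0; have [d [d0 Hd]] := c t t0 e e0.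
  by exists d; split=> // s s0 hs; rewrite -!E //; apply: Hd.
split; [exact: C cu | split; first exact: C cv].
by exists M => t t0; rewrite -Eu // -Ev //; apply: HM.
Qed.

Local Lemma wgtE t : wgt w eta t = exp (- (eta * t)) * exp (- I t).
Proof.
by rewrite /wgt Rint_zint // zint0 -exp_plus; congr exp; rewrite /I /z; ring.
Qed.

Local Lemma vcont_cont_neg k (x : R -> vec k) : vcont x -> cont_neg x.
Proof.
move=> xc t t0 e e0.
have := filterlim_vnorm0 (locally t) k (fun s => vsub (x s) (x t)).
case/(_ _ _ e e0) => [i|d Hd].
  rewrite -(Rminus_diag (x t i)); apply: filterlim_subR; [exact: xc | exact: filterlim_const].
by exists d; split=> [|s s0 hs]; [apply: cond_pos | apply: Hd].
Qed.

Local Lemma in_Cneg_grow (U : R -> vec n) (V : R -> vec m) :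
  vcont U -> vcont V -> weighted_bounded eta U V -> in_Cneg w eta (grow U) (grow V).
Proof.
move=> Uc Vc [M HM].
split; [|split]; try by apply: vcont_cont_neg; apply: vcont_vscale_exp => //; apply: I_cont.
exists M => t t0; rewrite wgtE.
have E k (x : vec k) : exp (- (eta * t)) * exp (- I t) * vnorm (vscale (exp (I t)) x) =
   exp (- (eta * t)) * vnorm x.
  rewrite vnorm_vscale Rabs_right; last exact/Rle_ge/Rlt_le/exp_pos.
  have -> : exp (- (eta * t)) * exp (- I t) * (exp (I t) * vnorm x) =
    exp (- (eta * t)) * (exp (- I t) * exp (I t)) * vnorm x by ring.
  by rewrite -(exp_plus (- I t)) Rplus_opp_l exp_0; ring.
rewrite /grow !E.
have M1 : exp (- (eta * t)) * (M * exp (eta * t)) = M.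
  have -> : exp (- (eta * t)) * (M * exp (eta * t)) = M * (exp (- (eta * t)) * exp (eta * t)) by ring.
  by rewrite -exp_plus Rplus_opp_l exp_0; ring.
have := HM t t0; have := vnorm_ge0 _ (U t); have := vnorm_ge0 _ (V t) => h1 h2 h3.
by split; rewrite -[X in _ <= X]M1; apply: Rmult_le_compat_l; try lra; apply/Rlt_le/exp_pos.
Qed.

(* [C^-_eta] only controls [t <= 0]; freezing at [0] gives functions continuous on all of [R]. *)
Let freeze {k} (u : R -> vec k) s : vec k := shrink u (Rmin s 0).

Local Lemma freezeE k (u : R -> vec k) s : s <= 0 -> grow (freeze u) s = u s.
Proof. by move=> s0; rewrite -[RHS]grow_shrink /grow /freeze Rmin_left. Qed.

Local Lemma freeze_vcont k (u : R -> vec k) : cont_neg u -> vcont (freeze u).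
Proof.
move=> uc; apply: (vcont_vscale_exp k (fun s => - I (Rmin s 0)) (fun s => u (Rmin s 0))).
  by move=> t; apply: (filterlim_compR (fun s => Rmin s 0) (fun s => - I s)); [apply: continuous_Rmin0 | apply: opp_I_cont].
move=> i t; apply/continuous_RP => e e0.
have [d [d0 Hd]] := uc (Rmin t 0) (Rmin_r _ _) e e0.
have [d' [d'0 Hd']] := proj1 (continuous_RP _ _) (continuous_Rmin0 t) d d0.
exists d'; split=> // s hs.
apply: Rle_lt_trans (coord_le_vnorm _ (vsub (u (Rmin s 0)) (u (Rmin t 0))) i) _.
by apply: Hd; [apply: Rmin_r | apply: Hd'].
Qed.

Local Lemma freeze_bounded (u : R -> vec n) (v : R -> vec m) :
  in_Cneg w eta u v -> weighted_bounded eta (freeze u) (freeze v).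
Proof.
move=> [_ [_ [M HM]]]; exists (M + M) => t t0; have [] := HM t t0; rewrite wgtE.
have F k (x : R -> vec k) : vnorm (freeze x t) = exp (- I t) * vnorm (x t).
  rewrite /freeze Rmin_left // /shrink vnorm_vscale Rabs_right //; exact/Rle_ge/Rlt_le/exp_pos.
rewrite !F.
move=> h1 h2.
have X x : exp (- (eta * t)) * exp (- I t) * x <= M -> exp (- I t) * x <= M * exp (eta * t).
  move=> h; have -> : exp (- I t) * x = exp (- (eta * t)) * exp (- I t) * x * exp (eta * t).
    transitivity (exp (- (eta * t)) * exp (eta * t) * (exp (- I t) * x)); last by ring.
    by rewrite -exp_plus Rplus_opp_l exp_0; ring.
  by apply: Rmult_le_compat_r => //; apply/Rlt_le/exp_pos.
have := X _ h1; have := X _ h2; lra.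
Qed.

Local Lemma exp_I_inv t x : exp (- I t) * (exp (I t) * x) = x.
Proof. by rewrite -Rmult_assoc -exp_plus Rplus_opp_l exp_0; ring. Qed.

Local Lemma LP_bounded_sol xi u v : in_Cneg w eta u v -> is_LP_sol A B f g w x0 y0 xi u v ->
  bsol (vsub xi x0) (freeze u) (freeze v).
Proof.
move=> Cuv H; have [cu [cv _]] := Cuv.
apply: (integral_bounded_sol A B K eta dp dq dp_lip dq_lip).
- exact: freeze_vcont.
- exact: freeze_vcont.
- exact: freeze_bounded.
- move=> t i t0; have [h _] := H t t0; have /has_intP := h i.
  move/(is_RInt_scalR _ (exp (- I t))).
  rewrite Rint_zint // zint0 Rminus_0_r -/z -/I -(freezeE _ u t t0).
  have -> : exp (- I t) * (grow (freeze u) t i - exp (I t) * mulmv (mexp A t) (vsub xi x0) i) =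
     freeze u t i - mulmv (mexp A t) (vsub xi x0) i.
    by rewrite Rmult_minus_distr_l !exp_I_inv.
  apply: is_RInt_ext => s; rewrite Rmin_right // Rmax_left // => hs.
  rewrite -(freezeE _ u s); last lra.
  rewrite -(freezeE _ v s); last lra.
  by rewrite dF_grow kernel_grow exp_I_inv.
- move=> t j t0; have [_ h] := H t t0.
  have := has_int_neginf_scal _ (exp (- I t)) _ _ (h j).
  rewrite -(freezeE _ v t t0) exp_I_inv.
  apply: has_int_neginf_ext => s hs.
  rewrite -(freezeE _ u s); last lra.
  rewrite -(freezeE _ v s); last lra.
  by rewrite dG_grow kernel_grow exp_I_inv.
Qed.

Local Lemma bounded_sol_LP xi U V : bsol (vsub xi x0) U V ->
  in_Cneg w eta (grow U) (grow V) /\ is_LP_sol A B f g w x0 y0 xi (grow U) (grow V).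
Proof.
move=> S; have [Uc [Vc [W _]]] := S; split; first exact: in_Cneg_grow.
move=> t t0; split=> i.
  apply/has_intP.
  have := is_RInt_scalR _ (exp (I t)) _ _ _
    (bounded_sol_integral_u A B K eta dp dq dp_lip _ _ _ S t i t0).
  rewrite Rint_zint // zint0 Rminus_0_r Rmult_minus_distr_l.
  by apply: is_RInt_ext => s _; rewrite dF_grow kernel_grow.
have := has_int_neginf_scal _ (exp (I t)) _ _
  (bounded_sol_integral_v A B b K eta HB b_eta dp dq dq_lip _ _ _ S t i t0).
by apply: has_int_neginf_ext => s _; rewrite dG_grow kernel_grow.
Qed.

Local Lemma bsol_diff xi xi' U V U' V' : bsol xi U V -> bsol xi' U' V' -> forall t, t <= 0 ->
  vnorm (vsub (U t) (U' t)) + vnorm (vsub (V t) (V' t)) <=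
  vnorm (vsub xi xi') / (1 - K * (1 / (eta - b) + 1 / (a - eta))) * exp (eta * t) /\
  vnorm (vsub (V t) (V' t)) <=
  K * (vnorm (vsub xi xi') / (1 - K * (1 / (eta - b) + 1 / (a - eta)))) / (eta - b) * exp (eta * t).
Proof. by move=> S S'; apply: (bounded_sol_diff A B a b K eta HA HB _ _ _ _ dp dq dp_lip dq_lip _ _ _ _ _ _ S S'). Qed.

Local Lemma bsol_unique xi U V U' V' : bsol xi U V -> bsol xi U' V' ->
  forall t, t <= 0 -> U t = U' t /\ V t = V' t.
Proof.
move=> S S' t t0; have [h _] := bsol_diff _ _ _ _ _ _ S S' t t0.
rewrite vsubxx vnorm0 /Rdiv !Rmult_0_l in h.
have := vnorm_ge0 _ (vsub (U t) (U' t)); have := vnorm_ge0 _ (vsub (V t) (V' t)) => h1 h2.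
by split; apply: vsub_eq0; lra.
Qed.

Lemma LP_exists_unique xi : exists uv : (R -> vec n) * (R -> vec m),
  (in_Cneg w eta uv.1 uv.2 /\ is_LP_sol A B f g w x0 y0 xi uv.1 uv.2) /\
  forall uv' : (R -> vec n) * (R -> vec m),
    in_Cneg w eta uv'.1 uv'.2 /\ is_LP_sol A B f g w x0 y0 xi uv'.1 uv'.2 ->
    forall t, t <= 0 -> uv'.1 t = uv.1 t /\ uv'.2 t = uv.2 t.
Proof.
have [U [V S]] := bounded_sol_exists A B a b K eta HA HB b_eta eta_a K_ge0 gap dp dq dp_lip dq_lip (vsub xi x0).
exists (grow U, grow V); split; first exact: bounded_sol_LP.
move=> [u v] /= [Cuv H] t t0.
have [h1 h2] := bsol_unique _ _ _ _ _ (LP_bounded_sol _ _ _ Cuv H) S t t0.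
by split; [rewrite -(freezeE _ u t t0) /grow h1 | rewrite -(freezeE _ v t t0) /grow h2].
Qed.

Let LPu xi := (LPsol A B f g w eta x0 y0 xi).1.
Let LPv xi := (LPsol A B f g w eta x0 y0 xi).2.

Local Lemma LPsol_spec xi :
  in_Cneg w eta (LPu xi) (LPv xi) /\ is_LP_sol A B f g w x0 y0 xi (LPu xi) (LPv xi).
Proof.
rewrite /LPu /LPv /LPsol; apply: (epsilon_spec (inhabits ((fun _ _ => 0), (fun _ _ => 0)))
  (fun uv : (R -> vec n) * (R -> vec m) =>
     in_Cneg w eta uv.1 uv.2 /\ is_LP_sol A B f g w x0 y0 xi uv.1 uv.2)).
by have [uv [H _]] := LP_exists_unique xi; exists uv.
Qed.

(** The integrand of [l] is that of the stable integral equation at [t = 0]; hence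
    [l(xi) = y0 + v(0)]. *)
Lemma l_integrand_improper xi j :
  has_int_neginf (l_integrand A B f g w eta x0 y0 xi j) 0 (LPv xi 0 j).
Proof.
have [_ H] := LPsol_spec xi; have [_ h] := H 0 (Rle_refl 0).
by apply: has_int_neginf_ext (h j) => s _; rewrite /l_integrand Rminus_0_l.
Qed.

Local Lemma LPsol_bsol xi : bsol (vsub xi x0) (freeze (LPu xi)) (freeze (LPv xi)).
Proof. by have [h1 h2] := LPsol_spec xi; apply: LP_bounded_sol. Qed.

Local Lemma lmapE xi : vsub (lmap A B f g w eta x0 y0 xi) y0 = freeze (LPv xi) 0.
Proof.
have -> : freeze (LPv xi) 0 = LPv xi 0.
  rewrite -[RHS]freezeE; last exact: Rle_refl.
  by rewrite /grow vscale_exp0 // /I zint0.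
apply: functional_extensionality => j.
by rewrite /vsub /lmap (Rint_neginf_unique _ _ _ (l_integrand_improper xi j)); ring.
Qed.

(** The stable estimate for two bounded solutions read at [t = 0], where the weight is 1; [y0] and
    [x0] drop out of the differences. *)
Lemma lmap_lipschitz xi1 xi2 :
  vnorm (vsub (lmap A B f g w eta x0 y0 xi1) (lmap A B f g w eta x0 y0 xi2))
  <= K / ((eta - b) * (1 - K * (1 / (eta - b) + 1 / (a - eta)))) * vnorm (vsub xi1 xi2).
Proof.
have E k (x y c : vec k) : vsub x y = vsub (vsub x c) (vsub y c).
  by apply: functional_extensionality => i; rewrite /vsub; ring.
rewrite (E _ _ _ y0) !lmapE.
have [_] := bsol_diff _ _ _ _ _ _ (LPsol_bsol xi1) (LPsol_bsol xi2) 0 (Rle_refl 0).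
rewrite -E Rmult_0_r exp_0 Rmult_1_r => h; apply: Rle_trans h _.
have r0 : 0 < 1 - K * (1 / (eta - b) + 1 / (a - eta)) by lra.
by move: (1 - _) r0 => r r0; apply/Req_le; field; lra.
Qed.

(** The difference of the two orbits, rescaled, solves the recentered equation. If it is bounded,
    uniqueness of bounded solutions identifies it with the integral solution, and time 0 gives [ys].
    Conversely, if [ys] lies on the graph, both have the same values at 0, backward uniqueness makes
    them agree on [t <= 0], and the bound is inherited. *)
Lemma Wfiber_graph xs ys :
  Wfiber A B f g w eta x0 y0 xs ys <-> ys = lmap A B f g w eta x0 y0 xs.
Proof.
pose X := (phi A B f g w xs ys).1; pose Y := (phi A B f g w xs ys).2.
have [Uc [Vc [U0 [V0 H]]]] := rde_pair_ode _ _ _ _ (phi_rde xs ys).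
have [Ubc [Vbc [Ub0 [Vb0 Hb]]]] := base_ode.
pose U s := vsub (shrink X s) (Ub s); pose V s := vsub (shrink Y s) (Vb s).
have Uc' : vcont U by apply: vcont_sub.
have Vc' : vcont V by apply: vcont_sub.
have UE : U 0 = vsub xs x0 by rewrite /U U0 Ub0.
have VE : V 0 = vsub ys y0 by rewrite /V V0 Vb0.
have addsub k (x y : vec k) : vadd (vsub x y) y = x.
  by apply: functional_extensionality => i; rewrite /vadd /vsub; ring.
have ode t : pair_ode A B dp dq U V t.
  have [h1 h2] := pair_ode_sub A B p q _ _ _ _ t (H t) (Hb t).
  by split; rewrite /dp /dq /recenter /U /V !addsub.
have growU s : grow U s = vsub (X s) (Xb s).
  by rewrite /grow /U vscale_vsub -!/(grow _ s) !grow_shrink.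
have growV s : grow V s = vsub (Y s) (Yb s).
  by rewrite /grow /V vscale_vsub -!/(grow _ s) !grow_shrink.
have SL := LPsol_bsol xs; have [Lc [Mc [WL [L0 HL]]]] := SL.
have vinj (x y : vec m) : vsub x y0 = vsub y y0 -> x = y.
  by move=> E; rewrite -(addsub _ x y0) E addsub.
split=> [WF|ysE].
  have WU : weighted_bounded eta U V.
    have [M HM] := freeze_bounded _ _ WF; exists M => t t0; have := HM t t0.
    have F k (Z : R -> vec k) (D : R -> vec k) : (forall s, grow Z s = D s) -> freeze D t = Z t.
      move=> E; rewrite /freeze Rmin_left // /shrink -E /grow vscale_expK //; ring.
    by rewrite (F _ U _ growU) (F _ V _ growV).
  have S : bsol (vsub xs x0) U V by split=> //; split=> //; split=> //; split=> // t _.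
  have [_ h] := bsol_unique _ _ _ _ _ S SL 0 (Rle_refl 0).
  by apply: vinj; rewrite lmapE -h VE.
have same : forall t, t <= 0 -> U t = freeze (LPu xs) t /\ V t = freeze (LPv xs) t.
  apply: (pair_ode_backward_unique A B K K_ge0 dp dq dp_lip dq_lip) => //.
    by rewrite UE L0.
  by rewrite VE ysE lmapE.
have WU : weighted_bounded eta U V.
  by have [M HM] := WL; exists M => t t0; have [-> ->] := same t t0; apply: HM.
by apply: in_Cneg_ext (in_Cneg_grow _ _ Uc' Vc' WU) => t _.
Qed.

End Base.
End Fibers.

Theorem theorem4p1 (n m : nat) (A : mat n) (B : mat m) (a b : R)
  (f : vec n -> vec m -> vec n) (g : vec n -> vec m -> vec m) (K : R)
  (w : R -> R) (eta : R)
  (* (A1) *)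
  (Hb : b < 0) (Ha : 0 < a)
  (HA : forall t (x : vec n), t <= 0 -> vnorm (mulmv (mexp A t) x) <= exp (a * t) * vnorm x)
  (HB : forall t (y : vec m), t >= 0 -> vnorm (mulmv (mexp B t) y) <= exp (b * t) * vnorm y)
  (* (A2) *)
  (Hf0 : f (fun _ => 0) (fun _ => 0) = (fun _ => 0))
  (Hg0 : g (fun _ => 0) (fun _ => 0) = (fun _ => 0))
  (Hflip : forall x1 y1 x2 y2,
      vnorm (vsub (f x1 y1) (f x2 y2)) <= K * (vnorm (vsub x1 x2) + vnorm (vsub y1 y2)))
  (Hglip : forall x1 y1 x2 y2,
      vnorm (vsub (g x1 y1) (g x2 y2)) <= K * (vnorm (vsub x1 x2) + vnorm (vsub y1 y2)))
  (* omega in Omega *)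
  (Hw : in_Omega w)
  (* eta and the gap condition *)
  (Heta0 : 0 < eta) (Hetab : b < eta) (Hetaa : eta < a)
  (Hgap : K * (1 / (eta - b) + 1 / (a - eta)) < 1) :
  forall (x0 : vec n) (y0 : vec m),
    (* unique solution in C^-_eta of the integral system (unique on t <= 0) *)
    (forall xi : vec n,
       exists uv : (R -> vec n) * (R -> vec m),
         (in_Cneg w eta uv.1 uv.2 /\ is_LP_sol A B f g w x0 y0 xi uv.1 uv.2) /\
         forall uv' : (R -> vec n) * (R -> vec m),
           in_Cneg w eta uv'.1 uv'.2 /\ is_LP_sol A B f g w x0 y0 xi uv'.1 uv'.2 ->
           forall t, t <= 0 -> uv'.1 t = uv.1 t /\ uv'.2 t = uv.2 t) /\
    (* the improper integral defining l converges *)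
    (forall (xi : vec n) (j : 'I_m),
       exists I, has_int_neginf (l_integrand A B f g w eta x0 y0 xi j) 0 I) /\
    (* the unstable fiber is the graph of l *)
    (forall (xs : vec n) (ys : vec m),
       Wfiber A B f g w eta x0 y0 xs ys <-> ys = lmap A B f g w eta x0 y0 xs) /\
    (* Lipschitz bound *)
    (forall xi1 xi2 : vec n,
       vnorm (vsub (lmap A B f g w eta x0 y0 xi1) (lmap A B f g w eta x0 y0 xi2))
       <= K / ((eta - b) * (1 - K * (1 / (eta - b) + 1 / (a - eta))))
          * vnorm (vsub xi1 xi2)).
Proof.
have zc : cadlag (Zt w) by case: Hw => [_ [_ [_ [h _]]]].
move=> x0 y0.
case: (Rle_lt_dec 0 K) => K0.
  split; first by move=> xi; apply: (LP_exists_unique A B a b f g K w eta).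
  split; first by move=> xi j; eexists; apply: (l_integrand_improper A B a b f g K w eta).
  split; first by move=> xs ys; apply: (Wfiber_graph A B a b f g K w eta).
  by move=> xi1 xi2; apply: lmap_lipschitz.
(* A negative Lipschitz constant forces all norms to vanish, so [0] is one too. *)
have null (x : vec n) (y : vec m) : vnorm x = 0 /\ vnorm y = 0.
  have := Hflip x y (fun _ => 0) (fun _ => 0); rewrite !vsub0.
  have := vnorm_ge0 _ x; have := vnorm_ge0 _ y.
  have := vnorm_ge0 _ (vsub (f x y) (f (fun _ => 0) (fun _ => 0))); nra.
have Hf1 x1 y1 x2 y2 : vnorm (vsub (f x1 y1) (f x2 y2)) <= 0 * (vnorm (vsub x1 x2) + vnorm (vsub y1 y2)).
  by have [-> _] := null (vsub (f x1 y1) (f x2 y2)) y1; lra.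
have Hg1 x1 y1 x2 y2 : vnorm (vsub (g x1 y1) (g x2 y2)) <= 0 * (vnorm (vsub x1 x2) + vnorm (vsub y1 y2)).
  by have [_ ->] := null x1 (vsub (g x1 y1) (g x2 y2)); lra.
have gap0 : 0 * (1 / (eta - b) + 1 / (a - eta)) < 1 by lra.
have le0 := Rle_refl 0.
split; first by move=> xi; apply: (LP_exists_unique A B a b f g 0 w eta).
split; first by move=> xi j; eexists; apply: (l_integrand_improper A B a b f g 0 w eta).
split; first by move=> xs ys; apply: (Wfiber_graph A B a b f g 0 w eta).
move=> xi1 xi2.
have [-> ->] := null (vsub xi1 xi2) (vsub (lmap A B f g w eta x0 y0 xi1) (lmap A B f g w eta x0 y0 xi2)).
lra.
Qed.
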